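(* Let $u_0:\mathbb{R}\to\mathbb{R}$ be a smooth function with bounded $C^2$ norm such that $0<m\leqslant u_0(x)\leqslant M<\infty$ for all $x\in\mathbb{R}$, where $m,M$ are two positive constants, and let $u_1:\mathbb{R}\to\mathbb{R}$ be a smooth function with bounded $C^1$ norm satisfying $$u_1(x)\geqslant \frac{|u_0'(x)|}{\sqrt{u_0(x)}},\qquad\forall\,x\in\mathbb{R}.$$ Consider the Cauchy problem on $\mathbb{R}^2$ (with coordinates $(x,y)$) $$\frac{\partial^2 g_{ij}}{\partial t^2}=-2R_{ij},\qquad t=0:\ \ g_{ij}=u_0(x)\delta_{ij},\quad \frac{\partial g_{ij}}{\partial t}=u_1(x)\delta_{ij}\qquad(i,j=1,2).$$ (I) The Cauchy problem has a unique smooth solution of the form $g_{ij}=u(t,x)\delta_{ij}$ $(i,j=1,2)$ for all time; moreover, the scalar curvature $R(t,x)$ corresponding to the solution metric $g_{ij}$ remains uniformly bounded, i.e., $$|R(t,x)|\leqslant k,\qquad\forall\,(t,x)\in\mathbb{R}^+\times\mathbb{R},$$ where $k$ is a positive constant depending on $M$, the $C^2$ norm of $u_0$ and the $C^1$ norm of $u_1$, but independent of $t$ and $x$. (II) Suppose furthermore that there exists a positive constant $\varepsilon$ such that $$u_1(x)\geqslant \frac{|u_0'(x)|}{\sqrt{u_0(x)}}+\varepsilon,\qquad\forall\,x\in\mathbb{R}.$$ Then the Cauchy problem has a unique smooth solution of the form $g_{ij}=u(t,x)\delta_{ij}$ $(i,j=1,2)$ for all time; moreover, the solution metric $g_{ij}$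 converges to one of flat curvature at an algebraic rate $\frac{1}{(1+t)^{\gamma}}$, i.e., $$|R(t,x)|\leqslant\frac{\tilde k}{(1+t)^{\gamma}},\qquad\forall\,(t,x)\in\mathbb{R}^+\times\mathbb{R},$$ where $\gamma\in(1/2,2]$ and $\tilde k$ are two positive constants depending on $\varepsilon$, $M$, the $C^2$ norm of $u_0$ and the $C^1$ norm of $u_1$.
   Context: Here $g_{ij}(t,\cdot)$ is a one-parameter family of Riemannian metrics on $\mathbb{R}^2$, $R_{ij}$ is the Ricci curvature tensor of $g_{ij}(t,\cdot)$, and $\delta_{ij}$ is the Kronecker delta. The equation $\partial_t^2 g_{ij}=-2R_{ij}$ is called the hyperbolic geometric flow. $\mathbb{R}^+$ denotes the range of forward times $t\geqslant 0$. ''Bounded $C^k$ norm'' means that the function and its derivatives up to order $k$ are bounded on $\mathbb{R}$. For a metric of the form $g_{ij}=u\,\delta_{ij}$ with $u>0$, the scalar curvature is $R=-\Delta\ln u/u$, $R_{ij}=\frac12 R g_{ij}$, and the flow equation becomes $u_{tt}-\Delta\ln u=0$.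
   Formalization: The constants k and k̃ may also depend on the lower bound m of u_0, which the statement's list omits; without this the claim fails, e.g. for u_0 = m + sin²x with u_1 constant, where |R| = 2/m² at t = 0, x = 0. *)

(* Defs.v *)
From Stdlib Require Import Reals.
From Coquelicot Require Import Coquelicot.
Open Scope R_scope.

Inductive idx : Set := i1 | i2.

Definition isum (F : idx -> R) : R := F i1 + F i2.

Definition kronecker (i j : idx) : R :=
  match i, j with
  | i1, i1 | i2, i2 => 1
  | _, _ => 0
  end.

Definition tensor2 : Type := idx -> idx -> R -> R -> R.

Definition pd (k : idx) (f : R -> R -> R) (x y : R) : R :=
  match k with
  | i1 => Derive (fun r => f r y) x
  | i2 => Derive (fun r => f x r) y
  end.

Definition riemannian (h : tensor2) : Prop :=
  forall x y : R,
    (forall i j, h i j x y = h j i x y) /\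
    (forall v : idx -> R, (exists i, v i <> 0) ->
       0 < isum (fun i => isum (fun j => h i j x y * v i * v j))).

Definition det_metric (h : tensor2) (x y : R) : R :=
  h i1 i1 x y * h i2 i2 x y - h i1 i2 x y * h i2 i1 x y.

Definition inv_metric (h : tensor2) : tensor2 := fun i j x y =>
  match i, j with
  | i1, i1 => h i2 i2 x y / det_metric h x y
  | i2, i2 => h i1 i1 x y / det_metric h x y
  | _, _ => - h i j x y / det_metric h x y
  end.

(* [christoffel h k i j] is Gamma^k_{ij}. *)
Definition christoffel (h : tensor2) (k i j : idx) (x y : R) : R :=
  / 2 * isum (fun l => inv_metric h k l x y *
    (pd i (h j l) x y + pd j (h i l) x y - pd l (h i j) x y)).

(* Sign convention: round spheres have positive Ricci curvature. *)
Definition ricci (h : tensor2) : tensor2 := fun i j x y =>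
  isum (fun k => pd k (christoffel h k i j) x y
                 - pd j (christoffel h k i k) x y)
  + isum (fun k => isum (fun l =>
      christoffel h k k l x y * christoffel h l i j x y
      - christoffel h k j l x y * christoffel h l i k x y)).

Definition scalar_curvature (h : tensor2) (x y : R) : R :=
  isum (fun i => isum (fun j => inv_metric h i j x y * ricci h i j x y)).

(* Derivative at [t] relative to the half-line [0, +oo): one-sided at t = 0,
   the usual derivative for t > 0.  Values at negative times play no role. *)
Definition is_dt (f : R -> R) (t l : R) : Prop :=
  filterdiff (U := AbsRing_NormedModule R_AbsRing) (V := R_NormedModule)
    f (within (Rle 0) (locally t)) (fun h => scal h l).

Definition dt (f : R -> R) (t : R) : R := iota (is_dt f t).

Definition half_space (p : R * R * R) : Prop := 0 <= fst (fst p).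

(* All partial derivatives of order at most [n] exist and are continuous on the
   closed half-space of points (t, x, y) with t >= 0. *)
Fixpoint class_C (n : nat) (f : R -> R -> R -> R) : Prop :=
  continuous_on half_space (fun p => f (fst (fst p)) (snd (fst p)) (snd p)) /\
  match n with
  | O => True
  | S n' =>
      (forall t x y, 0 <= t ->
         (exists l, is_dt (fun s => f s x y) t l) /\
         ex_derive (fun r => f t r y) x /\
         ex_derive (fun r => f t x r) y) /\
      class_C n' (fun t x y => dt (fun s => f s x y) t) /\
      class_C n' (fun t => pd i1 (f t)) /\
      class_C n' (fun t => pd i2 (f t))
  end.

Definition smooth_family (g : R -> tensor2) : Prop :=
  forall (n : nat) (i j : idx), class_C n (fun t => g t i j).

Definition conformal (u : R -> R -> R) : R -> tensor2 :=
  fun t i j x y => u t x * kronecker i j.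

Definition hgf_solution (u0 u1 : R -> R) (g : R -> tensor2) : Prop :=
  smooth_family g /\
  (forall t, 0 <= t -> riemannian (g t)) /\
  (forall t x y i j, 0 <= t ->
     dt (fun s => dt (fun r => g r i j x y) s) t = - 2 * ricci (g t) i j x y) /\
  (forall x y i j, g 0 i j x y = u0 x * kronecker i j) /\
  (forall x y i j, dt (fun s => g s i j x y) 0 = u1 x * kronecker i j).

Definition unique_conformal_solution (u0 u1 : R -> R) (u : R -> R -> R) : Prop :=
  hgf_solution u0 u1 (conformal u) /\
  forall v : R -> R -> R, hgf_solution u0 u1 (conformal v) ->
    forall t x, 0 <= t -> v t x = u t x.

Definition smooth (f : R -> R) : Prop := forall n x, ex_derive_n f n x.

(* The C^k norm, as the largest of the sup norms of the derivatives of order at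
   most [k] (summing them instead changes it by a factor of at most k + 1). *)
Definition Ck_norm (k : nat) (f : R -> R) : Rbar :=
  Lub_Rbar (fun r => exists j x, (j <= k)%nat /\ r = Rabs (Derive_n f j x)).

Definition initial_data (m M N0 N1 : R) (u0 u1 : R -> R) : Prop :=
  smooth u0 /\ Rbar_le (Ck_norm 2 u0) N0 /\
  (forall x, m <= u0 x <= M) /\
  smooth u1 /\ Rbar_le (Ck_norm 1 u1) N1.

(* Main.v *)
(** The equation is u_tt = (ln u)_xx.  Let w be a potential with w_x = u_t, w_t = u_x / u.  The Riemann
    invariants w + 2 sqrt u and w - 2 sqrt u are constant along the characteristics of speed
    -1/sqrt u and 1/sqrt u.  So if a point of the half-plane is labelled by the feet (alpha, beta) of
    its two backward characteristics, sqrt u becomes the explicit function rp(alpha) - rm(beta) of the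
    data, and the change of coordinates (alpha, beta) -> (t, x) solves a linear Goursat problem with
    known coefficients on beta <= alpha, which is solvable globally.  The sign condition on the data
    says that rp and rm are nondecreasing, which makes this map a diffeomorphism onto t >= 0.

    By positivity of the same linear system, the derivatives A = u_t + u_x / sqrt u and
    B = u_t - u_x / sqrt u of the invariants keep their initial bounds eps <= A, B <= K.  The
    derivatives P of A and Q of B along the opposite characteristics relax towards bounded quantities:
    P_beta = (3 A t_beta / 4u) (A (A - B) / 4u - P), and symmetrically for Q.  As
    u_tt = (P + Q)/4 - (A - B)^2/(16 u), this bounds u_tt, hence the curvature -u_tt/u; when
    A, B >= eps the solution grows linearly in t and the curvature decays like 1/t.

    For uniqueness, a second solution is transported to the characteristic coordinates of the first
    one; there the differences of u, A and B solve a linear system along the coordinate lines with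
    zero data on the diagonal. *)

(* The labels straighten both families of characteristics, which makes the quasilinear equation
   linear. Write sigma = t_alpha and tau = - t_beta; then x_alpha = sigma / sqrt u and x_beta = tau
   / sqrt u. Equality of the mixed derivatives of t and of x forces sigma_beta = - tau_alpha = -
   (rp' tau + rm' sigma) / (2 sqrt u). So no bound has to be continued in time: global existence is
   the solvability of a linear system with bounded coefficients.

   The coefficients make sense only for beta <= alpha. A cut-off extends them smoothly to the plane,
   and all calculus takes place there. Smoothness of every order is obtained at once, from a class
   of functions that contains the solution of the system and is closed under integration,
   restriction to the diagonal and partial derivatives.

   Regularity is needed up to t = 0, which is the boundary of the chart. The inverse function
   theorem is therefore replaced by monotonicity: t increases in alpha and decreases in beta, x
   increases in both, so the chart cannot contract distances by more than a fixed factor on bounded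
   sets. *)
Require Import Defs.
From Stdlib Require Import Reals Lra Lia FunctionalExtensionality ClassicalEpsilon.
From Coquelicot Require Import Coquelicot.
Open Scope R_scope.

(** * Continuity and parametric integrals in two variables *)

(* Coquelicot states some equalities in a carrier that is only convertible to R; ring and field need R. *)
Ltac as_R := match goal with |- @eq _ ?x ?y => change (@eq R x y) end.

Lemma is_derive_const_R (c x : R) : is_derive (fun _ : R => c) x 0.
Proof. auto_derive; trivial. Qed.

Lemma is_derive_plus_R (f g : R -> R) (x l1 l2 : R) :
  is_derive f x l1 -> is_derive g x l2 -> is_derive (fun r => f r + g r) x (l1 + l2).
Proof. apply (is_derive_plus (V := R_NormedModule) f g x l1 l2). Qed.

Lemma is_derive_mult_R (f g : R -> R) (x l1 l2 : R) :
  is_derive f x l1 -> is_derive g x l2 -> is_derive (fun r => f r * g r) x (l1 * g x + f x * l2).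
Proof. intros Hf Hg. apply (is_derive_mult f g x l1 l2 Hf Hg). intros; apply Rmult_comm. Qed.

Lemma is_derive_comp_R (f g : R -> R) (x l1 l2 : R) :
  is_derive f (g x) l1 -> is_derive g x l2 -> is_derive (fun r => f (g r)) x (l2 * l1).
Proof. apply (is_derive_comp f g x l1 l2). Qed.

Lemma is_derive_opp_R (h : R -> R) (x l : R) : is_derive h x l -> is_derive (fun r => - h r) x (- l).
Proof. apply (is_derive_opp h x l). Qed.

Lemma is_derive_div_const (h : R -> R) (x l k : R) : is_derive h x l -> is_derive (fun r => h r / k) x (l / k).
Proof.
  intros D. assert (D' := is_derive_mult_R h (fun _ => / k) x l 0 D (is_derive_const_R _ _)).
  rewrite Rmult_0_r, Rplus_0_r in D'. exact D'.
Qed.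

Lemma is_derive_value (f : R -> R) (x l l' : R) : is_derive f x l -> l = l' -> is_derive f x l'.
Proof. now intros H <-. Qed.

Lemma is_derive_ext_gt (f g : R -> R) (b a l : R) :
  b < a -> (forall y, b < y -> f y = g y) -> is_derive f a l -> is_derive g a l.
Proof.
  intros H E. apply is_derive_ext_loc. apply (filter_imp (fun y => b < y)); [exact E|].
  now apply open_gt.
Qed.

Lemma is_derive_ext_lt (f g : R -> R) (b a l : R) :
  a < b -> (forall y, y < b -> f y = g y) -> is_derive f a l -> is_derive g a l.
Proof.
  intros H E. apply is_derive_ext_loc. apply (filter_imp (fun y => y < b)); [exact E|].
  now apply open_lt.
Qed.

Definition cont2 (f : R -> R -> R) : Prop := forall a b, continuity_2d_pt f a b.

Lemma cont2_fst (f : R -> R -> R) (a b : R) :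
  continuity_2d_pt f a b -> continuous (fun r => f r b) a.
Proof.
  intros H. apply filterlim_locally. intros eps.
  destruct (H eps) as [d Hd]. exists d. intros y Hy.
  apply Hd; [exact Hy|]. rewrite Rminus_diag, Rabs_R0. apply cond_pos.
Qed.

Lemma cont2_snd (f : R -> R -> R) (a b : R) :
  continuity_2d_pt f a b -> continuous (fun r => f a r) b.
Proof.
  intros H. apply filterlim_locally. intros eps.
  destruct (H eps) as [d Hd]. exists d. intros y Hy.
  apply Hd; [|exact Hy]. rewrite Rminus_diag, Rabs_R0. apply cond_pos.
Qed.

Lemma cont2_const (k : R) : cont2 (fun _ _ => k).
Proof. intros a b. apply continuity_2d_pt_const. Qed.
Lemma cont2_id1 : cont2 (fun a _ => a).
Proof. intros a b. apply continuity_2d_pt_id1. Qed.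
Lemma cont2_id2 : cont2 (fun _ b => b).
Proof. intros a b. apply continuity_2d_pt_id2. Qed.
Lemma cont2_plus (f g : R -> R -> R) : cont2 f -> cont2 g -> cont2 (fun a b => f a b + g a b).
Proof. intros Hf Hg a b. now apply continuity_2d_pt_plus. Qed.
Lemma cont2_mult (f g : R -> R -> R) : cont2 f -> cont2 g -> cont2 (fun a b => f a b * g a b).
Proof. intros Hf Hg a b. now apply continuity_2d_pt_mult. Qed.
Lemma cont2_opp (f : R -> R -> R) : cont2 f -> cont2 (fun a b => - f a b).
Proof. intros Hf a b. now apply continuity_2d_pt_opp. Qed.
Lemma cont2_minus (f g : R -> R -> R) : cont2 f -> cont2 g -> cont2 (fun a b => f a b - g a b).
Proof. intros Hf Hg. exact (cont2_plus _ _ Hf (cont2_opp _ Hg)). Qed.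
Lemma cont2_inv (f : R -> R -> R) : cont2 f -> (forall a b, 0 < f a b) -> cont2 (fun a b => / f a b).
Proof. intros Hf Hp a b. apply continuity_2d_pt_inv; [apply Hf|]. specialize (Hp a b). lra. Qed.

Lemma cont2_swap (f : R -> R -> R) : cont2 f -> cont2 (fun a b => f b a).
Proof.
  intros H a b eps. destruct (H b a eps) as [d Hd]. exists d. intros u v Hu Hv. now apply Hd.
Qed.

Lemma cont2_comp1 (f : R -> R) (g : R -> R -> R) :
  (forall x, continuous f x) -> cont2 g -> cont2 (fun a b => f (g a b)).
Proof.
  intros Hf Hg a b. apply continuity_1d_2d_pt_comp; [|apply Hg].
  apply continuity_pt_filterlim, Hf.
Qed.

Lemma cont2_diag (f : R -> R -> R) : cont2 f -> forall a, continuous (fun r => f r r) a.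
Proof.
  intros H a. apply filterlim_locally. intros eps.
  destruct (H a a eps) as [d Hd]. exists d. intros y Hy. now apply Hd.
Qed.

Lemma ex_RInt_cont (f : R -> R) (a b : R) : (forall x, continuous f x) -> ex_RInt f a b.
Proof. intros H. apply (ex_RInt_continuous (V := R_CompleteNormedModule)). auto. Qed.

Lemma RInt_Chasles_R (f : R -> R) (a b c : R) :
  (forall x, continuous f x) -> RInt f a b + RInt f b c = RInt f a c.
Proof. intros H. apply (RInt_Chasles f a b c); now apply ex_RInt_cont. Qed.

Lemma RInt_minus_R (f g : R -> R) (a b : R) :
  (forall x, continuous f x) -> (forall x, continuous g x) ->
  RInt (fun x => f x - g x) a b = RInt f a b - RInt g a b.
Proof. intros Hf Hg. apply (RInt_minus f g a b); now apply ex_RInt_cont. Qed.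

Lemma RInt_swap_R (f : R -> R) (a b : R) :
  (forall x, continuous f x) -> - RInt f a b = RInt f b a.
Proof. intros H. apply (opp_RInt_swap f a b). now apply ex_RInt_cont. Qed.

Lemma abs_RInt_le_between (f : R -> R) (a b M : R) :
  (forall x, continuous f x) ->
  (forall s, Rmin a b <= s <= Rmax a b -> Rabs (f s) <= M) ->
  Rabs (RInt f a b) <= M * Rabs (b - a).
Proof.
  intros Hc HM. destruct (Rle_dec a b) as [h|h].
  - rewrite (Rabs_right (b - a)) by lra. rewrite Rmult_comm.
    apply abs_RInt_le_const; auto using ex_RInt_cont.
    intros t Ht. apply HM. rewrite Rmin_left, Rmax_right; lra.
  - rewrite <- (RInt_swap_R f b a) by auto. rewrite Rabs_Ropp.
    rewrite (Rabs_left (b - a)) by lra. replace (M * - (b - a)) with ((a - b) * M) by ring.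
    apply abs_RInt_le_const; try lra; auto using ex_RInt_cont.
    intros t Ht. apply HM. rewrite Rmin_right, Rmax_left; lra.
Qed.

Lemma is_derive_RInt_upper (f : R -> R) (a b : R) :
  (forall x, continuous f x) -> is_derive (fun r => RInt f a r) b (f b).
Proof.
  intros H. apply (is_derive_RInt f (fun r => RInt f a r) a b); auto.
  apply filter_forall. intros y. apply (RInt_correct (V := R_CompleteNormedModule)), ex_RInt_cont, H.
Qed.

Lemma is_derive_RInt_lower (f : R -> R) (a b : R) :
  (forall x, continuous f x) -> is_derive (fun r => RInt f r b) a (- f a).
Proof.
  intros H. apply (is_derive_RInt' f (fun r => RInt f r b) a b); auto.
  apply filter_forall. intros y. apply (RInt_correct (V := R_CompleteNormedModule)), ex_RInt_cont, H.
Qed.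

(** Uniform continuity gives a radius within which [f] varies by less than 1. Walking from the
    corner [(lo, lo)] in steps of half that radius adds at most 1 per step, and boundedly many steps
    reach every point of the box. *)
Lemma cont2_bounded_box (f : R -> R -> R) (lo hi : R) :
  cont2 f -> lo <= hi ->
  exists N, 0 <= N /\ forall x y, lo <= x <= hi -> lo <= y <= hi -> Rabs (f x y) <= N.
Proof.
  intros Hf Hle.
  destruct (uniform_continuity_2d f lo hi lo hi (fun x y _ _ => Hf x y) (mkposreal 1 Rlt_0_1))
    as [d Hd]. simpl in Hd.
  pose proof (cond_pos d) as Hdp.
  assert (Hn : forall n : nat, forall x y, lo <= x <= hi -> lo <= y <= hi ->
    x - lo <= INR n * (d / 2) -> y - lo <= INR n * (d / 2) ->
    Rabs (f x y) <= Rabs (f lo lo) + INR n).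
  { induction n as [|n IH]; intros x y Hx Hy Hxn Hyn.
    - simpl in *. replace x with lo by lra. replace y with lo by lra. lra.
    - rewrite S_INR in *.
      (* One step back towards the corner, clamped at [lo]; half the radius keeps the distance
         strictly below it. *)
      set (x' := Rmax lo (x - d / 2)). set (y' := Rmax lo (y - d / 2)).
      assert (Hx' : lo <= x' <= hi /\ x' - lo <= INR n * (d / 2) /\ Rabs (x - x') < d).
      { unfold x', Rmax. pose proof (pos_INR n). destruct Rle_dec; repeat split; try nra;
        rewrite Rabs_pos_eq; lra. }
      assert (Hy' : lo <= y' <= hi /\ y' - lo <= INR n * (d / 2) /\ Rabs (y - y') < d).
      { unfold y', Rmax. pose proof (pos_INR n). destruct Rle_dec; repeat split; try nra;
        rewrite Rabs_pos_eq; lra. }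
      destruct Hx' as (? & ? & ?). destruct Hy' as (? & ? & ?).
      specialize (IH x' y' ltac:(assumption) ltac:(assumption) ltac:(assumption) ltac:(assumption)).
      specialize (Hd x' y' x y ltac:(assumption) ltac:(assumption) Hx Hy ltac:(assumption) ltac:(assumption)).
      pose proof (Rabs_triang (f x y - f x' y') (f x' y')) as Ht.
      replace (f x y - f x' y' + f x' y') with (f x y) in Ht by ring. lra. }
  destruct (nfloor_ex ((hi - lo) / (d / 2))) as [n Hfl].
  { apply Rle_div_r; lra. }
  exists (Rabs (f lo lo) + INR (S n)). split.
  { pose proof (Rabs_pos (f lo lo)); pose proof (pos_INR (S n)); lra. }
  intros x y Hx Hy.
  assert (hi - lo <= INR (S n) * (d / 2)).
  { rewrite S_INR. destruct Hfl as [_ Hfl]. apply (Rlt_div_l (hi - lo) (INR n + 1) (d / 2)) in Hfl; lra. }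
  apply Hn; try assumption; lra.
Qed.

Lemma cont2_RInt_fst (f : R -> R -> R) :
  cont2 f -> cont2 (fun a b => RInt (fun s => f a s) b a).
Proof.
  intros Hf a0 b0 eps.
  assert (Hc : forall a x, continuous (fun s => f a s) x) by (intros; apply cont2_snd, Hf).
  assert (He : forall a x y, ex_RInt (fun s => f a s) x y) by (intros; apply ex_RInt_cont, Hc).
  set (lo := Rmin a0 b0 - 1). set (hi := Rmax a0 b0 + 1).
  assert (Hab : lo + 1 <= a0 <= hi - 1 /\ lo + 1 <= b0 <= hi - 1).
  { unfold lo, hi. pose proof (Rmin_l a0 b0); pose proof (Rmin_r a0 b0).
    pose proof (Rmax_l a0 b0); pose proof (Rmax_r a0 b0). lra. }
  destruct (cont2_bounded_box f lo hi Hf ltac:(lra)) as [N [HN0 HN]].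
  set (L := Rabs (a0 - b0)). pose proof (Rabs_pos (a0 - b0) : 0 <= L).
  pose proof (cond_pos eps) as Hep.
  assert (He1 : 0 < eps / (4 * (L + 1))) by (apply Rdiv_lt_0_compat; lra).
  destruct (uniform_continuity_2d f lo hi lo hi (fun x y _ _ => Hf x y) (mkposreal _ He1))
    as [d Hd]. simpl in Hd. pose proof (cond_pos d) as Hdp.
  assert (He2 : 0 < eps / (4 * (N + 1))) by (apply Rdiv_lt_0_compat; lra).
  assert (Hde : 0 < Rmin d (Rmin 1 (eps / (4 * (N + 1))))) by (repeat apply Rmin_pos; lra).
  exists (mkposreal _ Hde). simpl. intros a b Ha Hb.
  assert (Ha' : Rabs (a - a0) < d /\ Rabs (a - a0) < 1 /\ Rabs (a - a0) < eps / (4 * (N + 1))).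
  { revert Ha. unfold Rmin. repeat destruct Rle_dec; lra. }
  assert (Hb' : Rabs (b - b0) < d /\ Rabs (b - b0) < 1 /\ Rabs (b - b0) < eps / (4 * (N + 1))).
  { revert Hb. unfold Rmin. repeat destruct Rle_dec; lra. }
  destruct Ha' as (Ha1 & Ha2 & Ha3). destruct Hb' as (Hb1 & Hb2 & Hb3).
  apply Rabs_def2 in Ha2 as Ha4. apply Rabs_def2 in Hb2 as Hb4.
  (* The endpoints move with the parameters. The increment splits into one piece at each end,
     bounded by the supremum of [f] times its length, and a change of integrand over the fixed
     interval, small by uniform continuity. *)
  assert (Heq : RInt (fun s => f a s) b a - RInt (fun s => f a0 s) b0 a0 =
     RInt (fun s => f a s) b b0 + RInt (fun s => f a s - f a0 s) b0 a0
     + RInt (fun s => f a s) a0 a).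
  { rewrite (RInt_minus_R (fun s => f a s) (fun s => f a0 s)) by auto.
    rewrite <- (RInt_Chasles_R (fun s => f a s) b b0 a) by auto.
    rewrite <- (RInt_Chasles_R (fun s => f a s) b0 a0 a) by auto.
    ring. }
  rewrite Heq.
  assert (B1 : Rabs (RInt (fun s => f a s) b b0) <= N * Rabs (b0 - b)).
  { apply abs_RInt_le_between; auto. intros s Hs. apply HN; try lra.
    revert Hs. unfold Rmin, Rmax. repeat destruct Rle_dec; lra. }
  assert (B3 : Rabs (RInt (fun s => f a s) a0 a) <= N * Rabs (a - a0)).
  { apply abs_RInt_le_between; auto. intros s Hs. apply HN; try lra.
    revert Hs. unfold Rmin, Rmax. repeat destruct Rle_dec; lra. }
  assert (B2 : Rabs (RInt (fun s => f a s - f a0 s) b0 a0) <= eps / (4 * (L + 1)) * Rabs (a0 - b0)).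
  { apply abs_RInt_le_between.
    - intros x. apply (continuous_minus (fun s => f a s) (fun s => f a0 s)); auto.
    - intros s Hs. apply Rlt_le, Hd; try lra;
      try (rewrite Rminus_diag, Rabs_R0; lra);
      revert Hs; unfold Rmin, Rmax; repeat destruct Rle_dec; lra. }
  rewrite (Rabs_minus_sym b0 b) in B1.
  assert (B2' : eps / (4 * (L + 1)) * Rabs (a0 - b0) <= eps / 4).
  { fold L. replace (eps / (4 * (L + 1)) * L) with (eps / 4 * (L / (L + 1))) by (field; lra).
    assert (L / (L + 1) <= 1) by (apply Rle_div_l; lra). nra. }
  assert (B4 : forall z, 0 <= z -> z < eps / (4 * (N + 1)) -> N * z <= eps / 4).
  { intros z Hz0 Hz. apply Rlt_div_r in Hz; nra. }
  pose proof (B4 _ (Rabs_pos _) Ha3). pose proof (B4 _ (Rabs_pos _) Hb3).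
  pose proof (Rabs_triang (RInt (fun s => f a s) b b0 + RInt (fun s => f a s - f a0 s) b0 a0)
     (RInt (fun s => f a s) a0 a)).
  pose proof (Rabs_triang (RInt (fun s => f a s) b b0) (RInt (fun s => f a s - f a0 s) b0 a0)).
  lra.
Qed.

Lemma cont2_RInt_snd (f : R -> R -> R) :
  cont2 f -> cont2 (fun a b => RInt (fun s => f s b) b a).
Proof.
  intros Hf. pose proof (cont2_swap _ (cont2_RInt_fst _ (cont2_swap _ Hf))) as H.
  intros a b. apply continuity_2d_pt_ext with (fun a b => - RInt (fun s => f s b) a b).
  - intros x y. apply RInt_swap_R. intros z. apply (cont2_fst f z y (Hf z y)).
  - apply continuity_2d_pt_opp, H.
Qed.

Lemma is_derive_RInt_fst (f fa : R -> R -> R) :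
  cont2 f -> cont2 fa -> (forall a b, is_derive (fun r => f r b) a (fa a b)) ->
  forall a b, is_derive (fun r => RInt (fun s => f r s) b r) a
    (f a a + RInt (fun s => fa a s) b a).
Proof.
  intros Hf Hfa Hd a b.
  assert (E : (fun a b => Derive (fun r => f r b) a) = fa).
  { extensionality x; extensionality y. apply is_derive_unique, Hd. }
  assert (E' : forall x y, Derive (fun r => f r y) x = fa x y) by (intros; now rewrite <- E).
  assert (He : forall a x y, ex_RInt (fun s => f a s) x y)
    by (intros; apply ex_RInt_cont; intros; apply cont2_snd, Hf).
  evar (l : R).
  replace (f a a + RInt (fun s => fa a s) b a) with l; [unfold l|].
  - apply (is_derive_RInt_param_bound_comp_aux3 f b (fun r => r) a 1).
    + apply filter_forall; auto.
    + exists (mkposreal 1 Rlt_0_1). apply filter_forall; auto.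
    + auto_derive; trivial.
    + exists (mkposreal 1 Rlt_0_1). apply filter_forall. intros. exists (fa x t). apply Hd.
    + intros t _. rewrite E. apply Hfa.
    + apply locally_2d_forall. intros u v. rewrite E. apply Hfa.
    + apply continuity_pt_filterlim, cont2_snd, Hf.
  - unfold l. rewrite Rmult_1_r, Rplus_comm. f_equal. apply RInt_ext. intros; apply E'.
Qed.

Lemma is_derive_RInt_snd (f fb : R -> R -> R) :
  cont2 f -> cont2 fb -> (forall a b, is_derive (fun r => f a r) b (fb a b)) ->
  forall a b, is_derive (fun r => RInt (fun s => f s r) r a) b
    (- f b b + RInt (fun s => fb s b) b a).
Proof.
  intros Hf Hfb Hd a b.
  pose proof (is_derive_RInt_fst _ _ (cont2_swap _ Hf) (cont2_swap _ Hfb)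
    (fun x y => Hd y x) b a) as H.
  apply is_derive_opp in H. change opp with Ropp in H. cbv beta in H.
  replace (- f b b + RInt (fun s => fb s b) b a) with
    (- (f b b + RInt (fun s => fb s b) a b)).
  - eapply is_derive_ext; [|exact H]. intros t. cbv beta.
    apply RInt_swap_R. intros z. apply (cont2_fst f z t (Hf z t)).
  - rewrite <- (RInt_swap_R (fun s => fb s b) a b); [ring|].
    intros z. apply (cont2_fst fb z b (Hfb z b)).
Qed.

(** The increment is taken along two sides of a rectangle, with the mean value theorem on each. The
    partial derivatives are assumed only near the point, so the lemma also applies in the open
    half-plane t > 0. *)
Lemma differentiable_of_partials (f fa fb : R -> R -> R) (a b : R) :
  locally_2d (fun x y => is_derive (fun r => f r y) x (fa x y) /\
     is_derive (fun r => f x r) y (fb x y)) a b ->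
  continuity_2d_pt fa a b -> continuity_2d_pt fb a b ->
  differentiable_pt_lim f a b (fa a b) (fb a b).
Proof.
  intros [d0 HD] Ca Cb eps.
  assert (He : 0 < eps / 2) by (pose proof (cond_pos eps); lra).
  destruct (Ca (mkposreal _ He)) as [d1 H1]. destruct (Cb (mkposreal _ He)) as [d2 H2].
  simpl in H1, H2.
  assert (Hd : 0 < Rmin d0 (Rmin d1 d2)) by (repeat apply Rmin_pos; apply cond_pos).
  exists (mkposreal _ Hd). simpl. intros u v Hu Hv.
  assert (Hu' : Rabs (u - a) < d0 /\ Rabs (u - a) < d1 /\ Rabs (u - a) < d2).
  { revert Hu. unfold Rmin. repeat destruct Rle_dec; lra. }
  assert (Hv' : Rabs (v - b) < d0 /\ Rabs (v - b) < d1 /\ Rabs (v - b) < d2).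
  { revert Hv. unfold Rmin. repeat destruct Rle_dec; lra. }
  assert (Habs : forall c x y, Rmin y x <= c <= Rmax y x -> Rabs (c - y) <= Rabs (x - y)).
  { intros c x y Hc. revert Hc. unfold Rmin, Rmax. repeat destruct Rle_dec; intros;
    unfold Rabs; repeat destruct Rcase_abs; lra. }
  assert (H0 : forall z (d : posreal), Rabs (z - z) < d)
    by (intros; rewrite Rminus_diag, Rabs_R0; apply cond_pos).
  destruct (MVT_gen (fun r => f r v) a u (fun r => fa r v)) as [c1 [Hc1 E1]].
  { intros x Hx. apply HD; [|tauto]. eapply Rle_lt_trans; [apply (Habs x u a); lra|tauto]. }
  { intros x Hx. apply continuity_pt_filterlim. apply (ex_derive_continuous (fun r => f r v)).
    exists (fa x v). apply HD; [|tauto]. eapply Rle_lt_trans; [apply (Habs x u a); lra|tauto]. }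
  destruct (MVT_gen (fun r => f a r) b v (fun r => fb a r)) as [c2 [Hc2 E2]].
  { intros x Hx. apply HD; [apply H0|]. eapply Rle_lt_trans; [apply (Habs x v b); lra|tauto]. }
  { intros x Hx. apply continuity_pt_filterlim. apply (ex_derive_continuous (fun r => f a r)).
    exists (fb a x). apply HD; [apply H0|]. eapply Rle_lt_trans; [apply (Habs x v b); lra|tauto]. }
  replace (f u v - f a b - (fa a b * (u - a) + fb a b * (v - b))) with
    ((fa c1 v - fa a b) * (u - a) + (fb a c2 - fb a b) * (v - b)) by lra.
  assert (K1 : Rabs (fa c1 v - fa a b) < eps / 2).
  { apply H1; [|tauto]. eapply Rle_lt_trans; [apply (Habs c1 u a Hc1)|tauto]. }
  assert (K2 : Rabs (fb a c2 - fb a b) < eps / 2).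
  { apply H2; [apply H0|]. eapply Rle_lt_trans; [apply (Habs c2 v b Hc2)|tauto]. }
  eapply Rle_trans; [apply Rabs_triang|]. rewrite !Rabs_mult.
  pose proof (Rmax_l (Rabs (u - a)) (Rabs (v - b))).
  pose proof (Rmax_r (Rabs (u - a)) (Rabs (v - b))).
  pose proof (Rabs_pos (u - a)). pose proof (Rabs_pos (v - b)).
  pose proof (Rabs_pos (fa c1 v - fa a b)). pose proof (Rabs_pos (fb a c2 - fb a b)).
  pose proof (cond_pos eps). nra.
Qed.

(** * Comparison lemmas in one variable *)

Lemma le_of_derive (y dy : R -> R) (a b : R) :
  a <= b -> (forall x, a <= x <= b -> continuous y x) ->
  (forall x, a < x < b -> is_derive y x (dy x)) -> (forall x, a < x < b -> 0 <= dy x) -> y a <= y b.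
Proof.
  intros Hab Hc Hd Hp. destruct (Req_dec a b) as [->|Hne]; [lra|].
  (* The mean value theorem may return an endpoint, where the sign of [dy] is unknown. The positive
     part agrees with [dy] inside and is nonnegative everywhere. *)
  destruct (MVT_gen y a b (fun x => Rmax 0 (dy x))) as [c [_ E]].
  - rewrite Rmin_left, Rmax_right by lra. intros x Hx.
    rewrite Rmax_right by (apply Hp; lra). apply Hd; lra.
  - rewrite Rmin_left, Rmax_right by lra. intros x Hx. apply continuity_pt_filterlim, Hc, Hx.
  - pose proof (Rmax_l 0 (dy c)). nra.
Qed.

(** [k exp (L (a - s))] and its opposite are barriers: each is at least as steep as [y], and at
    [s = a] they enclose 0. *)
Lemma bound_of_exp_rate_backward (y dy : R -> R) (k L a b : R) :
  b <= a -> (forall s, b <= s <= a -> continuous y s) ->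
  (forall s, b < s < a -> is_derive y s (dy s)) ->
  (forall s, b < s < a -> Rabs (dy s) <= k * L * exp (L * (a - s))) ->
  0 <= k -> y a = 0 -> Rabs (y b) <= k * exp (L * (a - b)).
Proof.
  intros Hab Hc Hd Hb Hk Ha.
  assert (DW : forall s, is_derive (fun s => k * exp (L * (a - s))) s (- (k * L * exp (L * (a - s))))).
  { intros s. auto_derive; [trivial|]. unfold Rminus. ring. }
  assert (cW : forall s, continuous (fun s => k * exp (L * (a - s))) s).
  { intros s. apply (ex_derive_continuous (V := R_NormedModule)). eexists; apply DW. }
  assert (Hend : exp (L * (a - a)) = 1) by (rewrite Rminus_diag, Rmult_0_r; apply exp_0).
  apply Rabs_le_between. split.
  - assert (L1 : - (y b + k * exp (L * (a - b))) <= - (y a + k * exp (L * (a - a)))); [|rewrite Hend, Ha in L1; lra].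
    apply (le_of_derive (fun s => - (y s + k * exp (L * (a - s))))
      (fun s => - (dy s + - (k * L * exp (L * (a - s)))))); [assumption| | |].
    + intros s Hs. apply (continuous_opp (V := R_NormedModule)).
      apply (continuous_plus (V := R_NormedModule) y); auto.
    + intros s Hs. apply (is_derive_opp (fun s => y s + k * exp (L * (a - s)))).
      apply is_derive_plus_R; auto.
    + intros s Hs. specialize (Hb s Hs). apply Rabs_le_between in Hb. lra.
  - assert (L1 : y b + - (k * exp (L * (a - b))) <= y a + - (k * exp (L * (a - a)))); [|rewrite Hend, Ha in L1; lra].
    apply (le_of_derive (fun s => y s + - (k * exp (L * (a - s))))
      (fun s => dy s + - - (k * L * exp (L * (a - s))))); [assumption| | |].
    + intros s Hs. apply (continuous_plus (V := R_NormedModule) y); auto.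
      apply (continuous_opp (V := R_NormedModule)); auto.
    + intros s Hs. apply is_derive_plus_R; auto.
      apply (is_derive_opp (fun s => k * exp (L * (a - s)))); auto.
    + intros s Hs. specialize (Hb s Hs). apply Rabs_le_between in Hb. lra.
Qed.

Lemma bound_of_exp_rate_forward (y dy : R -> R) (k L a b : R) :
  b <= a -> (forall s, b <= s <= a -> continuous y s) ->
  (forall s, b < s < a -> is_derive y s (dy s)) ->
  (forall s, b < s < a -> Rabs (dy s) <= k * L * exp (L * (s - b))) ->
  0 <= k -> y b = 0 -> Rabs (y a) <= k * exp (L * (a - b)).
Proof.
  intros Hab Hc Hd Hb Hk Ha.
  (* The reflection [s -> - s] reduces this to the backward case. *)
  replace (y a) with ((fun s => y (- s)) (- a)) by (simpl; f_equal; ring).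
  replace (a - b) with (- b - - a) by ring.
  apply (bound_of_exp_rate_backward (fun s => y (- s)) (fun s => -1 * dy (- s)) k L (- b) (- a)); auto.
  - lra.
  - intros s Hs. apply (continuous_comp Ropp y).
    + apply (continuous_opp (V := R_NormedModule) (fun x => x)), continuous_id.
    + apply Hc. lra.
  - intros s Hs.
    assert (D : is_derive (fun x : R => - x) s (-1)) by (auto_derive; [trivial|ring]).
    apply (is_derive_comp_R y Ropp); [apply Hd; lra|exact D].
  - intros s Hs. rewrite Rabs_mult, Rabs_m1, Rmult_1_l.
    replace (- b - s) with (- s - b) by ring. apply Hb. lra.
  - now rewrite Ropp_involutive.
Qed.

(** * A class of smooth functions closed under differentiation *)

Lemma smooth_is_derive (f : R -> R) : smooth f -> forall x, is_derive f x (Derive f x).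
Proof. intros H x. apply Derive_correct. exact (H 1%nat x). Qed.

Lemma smooth_continuous (f : R -> R) : smooth f -> forall x, continuous f x.
Proof. intros H x. apply (ex_derive_continuous (V := R_NormedModule)). exact (H 1%nat x). Qed.

Lemma smooth_Derive (f : R -> R) : smooth f -> smooth (Derive f).
Proof.
  intros H [|n] x; [exact I|].
  apply (ex_derive_ext (Derive_n f (S n))); [|exact (H (S (S n)) x)].
  intros t. pose proof (Derive_n_comp f n 1 t) as E. rewrite Nat.add_1_r in E. now rewrite <- E.
Qed.

(** One closure property replaces an induction that would have to describe every higher derivative:
    a derivative stays in the family, so it can be differentiated again. *)
Lemma smooth_of_family (Fam : (R -> R) -> Prop) :
  (forall f, Fam f -> exists f', Fam f' /\ forall x, is_derive f x (f' x)) ->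
  forall f, Fam f -> smooth f.
Proof.
  intros HF f Hf n.
  assert (Hn : exists h, Fam h /\ Derive_n f n = h).
  { induction n as [|n [h [Hh E]]]; [now exists f|].
    destruct (HF h Hh) as [h' [Hh' D]]. exists h'. split; [assumption|].
    extensionality x. simpl. rewrite E. apply is_derive_unique, D. }
  destruct n as [|n]; [intros; exact I|]. clear Hn.
  assert (Hn : exists h, Fam h /\ Derive_n f n = h).
  { induction n as [|n [h [Hh E]]]; [now exists f|].
    destruct (HF h Hh) as [h' [Hh' D]]. exists h'. split; [assumption|].
    extensionality x. simpl. rewrite E. apply is_derive_unique, D. }
  destruct Hn as [h [Hh E]]. intros x. simpl. rewrite E.
  destruct (HF h Hh) as [h' [_ D]]. exists (h' x). apply D.
Qed.

Lemma smooth_const (c : R) : smooth (fun _ => c).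
Proof.
  apply (smooth_of_family (fun f => exists c, f = fun _ => c)); [|now exists c].
  intros f [c' ->]. exists (fun _ => 0). split; [now exists 0|].
  intros x. apply is_derive_const_R.
Qed.

(** The integrals over [[b, a]] are those of the Goursat operators. Differentiating them at a moving
    end produces diagonal values, hence [sm_diag1] and [sm_diag2]; with these the class is closed
    under partial derivatives, see [sm_partials]. Positivity in [sm_inv] and [sm_sqrt] is required
    on the whole plane, which is why coefficients are cut off. The generators will be the solution
    of the Goursat system, whose derivatives are known only through its equations. *)
Inductive smooth_fn (gen : (R -> R -> R) -> Prop) : (R -> R -> R) -> Prop :=
| sm_gen f : gen f -> smooth_fn gen f
| sm_id1 : smooth_fn gen (fun a b => a)
| sm_id2 : smooth_fn gen (fun a b => b)
| sm_plus f g : smooth_fn gen f -> smooth_fn gen g -> smooth_fn gen (fun a b => f a b + g a b)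
| sm_mult f g : smooth_fn gen f -> smooth_fn gen g -> smooth_fn gen (fun a b => f a b * g a b)
| sm_comp h g : smooth h -> smooth_fn gen g -> smooth_fn gen (fun a b => h (g a b))
| sm_inv g : (forall a b, 0 < g a b) -> smooth_fn gen g -> smooth_fn gen (fun a b => / g a b)
| sm_sqrt g : (forall a b, 0 < g a b) -> smooth_fn gen g -> smooth_fn gen (fun a b => sqrt (g a b))
| sm_RInt1 f : smooth_fn gen f -> smooth_fn gen (fun a b => RInt (fun s => f a s) b a)
| sm_RInt2 f : smooth_fn gen f -> smooth_fn gen (fun a b => RInt (fun s => f s b) b a)
| sm_diag1 f : smooth_fn gen f -> smooth_fn gen (fun a b => f a a)
| sm_diag2 f : smooth_fn gen f -> smooth_fn gen (fun a b => f b b).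

Lemma sm_const gen c : smooth_fn gen (fun a b => c).
Proof. exact (sm_comp gen (fun _ => c) _ (smooth_const c) (sm_id1 gen)). Qed.

Lemma sm_opp gen f : smooth_fn gen f -> smooth_fn gen (fun a b => - f a b).
Proof.
  intros H. replace (fun a b => - f a b) with (fun a b => -1 * f a b)
    by (extensionality a; extensionality b; ring).
  apply sm_mult; auto using sm_const.
Qed.

Lemma sm_minus gen f g : smooth_fn gen f -> smooth_fn gen g -> smooth_fn gen (fun a b => f a b - g a b).
Proof. intros. apply sm_plus; auto using sm_opp. Qed.

Lemma sm_div gen f g : (forall a b, 0 < g a b) -> smooth_fn gen f -> smooth_fn gen g ->
  smooth_fn gen (fun a b => f a b / g a b).
Proof. intros. apply sm_mult; auto using sm_inv. Qed.

Lemma sm_smooth1 gen f : smooth f -> smooth_fn gen (fun a b => f a).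
Proof. intros H. apply (sm_comp gen f (fun a b => a)); auto using sm_id1. Qed.

Lemma sm_smooth2 gen f : smooth f -> smooth_fn gen (fun a b => f b).
Proof. intros H. apply (sm_comp gen f (fun a b => b)); auto using sm_id2. Qed.

Lemma sm_cont gen : (forall f, gen f -> cont2 f) -> forall f, smooth_fn gen f -> cont2 f.
Proof.
  intros Hg f H. induction H.
  - auto.
  - apply cont2_id1.
  - apply cont2_id2.
  - now apply cont2_plus.
  - now apply cont2_mult.
  - apply cont2_comp1; auto using smooth_continuous.
  - now apply cont2_inv.
  - apply cont2_comp1; auto using continuous_sqrt.
  - apply cont2_RInt_fst; auto.
  - apply cont2_RInt_snd; auto.
  - exact (cont2_comp1 _ _ (cont2_diag f IHsmooth_fn) cont2_id1).
  - exact (cont2_comp1 _ _ (cont2_diag f IHsmooth_fn) cont2_id2).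
Qed.

Definition partials (f fa fb : R -> R -> R) : Prop :=
  forall a b, is_derive (fun r => f r b) a (fa a b) /\ is_derive (fun r => f a r) b (fb a b).

Lemma partials_differentiable f fa fb :
  partials f fa fb -> cont2 fa -> cont2 fb ->
  forall a b, differentiable_pt_lim f a b (fa a b) (fb a b).
Proof.
  intros H Ha Hb a b. apply differentiable_of_partials; auto.
  apply locally_2d_forall. intros; apply H.
Qed.

Lemma partials_diag f fa fb :
  partials f fa fb -> cont2 fa -> cont2 fb ->
  forall a, is_derive (fun r => f r r) a (fa a a + fb a a).
Proof.
  intros H Ha Hb a. apply is_derive_Reals.
  replace (fa a a + fb a a) with (fa a a * 1 + fb a a * 1) by ring.
  apply (derivable_pt_lim_comp_2d f (fun r => r) (fun r => r)).
  - now apply partials_differentiable.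
  - apply derivable_pt_lim_id.
  - apply derivable_pt_lim_id.
Qed.

Lemma sm_partials gen :
  (forall f, gen f -> cont2 f) ->
  (forall f, gen f -> exists fa fb, partials f fa fb /\ smooth_fn gen fa /\ smooth_fn gen fb) ->
  forall f, smooth_fn gen f -> exists fa fb, partials f fa fb /\ smooth_fn gen fa /\ smooth_fn gen fb.
Proof.
  intros Hc Hp f H.
  assert (C : forall f, smooth_fn gen f -> cont2 f) by now apply sm_cont.
  induction H.
  - auto.
  - exists (fun _ _ => 1), (fun _ _ => 0). split; [|split; apply sm_const].
    intros a b. split; auto_derive; trivial.
  - exists (fun _ _ => 0), (fun _ _ => 1). split; [|split; apply sm_const].
    intros a b. split; auto_derive; trivial.
  - destruct IHsmooth_fn1 as (fa & fb & P & ? & ?), IHsmooth_fn2 as (ga & gb & Q & ? & ?).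
    exists (fun a b => fa a b + ga a b), (fun a b => fb a b + gb a b).
    split; [|split; apply sm_plus; assumption].
    intros a b. destruct (P a b), (Q a b).
    split; [apply (is_derive_plus_R (fun r => f r b))|apply (is_derive_plus_R (fun r => f a r))]; assumption.
  - destruct IHsmooth_fn1 as (fa & fb & P & ? & ?), IHsmooth_fn2 as (ga & gb & Q & ? & ?).
    exists (fun a b => fa a b * g a b + f a b * ga a b),
      (fun a b => fb a b * g a b + f a b * gb a b).
    split; [|split; apply sm_plus; apply sm_mult; assumption].
    intros a b. destruct (P a b), (Q a b).
    split; [apply (is_derive_mult_R (fun r => f r b) (fun r => g r b))|apply (is_derive_mult_R (fun r => f a r) (fun r => g a r))]; assumption.
  - destruct IHsmooth_fn as (ga & gb & Q & ? & ?).
    exists (fun a b => ga a b * Derive h (g a b)), (fun a b => gb a b * Derive h (g a b)).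
    split; [|split; apply sm_mult; auto using sm_comp, smooth_Derive].
    intros a b. destruct (Q a b).
    split; [apply (is_derive_comp_R h (fun r => g r b))|apply (is_derive_comp_R h (fun r => g a r))];
      auto using smooth_is_derive.
  - destruct IHsmooth_fn as (ga & gb & Q & ? & ?).
    exists (fun a b => - ga a b * (/ g a b * / g a b)), (fun a b => - gb a b * (/ g a b * / g a b)).
    split; [|split; apply sm_mult; auto using sm_opp, sm_mult, sm_inv].
    intros a b. destruct (Q a b). specialize (H a b).
    split.
    + replace (- ga a b * (/ g a b * / g a b)) with (- ga a b / g a b ^ 2) by (field; lra).
      apply (is_derive_inv (fun r => g r b)); auto; lra.
    + replace (- gb a b * (/ g a b * / g a b)) with (- gb a b / g a b ^ 2) by (field; lra).
      apply (is_derive_inv (fun r => g a r)); auto; lra.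
  - destruct IHsmooth_fn as (ga & gb & Q & ? & ?).
    assert (Hs : forall a b, 0 < sqrt (g a b)) by (intros; now apply sqrt_lt_R0).
    exists (fun a b => ga a b * (/ 2 * / sqrt (g a b))), (fun a b => gb a b * (/ 2 * / sqrt (g a b))).
    split; [|split; apply sm_mult; auto using sm_const, sm_mult, sm_inv, sm_sqrt].
    intros a b. destruct (Q a b). specialize (H a b). specialize (Hs a b).
    split.
    + replace (ga a b * (/ 2 * / sqrt (g a b))) with (ga a b / (2 * sqrt (g a b))) by (field; lra).
      apply (is_derive_sqrt (fun r => g r b)); auto.
    + replace (gb a b * (/ 2 * / sqrt (g a b))) with (gb a b / (2 * sqrt (g a b))) by (field; lra).
      apply (is_derive_sqrt (fun r => g a r)); auto.
  - destruct IHsmooth_fn as (fa & fb & P & ? & ?).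
    exists (fun a b => f a a + RInt (fun s => fa a s) b a), (fun a b => - f a b).
    split; [|split; auto using sm_plus, sm_RInt1, sm_diag1, sm_opp].
    intros a b. split.
    + apply is_derive_RInt_fst; auto. intros; apply P.
    + apply (is_derive_RInt_lower (fun s => f a s)). intros x. now apply cont2_snd, C.
  - destruct IHsmooth_fn as (fa & fb & P & ? & ?).
    exists (fun a b => f a b), (fun a b => - f b b + RInt (fun s => fb s b) b a).
    split; [|split; auto using sm_plus, sm_RInt2, sm_diag2, sm_opp].
    intros a b. split.
    + apply (is_derive_RInt_upper (fun s => f s b)). intros x. now apply (cont2_fst f), C.
    + apply is_derive_RInt_snd; auto. intros; apply P.
  - destruct IHsmooth_fn as (fa & fb & P & ? & ?).
    exists (fun a b => fa a a + fb a a), (fun _ _ => 0).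
    split; [|split; auto using sm_plus, sm_diag1, sm_const].
    intros a b. split; [apply partials_diag; auto|apply is_derive_const_R].
  - destruct IHsmooth_fn as (fa & fb & P & ? & ?).
    exists (fun _ _ => 0), (fun a b => fa b b + fb b b).
    split; [|split; auto using sm_plus, sm_diag2, sm_const].
    intros a b. split; [apply is_derive_const_R|apply partials_diag; auto].
Qed.

(** * Smooth cut-off of the identity *)

(** The powers of [/ x] make the family stable under differentiation: the derivative of the k-th
    function combines the next two. *)
Definition flat (k : nat) (x : R) : R :=
  if Rle_dec x 0 then 0 else (/ x) ^ k * exp (- / x).

Lemma flat_nonpos k x : x <= 0 -> flat k x = 0.
Proof. intros H. unfold flat. destruct Rle_dec; [reflexivity|lra]. Qed.

Lemma flat_pos k x : 0 < x -> flat k x = (/ x) ^ k * exp (- / x).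
Proof. intros H. unfold flat. destruct Rle_dec; [lra|reflexivity]. Qed.

(** This is the n-th power of [y <= n exp (y / n)], which follows from [1 + z <= exp z]. *)
Lemma pow_le_exp (n : nat) (y : R) : (0 < n)%nat -> 0 <= y -> y ^ n <= INR n ^ n * exp y.
Proof.
  intros Hn Hy. assert (H0 : 0 < INR n) by now apply lt_0_INR.
  replace (exp y) with (exp (y / INR n) ^ n).
  - rewrite <- Rpow_mult_distr. apply pow_incr. split; [assumption|].
    pose proof (exp_ineq1_le (y / INR n)).
    replace y with (INR n * (y / INR n)) at 1 by (field; lra). nra.
  - assert (E : forall k z, exp z ^ k = exp (INR k * z)).
    { induction k as [|k IH]; intros z; [now rewrite Rmult_0_l, exp_0|].
      rewrite S_INR. simpl. rewrite IH, <- exp_plus. f_equal. ring. }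
    rewrite E. f_equal. field. lra.
Qed.

(** Taking [pow_le_exp] at [/ x] with exponent [k + 2] leaves two spare powers of [x]. A quadratic
    bound is what gives derivative 0 at the origin. *)
Lemma flat_quadratic k x : 0 < x -> Rabs (flat k x) <= INR (k + 2) ^ (k + 2) * x ^ 2.
Proof.
  intros H. rewrite flat_pos by assumption.
  assert (Hi : 0 < / x) by now apply Rinv_0_lt_compat.
  pose proof (pow_le_exp (k + 2) (/ x) ltac:(lia) ltac:(lra)) as B.
  rewrite exp_Ropp. pose proof (exp_pos (/ x)) as He.
  rewrite Rabs_pos_eq.
  - apply Rmult_le_reg_r with ((/ x) ^ 2 * exp (/ x)).
    + apply Rmult_lt_0_compat; [apply pow_lt|]; lra.
    + replace (INR (k + 2) ^ (k + 2) * x ^ 2 * ((/ x) ^ 2 * exp (/ x))) with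
        (INR (k + 2) ^ (k + 2) * exp (/ x)) by (field; lra).
      replace ((/ x) ^ k * / exp (/ x) * ((/ x) ^ 2 * exp (/ x))) with ((/ x) ^ (k + 2)).
      * assumption.
      * rewrite pow_add. field. split; lra.
  - apply Rmult_le_pos; [apply pow_le; lra|]. left. now apply Rinv_0_lt_compat.
Qed.

Lemma is_derive_flat k x : is_derive (flat k) x (flat (k + 2) x - INR k * flat (k + 1) x).
Proof.
  destruct (total_order_T x 0) as [[Hx| ->]|Hx].
  - rewrite !flat_nonpos by lra. replace (0 - INR k * 0) with 0 by ring.
    apply (is_derive_ext_lt (fun _ => 0) _ 0); [assumption| |apply is_derive_const_R].
    intros y Hy. symmetry. apply flat_nonpos. lra.
  - rewrite !flat_nonpos by lra. replace (0 - INR k * 0) with 0 by ring.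
    apply is_derive_Reals. intros eps He.
    set (B := INR (k + 2) ^ (k + 2)).
    assert (HB : 0 < B) by (apply pow_lt, lt_0_INR; lia).
    assert (Hd : 0 < eps / B) by now apply Rdiv_lt_0_compat.
    exists (mkposreal _ Hd). simpl. intros h Hh Hhd.
    rewrite Rplus_0_l, (flat_nonpos k 0) by lra. rewrite !Rminus_0_r.
    destruct (Rle_dec h 0) as [h0|h0].
    + rewrite flat_nonpos by assumption. unfold Rdiv. rewrite Rmult_0_l, Rabs_R0. assumption.
    + assert (Hp : 0 < h) by lra. unfold Rdiv. rewrite Rabs_mult.
      rewrite Rabs_inv, (Rabs_pos_eq h) by lra. rewrite (Rabs_pos_eq h) in Hhd by lra.
      pose proof (flat_quadratic k h Hp) as Q. fold B in Q.
      apply Rle_lt_trans with (B * h ^ 2 * / h).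
      * apply Rmult_le_compat_r; [|assumption]. left. now apply Rinv_0_lt_compat.
      * replace (B * h ^ 2 * / h) with (B * h) by (field; lra).
        apply (Rlt_div_r h eps B) in Hhd; lra.
  - rewrite !flat_pos by lra.
    apply (is_derive_ext_gt (fun y => (/ y) ^ k * exp (- / y)) _ 0); [assumption| |].
    + intros y Hy. symmetry. now apply flat_pos.
    + auto_derive; [lra|].
      rewrite !pow_add. destruct k as [|k].
      * simpl. field. lra.
      * rewrite S_INR. simpl pred. simpl pow. field. lra.
Qed.

(** Just enough terms to write [cut] and to be closed under differentiation, so that
    [smooth_of_family] applies. *)
Inductive flat_algebra : (R -> R) -> Prop :=
| fa_flat k c : flat_algebra (fun s => flat k (c - s))
| fa_const c : flat_algebra (fun _ => c)
| fa_id : flat_algebra (fun s => s)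
| fa_plus f g : flat_algebra f -> flat_algebra g -> flat_algebra (fun s => f s + g s)
| fa_mult f g : flat_algebra f -> flat_algebra g -> flat_algebra (fun s => f s * g s).

Lemma flat_algebra_smooth f : flat_algebra f -> smooth f.
Proof.
  apply smooth_of_family. clear f. intros f H. induction H.
  - exists (fun s => -1 * (flat (k + 2) (c - s) + - INR k * flat (k + 1) (c - s))).
    split; [repeat constructor|]. intros x.
    apply (is_derive_value _ _ (-1 * (flat (k + 2) (c - x) - INR k * flat (k + 1) (c - x)))); [|ring].
    assert (D : is_derive (fun s => c - s) x (-1)) by (auto_derive; [trivial|ring]).
    apply (is_derive_comp_R (flat k) (fun s => c - s)); [apply is_derive_flat|exact D].
  - exists (fun _ => 0). split; [constructor|]. intros x. apply is_derive_const_R.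
  - exists (fun _ => 1). split; [constructor|]. intros x. auto_derive; trivial.
  - destruct IHflat_algebra1 as [f' [? ?]], IHflat_algebra2 as [g' [? ?]].
    exists (fun s => f' s + g' s). split; [now constructor|].
    intros x. apply is_derive_plus_R; auto.
  - destruct IHflat_algebra1 as [f' [? ?]], IHflat_algebra2 as [g' [? ?]].
    exists (fun s => f' s * g s + f s * g' s). split; [repeat constructor; assumption|].
    intros x. apply is_derive_mult_R; auto.
Qed.

(* It lets coefficients such as 1/s, which only make sense for s >= c, be extended smoothly to R. *)
Definition cut (c s : R) : R := s + exp (2 / c) * ((c + -1 * s) * flat 0 (c - s)).

Lemma cut_smooth c : smooth (cut c).
Proof. apply flat_algebra_smooth. unfold cut. repeat constructor. Qed.

Lemma cut_id c s : c <= s -> cut c s = s.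
Proof. intros H. unfold cut. rewrite flat_nonpos by lra. ring. Qed.

(** For [c / 2 <= s <= c] the added term is nonnegative. For [s < c / 2] one has
    [/ (c - s) <= 2 / c], so the prefactor [exp (2 / c)] makes the coefficient of [c - s] at least
    1, and [cut c s >= c]. *)
Lemma cut_lower c s : 0 < c -> c / 2 <= cut c s.
Proof.
  intros Hc. unfold cut. destruct (Rle_dec (c - s) 0) as [h|h].
  - rewrite flat_nonpos by assumption. lra.
  - rewrite flat_pos by lra. simpl. rewrite Rmult_1_l.
    pose proof (exp_pos (2 / c)). pose proof (exp_pos (- / (c - s))).
    destruct (Rle_dec (c - s) (c / 2)) as [h'|h'].
    + assert (0 <= exp (2 / c) * ((c + -1 * s) * exp (- / (c - s)))); [|lra].
      apply Rmult_le_pos; [lra|]. apply Rmult_le_pos; lra.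
    + assert (1 <= exp (2 / c) * exp (- / (c - s))); [|nra].
      rewrite <- exp_plus, <- exp_0. match goal with |- exp ?x <= exp ?y => assert (L : x <= y); [|destruct L as [L|L]; [left; now apply exp_increasing|right; now rewrite L]] end.
      assert (/ (c - s) <= / (c / 2)) by (apply Rinv_le_contravar; lra).
      replace (2 / c) with (/ (c / 2)) by (field; lra). lra.
Qed.

Lemma Derive_cut c s : c < s -> Derive (cut c) s = 1.
Proof.
  intros H. apply is_derive_unique, (is_derive_ext_gt (fun s => s) _ c); [assumption| |].
  - intros y Hy. symmetry. apply cut_id. lra.
  - auto_derive; trivial.
Qed.

(** * Linear Goursat problem *)

(** Integration gains a factor [1 / L] against the exponential weight; with [L = 2 C], multiplying
    by a coefficient of size [C] and integrating becomes a contraction of ratio 1/2. Both orders of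
    [a] and [b] occur because the Goursat system is solved on the whole plane. *)
Lemma RInt_exp_weight (h : R -> R) (a b N L : R) :
  0 < L -> 0 <= N -> (forall x, continuous h x) ->
  (forall s, Rmin a b <= s <= Rmax a b -> Rabs (h s) <= N * exp (L * Rabs (a - s))) ->
  Rabs (RInt h b a) <= N / L * exp (L * Rabs (a - b)).
Proof.
  intros HL HN Hc Hh.
  assert (HNL : 0 <= N / L) by (apply Rdiv_le_0_compat; lra).
  assert (E : N / L * L = N) by (field; lra).
  destruct (Rle_dec b a) as [Hab|Hab].
  - rewrite (Rabs_pos_eq (a - b)) by lra.
    apply (bound_of_exp_rate_backward (fun s => RInt h s a) (fun s => - h s)); auto.
    + intros s _. apply (ex_derive_continuous (V := R_NormedModule)). eexists. now apply is_derive_RInt_lower.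
    + intros s _. now apply is_derive_RInt_lower.
    + intros s Hs. rewrite Rabs_Ropp, E. rewrite <- (Rabs_pos_eq (a - s)) by lra.
      apply Hh. rewrite Rmin_right, Rmax_left; lra.
    + exact (RInt_point a h).
  - rewrite <- (RInt_swap_R h a b) by auto. rewrite Rabs_Ropp, (Rabs_minus_sym a b), (Rabs_pos_eq (b - a)) by lra.
    apply (bound_of_exp_rate_forward (fun s => RInt h a s) h); auto; try lra.
    + intros s _. apply (ex_derive_continuous (V := R_NormedModule)). eexists. now apply is_derive_RInt_upper.
    + intros s _. now apply is_derive_RInt_upper.
    + intros s Hs. rewrite E. rewrite <- (Rabs_pos_eq (s - a)), (Rabs_minus_sym s a) by lra.
      apply Hh. rewrite Rmin_left, Rmax_right; lra.
    + exact (RInt_point a h).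
Qed.

Lemma geometric_limit (x : nat -> R) (D : R) :
  (forall n, Rabs (x (S n) - x n) <= D * (/ 2) ^ n) ->
  exists l, forall n, Rabs (x n - l) <= 2 * D * (/ 2) ^ n.
Proof.
  intros H.
  (* The difference of powers, rather than the final bound [2 D / 2 ^ n], is what lets the induction
     on [k] close. *)
  assert (H2 : forall n k, Rabs (x (n + k)%nat - x n) <= 2 * D * ((/ 2) ^ n - (/ 2) ^ (n + k))).
  { intros n. induction k as [|k IH].
    - rewrite Nat.add_0_r, !Rminus_diag, Rabs_R0. lra.
    - rewrite Nat.add_succ_r. specialize (H (n + k)%nat).
      pose proof (Rabs_triang (x (S (n + k)) - x (n + k)%nat) (x (n + k)%nat - x n)) as T.
      replace (x (S (n + k)) - x (n + k)%nat + (x (n + k)%nat - x n)) with (x (S (n + k)) - x n) in T by ring.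
      simpl pow at 2. lra. }
  assert (HD : 0 <= D) by (specialize (H 0%nat); pose proof (Rabs_pos (x 1%nat - x 0%nat)); simpl in H; lra).
  assert (Hp : forall n, 0 < (/ 2) ^ n) by (intros; apply pow_lt; lra).
  assert (H3 : forall n k, Rabs (x (n + k)%nat - x n) <= 2 * D * (/ 2) ^ n).
  { intros n k. specialize (H2 n k). pose proof (Hp (n + k)%nat). nra. }
  assert (Hz : forall e, 0 < e -> exists n, 2 * D * (/ 2) ^ n < e).
  { intros e He. destruct (pow_lt_1_zero (/ 2) ltac:(rewrite Rabs_pos_eq; lra) (e / (2 * D + 1)))
      as [n Hn]. { apply Rdiv_lt_0_compat; lra. }
    exists n. specialize (Hn n (Nat.le_refl n)). rewrite Rabs_pos_eq in Hn by (left; auto).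
    apply (Rlt_div_r _ e (2 * D + 1)) in Hn; [|lra]. pose proof (Hp n). nra. }
  destruct (Rcomplete.R_complete x) as [l Hl].
  { intros e He. destruct (Hz (e / 2) ltac:(lra)) as [N HN]. exists N. intros n m Hn Hm.
    pose proof (H3 N (n - N)%nat) as A. pose proof (H3 N (m - N)%nat) as B.
    replace (N + (n - N))%nat with n in A by lia. replace (N + (m - N))%nat with m in B by lia.
    unfold Rdist, R_dist. pose proof (Rabs_triang (x n - x N) (x N - x m)) as T.
    rewrite (Rabs_minus_sym (x N) (x m)) in T.
    replace (x n - x N + (x N - x m)) with (x n - x m) in T by ring. lra. }
  exists l. intros n. apply Rnot_lt_le. intros C.
  destruct (Hl (Rabs (x n - l) - 2 * D * (/ 2) ^ n) ltac:(lra)) as [N HN].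
  specialize (HN (n + N)%nat ltac:(lia)). unfold Rdist, R_dist in HN. specialize (H3 n N).
  pose proof (Rabs_triang (x n - x (n + N)%nat) (x (n + N)%nat - l)) as T.
  rewrite (Rabs_minus_sym (x n) (x (n + N)%nat)) in T.
  replace (x n - x (n + N)%nat + (x (n + N)%nat - l)) with (x n - l) in T by ring. lra.
Qed.

(** The convergence is only locally uniform: continuity of [D] bounds it near a given point, and the
    eps/3 argument applies there. *)
Lemma uniform_limit_cont2 (x : nat -> R -> R -> R) (l : R -> R -> R) (D : R -> R -> R) :
  (forall n, cont2 (x n)) -> cont2 D ->
  (forall n a b, Rabs (x n a b - l a b) <= D a b * (/ 2) ^ n) -> cont2 l.
Proof.
  intros Hx HD H a b eps. pose proof (cond_pos eps) as He.
  destruct (HD a b (mkposreal 1 Rlt_0_1)) as [d1 Hd1]. simpl in Hd1.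
  set (M := Rabs (D a b) + 1). assert (HM : 0 < M) by (unfold M; pose proof (Rabs_pos (D a b)); lra).
  assert (Hloc : forall u v, Rabs (u - a) < d1 -> Rabs (v - b) < d1 -> D u v <= M).
  { intros u v Hu Hv. specialize (Hd1 u v Hu Hv). unfold M.
    pose proof (Rle_abs (D u v - D a b)). pose proof (Rle_abs (D a b)). lra. }
  destruct (pow_lt_1_zero (/ 2) ltac:(rewrite Rabs_pos_eq; lra) (eps / (3 * M))) as [n Hn].
  { apply Rdiv_lt_0_compat; lra. }
  specialize (Hn n (Nat.le_refl n)).
  assert (Hp : 0 < (/ 2) ^ n) by (apply pow_lt; lra). rewrite Rabs_pos_eq in Hn by lra.
  apply (Rlt_div_r _ eps (3 * M)) in Hn; [|lra].
  assert (He3 : 0 < eps / 3) by lra.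
  destruct (Hx n a b (mkposreal _ He3)) as [d2 Hd2]. simpl in Hd2.
  assert (Hd : 0 < Rmin d1 d2) by (apply Rmin_pos; apply cond_pos).
  exists (mkposreal _ Hd). simpl. intros u v Hu Hv.
  pose proof (Rmin_l d1 d2). pose proof (Rmin_r d1 d2).
  specialize (Hd2 u v ltac:(lra) ltac:(lra)).
  pose proof (Hloc u v ltac:(lra) ltac:(lra)) as B1.
  assert (B2 : D a b <= M) by (unfold M; pose proof (Rle_abs (D a b)); lra).
  pose proof (H n u v) as A1. pose proof (H n a b) as A2.
  rewrite (Rabs_minus_sym (x n u v)) in A1.
  pose proof (Rabs_triang (l u v - x n u v) (x n u v - x n a b)) as T1.
  pose proof (Rabs_triang (l u v - x n u v + (x n u v - x n a b)) (x n a b - l a b)) as T2.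
  replace (l u v - x n u v + (x n u v - x n a b) + (x n a b - l a b)) with (l u v - l a b) in T2 by ring.
  nra.
Qed.

Section Goursat.
Variables (A B : R -> R -> R) (phi : R -> R) (C Phi : R).
Hypotheses (HA : cont2 A) (HB : cont2 B) (Hphi : forall x, continuous phi x)
  (HC : 0 < C) (HAC : forall a b, Rabs (A a b) <= C) (HBC : forall a b, Rabs (B a b) <= C)
  (HPhi : forall x, Rabs (phi x) <= Phi).

Let I1 (q : R -> R -> R) a b := phi a + RInt (fun s => A a s * q a s) b a.
Let I2 (p : R -> R -> R) a b := phi b + RInt (fun s => B s b * p s b) b a.

Fixpoint picard (n : nat) : (R -> R -> R) * (R -> R -> R) :=
  match n with
  | O => (fun a b => phi a, fun a b => phi b)
  | S n => (I1 (snd (picard n)), I2 (fst (picard n)))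
  end.

Let cont2_phi1 : cont2 (fun a b => phi a).
Proof. exact (cont2_comp1 phi _ Hphi cont2_id1). Qed.

Let cont2_phi2 : cont2 (fun a b => phi b).
Proof. exact (cont2_comp1 phi _ Hphi cont2_id2). Qed.

Let cont2_I1 q : cont2 q -> cont2 (I1 q).
Proof. intros Hq. exact (cont2_plus _ _ cont2_phi1 (cont2_RInt_fst _ (cont2_mult _ _ HA Hq))). Qed.

Let cont2_I2 p : cont2 p -> cont2 (I2 p).
Proof. intros Hp. exact (cont2_plus _ _ cont2_phi2 (cont2_RInt_snd _ (cont2_mult _ _ HB Hp))). Qed.

Let W a b := exp (2 * C * Rabs (a - b)).

(* The weight exp(2C|a-b|) makes both integral operators contractions of ratio 1/2. *)
Let I1_contract q q' N : 0 <= N -> cont2 q -> cont2 q' ->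
  (forall a b, Rabs (q a b - q' a b) <= N * W a b) ->
  forall a b, Rabs (I1 q a b - I1 q' a b) <= N / 2 * W a b.
Proof.
  intros HN Hq Hq' H a b. unfold I1.
  replace (phi a + RInt (fun s => A a s * q a s) b a - (phi a + RInt (fun s => A a s * q' a s) b a))
    with (RInt (fun s => A a s * q a s) b a - RInt (fun s => A a s * q' a s) b a) by ring.
  assert (c1 : forall x, continuous (fun s => A a s * q a s) x)
    by (intros x; apply (cont2_snd (fun a s => A a s * q a s)), cont2_mult; auto).
  assert (c2 : forall x, continuous (fun s => A a s * q' a s) x)
    by (intros x; apply (cont2_snd (fun a s => A a s * q' a s)), cont2_mult; auto).
  rewrite <- RInt_minus_R by auto.
  replace (N / 2) with (C * N / (2 * C)) by (field; lra).
  apply RInt_exp_weight; try nra.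
  - intros x. apply (continuous_minus (V := R_NormedModule)); auto.
  - intros s _. replace (A a s * q a s - A a s * q' a s) with (A a s * (q a s - q' a s)) by ring.
    rewrite Rabs_mult, Rmult_assoc. apply Rmult_le_compat; auto using Rabs_pos.
Qed.

Let I2_contract p p' N : 0 <= N -> cont2 p -> cont2 p' ->
  (forall a b, Rabs (p a b - p' a b) <= N * W a b) ->
  forall a b, Rabs (I2 p a b - I2 p' a b) <= N / 2 * W a b.
Proof.
  intros HN Hp Hp' H a b. unfold I2.
  replace (phi b + RInt (fun s => B s b * p s b) b a - (phi b + RInt (fun s => B s b * p' s b) b a))
    with (RInt (fun s => B s b * p s b) b a - RInt (fun s => B s b * p' s b) b a) by ring.
  assert (c1 : forall x, continuous (fun s => B s b * p s b) x)
    by (intros x; apply (cont2_fst (fun s b => B s b * p s b)), cont2_mult; auto).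
  assert (c2 : forall x, continuous (fun s => B s b * p' s b) x)
    by (intros x; apply (cont2_fst (fun s b => B s b * p' s b)), cont2_mult; auto).
  rewrite <- RInt_minus_R by auto.
  rewrite <- RInt_swap_R, Rabs_Ropp.
  2: intros x; apply (continuous_minus (V := R_NormedModule)); auto.
  replace (N / 2) with (C * N / (2 * C)) by (field; lra). unfold W. rewrite (Rabs_minus_sym a b).
  apply RInt_exp_weight; try nra.
  - intros x. apply (continuous_minus (V := R_NormedModule)); auto.
  - intros s _. replace (B s b * p s b - B s b * p' s b) with (B s b * (p s b - p' s b)) by ring.
    rewrite Rabs_mult, Rmult_assoc. rewrite (Rabs_minus_sym b s).
    apply Rmult_le_compat; auto using Rabs_pos.
Qed.

Let cont2_picard n : cont2 (fst (picard n)) /\ cont2 (snd (picard n)).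
Proof. induction n as [|n [IH1 IH2]]; simpl; auto. Qed.

Let Phi_pos : 0 <= Phi.
Proof. eapply Rle_trans; [apply Rabs_pos|apply (HPhi 0)]. Qed.

Let W_pos a b : 0 < W a b.
Proof. apply exp_pos. Qed.

Let W_ge1 a b : 1 <= W a b.
Proof.
  unfold W. rewrite <- exp_0.
  destruct (Rle_lt_or_eq_dec 0 (2 * C * Rabs (a - b))) as [h|h].
  - pose proof (Rabs_pos (a - b)). nra.
  - left. now apply exp_increasing.
  - right. now rewrite <- h.
Qed.

Let picard_step n a b :
  Rabs (fst (picard (S n)) a b - fst (picard n) a b) <= Phi * (/ 2) ^ n * W a b /\
  Rabs (snd (picard (S n)) a b - snd (picard n) a b) <= Phi * (/ 2) ^ n * W a b.
Proof.
  revert a b. induction n as [|n IH]; intros a b.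
  - simpl. unfold I1, I2.
    (* Both operators send 0 to the boundary data, so the first increment is a contraction estimate
       against the zero function. *)
    assert (Z1 : forall a b, Rabs (phi b - 0) <= Phi * W a b).
    { intros x y. rewrite Rminus_0_r. specialize (HPhi y). specialize (W_ge1 x y). nra. }
    assert (Z2 : forall a b, Rabs (phi a - 0) <= Phi * W a b).
    { intros x y. rewrite Rminus_0_r. specialize (HPhi x). specialize (W_ge1 x y). nra. }
    pose proof (I1_contract (fun a b => phi b) (fun _ _ => 0) Phi Phi_pos cont2_phi2 (cont2_const 0) Z1 a b) as E1.
    pose proof (I2_contract (fun a b => phi a) (fun _ _ => 0) Phi Phi_pos cont2_phi1 (cont2_const 0) Z2 a b) as E2.
    unfold I1 in E1. unfold I2 in E2. pose proof (W_pos a b).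
    rewrite (RInt_ext (fun s => A a s * 0) (fun _ => 0)) in E1 by (intros; apply Rmult_0_r).
    rewrite (RInt_ext (fun s => B s b * 0) (fun _ => 0)) in E2 by (intros; apply Rmult_0_r).
    rewrite RInt_const in E1, E2. unfold scal in E1, E2; simpl in E1, E2.
    unfold mult in E1, E2; simpl in E1, E2. rewrite Rmult_0_r, Rplus_0_r in E1, E2.
    split; nra.
  - change (picard (S (S n))) with (I1 (snd (picard (S n))), I2 (fst (picard (S n)))).
    change (picard (S n)) with (I1 (snd (picard n)), I2 (fst (picard n))) at 2 4.
    cbn [fst snd].
    assert (Hp : 0 <= Phi * (/ 2) ^ n) by (apply Rmult_le_pos; [auto|apply pow_le; lra]).
    destruct (cont2_picard n) as [c1 c2]. destruct (cont2_picard (S n)) as [c3 c4].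
    replace (Phi * (/ 2) ^ (S n)) with (Phi * (/ 2) ^ n / 2) by (simpl; field).
    split.
    + exact (I1_contract _ _ _ Hp c4 c2 (fun a b => proj2 (IH a b)) a b).
    + exact (I2_contract _ _ _ Hp c3 c1 (fun a b => proj1 (IH a b)) a b).
Qed.

Lemma goursat_exists : exists p q : R -> R -> R, cont2 p /\ cont2 q /\
  (forall a b, p a b = phi a + RInt (fun s => A a s * q a s) b a) /\
  (forall a b, q a b = phi b + RInt (fun s => B s b * p s b) b a).
Proof.
  assert (L1 : forall a b, exists l, forall n, Rabs (fst (picard n) a b - l) <= 2 * (Phi * W a b) * (/ 2) ^ n).
  { intros a b. apply geometric_limit. intros n. destruct (picard_step n a b). lra. }
  assert (L2 : forall a b, exists l, forall n, Rabs (snd (picard n) a b - l) <= 2 * (Phi * W a b) * (/ 2) ^ n).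
  { intros a b. apply geometric_limit. intros n. destruct (picard_step n a b). lra. }
  set (p := fun a b => proj1_sig (constructive_indefinite_description _ (L1 a b))).
  set (q := fun a b => proj1_sig (constructive_indefinite_description _ (L2 a b))).
  assert (Hp : forall n a b, Rabs (fst (picard n) a b - p a b) <= 2 * (Phi * W a b) * (/ 2) ^ n).
  { intros n a b. unfold p. destruct constructive_indefinite_description; simpl; auto. }
  assert (Hq : forall n a b, Rabs (snd (picard n) a b - q a b) <= 2 * (Phi * W a b) * (/ 2) ^ n).
  { intros n a b. unfold q. destruct constructive_indefinite_description; simpl; auto. }
  assert (HW : cont2 (fun a b => 2 * (Phi * W a b))).
  { unfold W. apply (cont2_comp1 (fun z => 2 * (Phi * exp (2 * C * Rabs z))) (fun a b => a - b)).
    - intros x. apply (continuous_comp Rabs (fun z => 2 * (Phi * exp (2 * C * z)))).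
      + apply continuous_Rabs.
      + apply (ex_derive_continuous (V := R_NormedModule)). auto_derive; trivial.
    - exact (cont2_minus _ _ cont2_id1 cont2_id2). }
  assert (Cp : cont2 p).
  { apply (uniform_limit_cont2 (fun n => fst (picard n)) p _ (fun n => proj1 (cont2_picard n)) HW Hp). }
  assert (Cq : cont2 q).
  { apply (uniform_limit_cont2 (fun n => snd (picard n)) q _ (fun n => proj2 (cont2_picard n)) HW Hq). }
  assert (Zero : forall z D, 0 <= D -> (forall n, Rabs z <= D * (/ 2) ^ n) -> z = 0).
  { intros z D HD Hz. destruct (Req_dec z 0) as [|Hnz]; [assumption|exfalso].
    pose proof (Rabs_pos_lt z Hnz) as Hz0.
    destruct (pow_lt_1_zero (/ 2) ltac:(rewrite Rabs_pos_eq; lra) (Rabs z / (D + 1))) as [n Hn].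
    { apply Rdiv_lt_0_compat; lra. }
    specialize (Hn n (Nat.le_refl n)). rewrite Rabs_pos_eq in Hn by (apply pow_le; lra).
    apply (Rlt_div_r _ (Rabs z) (D + 1)) in Hn; [|lra]. specialize (Hz n).
    assert (0 < (/ 2) ^ n) by (apply pow_lt; lra). nra. }
  exists p, q. repeat split; auto.
  - intros a b. apply Rminus_diag_uniq. change (p a b - I1 q a b = 0).
    apply (Zero _ (4 * (Phi * W a b))). { specialize (W_pos a b); nra. }
    (* [p] is within O(2^-n) of its iterate, and by contraction that iterate is within O(2^-n) of
       the image of the limit. *)
    intros n. pose proof (Hp (S n) a b) as E1. simpl in E1.
    assert (E2 : Rabs (I1 (snd (picard n)) a b - I1 q a b) <= (2 * Phi * (/ 2) ^ n) / 2 * W a b).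
    { apply I1_contract; auto.
      - apply Rmult_le_pos; [lra|apply pow_le; lra].
      - apply cont2_picard.
      - intros. specialize (Hq n a0 b0). lra. }
    rewrite Rabs_minus_sym in E1.
    pose proof (Rabs_triang (p a b - I1 (snd (picard n)) a b) (I1 (snd (picard n)) a b - I1 q a b)) as T.
    replace (p a b - I1 (snd (picard n)) a b + (I1 (snd (picard n)) a b - I1 q a b)) with (p a b - I1 q a b) in T by ring.
    assert (0 <= Phi * W a b * (/ 2) ^ n).
    { specialize (W_pos a b). apply Rmult_le_pos; [nra|apply pow_le; lra]. } lra.
  - intros a b. apply Rminus_diag_uniq. change (q a b - I2 p a b = 0).
    apply (Zero _ (4 * (Phi * W a b))). { specialize (W_pos a b); nra. }
    intros n. pose proof (Hq (S n) a b) as E1. simpl in E1.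
    assert (E2 : Rabs (I2 (fst (picard n)) a b - I2 p a b) <= (2 * Phi * (/ 2) ^ n) / 2 * W a b).
    { apply I2_contract; auto.
      - apply Rmult_le_pos; [lra|apply pow_le; lra].
      - apply cont2_picard.
      - intros. specialize (Hp n a0 b0). lra. }
    rewrite Rabs_minus_sym in E1.
    pose proof (Rabs_triang (q a b - I2 (fst (picard n)) a b) (I2 (fst (picard n)) a b - I2 p a b)) as T.
    replace (q a b - I2 (fst (picard n)) a b + (I2 (fst (picard n)) a b - I2 p a b)) with (q a b - I2 p a b) in T by ring.
    assert (0 <= Phi * W a b * (/ 2) ^ n).
    { specialize (W_pos a b). apply Rmult_le_pos; [nra|apply pow_le; lra]. } lra.
Qed.

End Goursat.

(** * Smoothness in one variable, and positivity of Goursat systems *)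

Lemma smooth_antiderivative (F f : R -> R) :
  (forall x, is_derive F x (f x)) -> smooth f -> smooth F.
Proof.
  intros HF Hf. apply (smooth_of_family (fun h => h = F \/ smooth h)); [|now left].
  intros h [-> | Hh].
  - exists f. auto.
  - exists (Derive h). split; [right; now apply smooth_Derive|]. now apply smooth_is_derive.
Qed.

(** Without generators, partial derivatives are available unconditionally. This supplies the
    derivatives of the coefficients, on which the differentiability of the Goursat solution itself
    will depend. *)
Definition no_gen (f : R -> R -> R) : Prop := False.

Lemma sm_no_gen gen f : smooth_fn no_gen f -> smooth_fn gen f.
Proof.
  induction 1.
  - contradiction.
  - apply sm_id1.
  - apply sm_id2.
  - now apply sm_plus.
  - now apply sm_mult.
  - now apply sm_comp.
  - now apply sm_inv.
  - now apply sm_sqrt.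
  - now apply sm_RInt1.
  - now apply sm_RInt2.
  - now apply sm_diag1.
  - now apply sm_diag2.
Qed.

Lemma sm_no_gen_partials f :
  smooth_fn no_gen f -> exists fa fb, partials f fa fb /\ smooth_fn no_gen fa /\ smooth_fn no_gen fb.
Proof. apply sm_partials; intros ? []. Qed.

Lemma sm_no_gen_cont f : smooth_fn no_gen f -> cont2 f.
Proof. apply sm_cont; intros ? []. Qed.

(** It lets the smoothness of a one-variable formula be proved by reading it as a two-variable term
    of the class. *)
Lemma sm_slice_smooth (f : R -> R -> R) (b : R) : smooth_fn no_gen f -> smooth (fun r => f r b).
Proof.
  intros H. apply (smooth_of_family (fun h => exists f, smooth_fn no_gen f /\ h = fun r => f r b)); [|eauto].
  intros h [g [Hg ->]]. destruct (sm_no_gen_partials g Hg) as (ga & gb & P & Ha & _).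
  exists (fun r => ga r b). split; [eauto|]. intros x. apply P.
Qed.

(** It stands in for an argument on the best constant: a bound that can always be halved is
    arbitrarily small. Positivity and uniqueness for the linear systems both rest on it. *)
Lemma halving (Pr : R -> Prop) (N e : R) :
  0 < e -> 0 <= N -> Pr N -> (forall N, 0 <= N -> Pr N -> Pr (N / 2)) ->
  exists N', 0 <= N' < e /\ Pr N'.
Proof.
  intros He HN H0 HS.
  assert (Hn : forall n, Pr (N * (/ 2) ^ n)).
  { induction n as [|n IH]; simpl; [now rewrite Rmult_1_r|].
    replace (N * (/ 2 * (/ 2) ^ n)) with (N * (/ 2) ^ n / 2) by field. apply HS; [|assumption].
    apply Rmult_le_pos; [assumption|apply pow_le; lra]. }
  destruct (pow_lt_1_zero (/ 2) ltac:(rewrite Rabs_pos_eq; lra) (e / (N + 1))) as [n Hlt].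
  { apply Rdiv_lt_0_compat; lra. }
  specialize (Hlt n (Nat.le_refl n)).
  assert (Hp : 0 < (/ 2) ^ n) by (apply pow_lt; lra). rewrite Rabs_pos_eq in Hlt by lra.
  apply (Rlt_div_r _ e (N + 1)) in Hlt; [|lra].
  exists (N * (/ 2) ^ n). split; [|apply Hn]. split; nra.
Qed.

(* If P, Q >= -N exp(2C(a-b)) then the system improves N to N/2. *)
Lemma goursat_nonneg (A B P Q : R -> R -> R) (C : R) :
  0 < C -> cont2 P -> cont2 Q ->
  (forall a b, b <= a -> 0 <= A a b <= C) -> (forall a b, b <= a -> 0 <= B a b <= C) ->
  (forall a b, b <= a -> is_derive (fun r => P a r) b (- (A a b * Q a b))) ->
  (forall a b, b <= a -> is_derive (fun r => Q r b) a (B a b * P a b)) ->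
  (forall a, 0 <= P a a) -> (forall a, 0 <= Q a a) ->
  forall a b, b <= a -> 0 <= P a b /\ 0 <= Q a b.
Proof.
  intros HC cP cQ HA HB dP dQ P0 Q0 a0 b0 Hab0.
  destruct (cont2_bounded_box P b0 a0 cP Hab0) as [N1 [N1p HN1]].
  destruct (cont2_bounded_box Q b0 a0 cQ Hab0) as [N2 [N2p HN2]].
  set (W := fun a b => exp (2 * C * (a - b))).
  assert (Wp : forall a b, 0 < W a b) by (intros; apply exp_pos).
  assert (W1 : forall a b, b <= a -> 1 <= W a b).
  { intros a b h. unfold W. pose proof (exp_ineq1_le (2 * C * (a - b))). nra. }
  (* This triangle contains every segment that joins one of its points to the diagonal along either
     coordinate, so the bound can be propagated within it. *)
  set (Pr := fun N => forall a b, b0 <= b -> b <= a -> a <= a0 -> - N * W a b <= P a b /\ - N * W a b <= Q a b).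
  assert (Key0 : forall c y z, 0 <= c <= C -> - z <= y -> 0 <= z -> 0 <= c * y + C * z) by (intros; nra).
  assert (Key : forall e, 0 < e -> - e <= P a0 b0 /\ - e <= Q a0 b0).
  { intros e He.
    destruct (halving Pr (Rmax N1 N2) (e / W a0 b0)) as [N [HN HPr]].
    - apply Rdiv_lt_0_compat; auto.
    - pose proof (Rmax_l N1 N2); lra.
    - intros a b h1 h2 h3. specialize (HN1 a b ltac:(lra) ltac:(lra)). specialize (HN2 a b ltac:(lra) ltac:(lra)).
      apply Rabs_le_between in HN1, HN2.
      pose proof (Rmax_l N1 N2). pose proof (Rmax_r N1 N2). specialize (W1 a b h2). split; nra.
    - intros N HN HPr a b h1 h2 h3. split.
      + assert (L : - (P a b + N / 2 * W a b) <= - (P a a + N / 2 * W a a)).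
        { apply (le_of_derive (fun s => - (P a s + N / 2 * W a s))
            (fun s => A a s * Q a s + C * (N * W a s))); [assumption| | |].
          - intros x _. apply (continuous_opp (V := R_NormedModule)).
            apply (continuous_plus (V := R_NormedModule)); [apply cont2_snd, cP|].
            apply (ex_derive_continuous (V := R_NormedModule)). unfold W. auto_derive; trivial.
          - intros x Hx.
            assert (D2 : is_derive (fun s => - (N / 2 * W a s)) x (C * (N * W a x))).
            { unfold W. auto_derive; [trivial|]. unfold Rminus. field. }
            assert (D1 := dP a x ltac:(lra)).
            assert (D3 := is_derive_plus_R _ _ _ _ _ (is_derive_opp _ _ _ D1) D2).
            eapply is_derive_ext; [|eapply is_derive_value; [exact D3|]].
            + intros t. unfold opp; simpl. ring.
            + unfold opp; simpl. ring.
          - intros x Hx. destruct (HPr a x ltac:(lra) ltac:(lra) h3) as [_ Hq].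
            specialize (HA a x ltac:(lra)). specialize (Wp a x). apply Key0; [lra|lra|nra]. }
        specialize (P0 a). specialize (Wp a a). nra.
      + assert (L : Q b b + N / 2 * W b b <= Q a b + N / 2 * W a b).
        { apply (le_of_derive (fun s => Q s b + N / 2 * W s b)
            (fun s => B s b * P s b + C * (N * W s b))); [assumption| | |].
          - intros x _. apply (continuous_plus (V := R_NormedModule)); [apply (cont2_fst Q), cQ|].
            apply (ex_derive_continuous (V := R_NormedModule)). unfold W. auto_derive; trivial.
          - intros x Hx.
            assert (D2 : is_derive (fun s => N / 2 * W s b) x (C * (N * W x b))).
            { unfold W. auto_derive; [trivial|]. unfold Rminus. field. }
            apply (is_derive_plus_R (fun s => Q s b)); [apply dQ; lra|exact D2].
          - intros x Hx. destruct (HPr x b ltac:(lra) ltac:(lra) ltac:(lra)) as [Hq _].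
            specialize (HB x b ltac:(lra)). specialize (Wp x b). apply Key0; [lra|lra|nra]. }
        specialize (Q0 b). specialize (Wp b b). nra.
    - destruct (HPr a0 b0 ltac:(lra) Hab0 ltac:(lra)).
      destruct HN as [HN0 HN]. apply (Rlt_div_r N e (W a0 b0)) in HN; [|apply Wp]. split; nra. }
  split; apply Rnot_lt_le; intros Hn.
  - destruct (Key (- P a0 b0 / 2) ltac:(lra)). lra.
  - destruct (Key (- Q a0 b0 / 2) ltac:(lra)). lra.
Qed.

(** * Characteristic coordinates of the flow *)

Record admissible (m M N0 N1 : R) (u0 u1 : R -> R) : Prop := {
  adm_m : 0 < m;
  adm_u0 : smooth u0;
  adm_u1 : smooth u1;
  adm_bounds : forall x, m <= u0 x <= M;
  adm_u0' : forall x, Rabs (Derive u0 x) <= N0;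
  adm_u0'' : forall x, Rabs (Derive (Derive u0) x) <= N0;
  adm_u1_bound : forall x, Rabs (u1 x) <= N1;
  adm_u1' : forall x, Rabs (Derive u1 x) <= N1;
  adm_cond : forall x, u1 x >= Rabs (Derive u0 x) / sqrt (u0 x)
}.

Section Flow.
Variables (m M N0 N1 : R) (u0 u1 : R -> R).
Hypothesis Hadm : admissible m M N0 N1 u0 u1.

Definition slope_bound : R := N1 + N0 / sqrt m + 1.
(** Four times [rp'] and [rm'] are the initial values of u_t + u_x / sqrt u and u_t - u_x / sqrt u.
    The condition on the data says exactly that both are nonnegative. *)
Definition rp' (x : R) : R := (u1 x + Derive u0 x / sqrt (u0 x)) / 4.
Definition rm' (x : R) : R := (u1 x - Derive u0 x / sqrt (u0 x)) / 4.
(* A quarter of the Riemann invariants at t = 0. *)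
Definition rp (x : R) : R := RInt u1 0 x / 4 + sqrt (u0 x) / 2.
Definition rm (x : R) : R := RInt u1 0 x / 4 - sqrt (u0 x) / 2.
(* sqrt u in characteristic coordinates: a and b are the feet at t = 0 of the backward
   characteristics of speed -1/sqrt u and 1/sqrt u. *)
Definition root (a b : R) : R := rp a - rm b.
(** Strictly below the lower bound [sqrt m] of [root] on [b <= a]: [cut] is then the identity near
    every value taken there, so derivatives are unchanged up to the diagonal. *)
Definition cutoff : R := sqrt m / 2.
Definition root_c (a b : R) : R := cut cutoff (root a b).
Definition coefA (a b : R) : R := rp' a / (2 * root_c a b).
Definition coefB (a b : R) : R := rm' b / (2 * root_c a b).
(** On the diagonal t = 0 and x = b, so t_a + t_b = 0 and x_a + x_b = 1. Hence t_a = sqrt u / 2, and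
    dividing by the square root of [root] leaves half the fourth root of [u0]. *)
Definition diag_data (x : R) : R := sqrt (sqrt (u0 x)) / 2.

Let Hm : 0 < m := adm_m _ _ _ _ _ _ Hadm.

Lemma u0_pos x : 0 < u0 x.
Proof. pose proof (adm_bounds _ _ _ _ _ _ Hadm x). lra. Qed.

Lemma sqrt_m_pos : 0 < sqrt m.
Proof. apply sqrt_lt_R0, Hm. Qed.

Lemma sqrt_u0_lower x : sqrt m <= sqrt (u0 x).
Proof. apply sqrt_le_1_alt. apply (adm_bounds _ _ _ _ _ _ Hadm). Qed.

Lemma cutoff_pos : 0 < cutoff.
Proof. unfold cutoff. pose proof sqrt_m_pos. lra. Qed.

Lemma smooth_sqrt_u0 : smooth (fun x => sqrt (u0 x)).
Proof.
  apply (sm_slice_smooth (fun a b => sqrt (u0 a)) 0). apply sm_sqrt.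
  - intros; apply u0_pos.
  - apply sm_smooth1, (adm_u0 _ _ _ _ _ _ Hadm).
Qed.

Lemma smooth_diag_data : smooth diag_data.
Proof.
  apply (sm_slice_smooth (fun a b => sqrt (sqrt (u0 a)) / 2) 0).
  apply sm_div; [intros; lra| |apply sm_const]. apply sm_sqrt.
  - intros; apply sqrt_lt_R0, u0_pos.
  - exact (sm_smooth1 _ _ smooth_sqrt_u0).
Qed.

Lemma smooth_quot : smooth (fun x => Derive u0 x / sqrt (u0 x)).
Proof.
  apply (sm_slice_smooth (fun a b => Derive u0 a / sqrt (u0 a)) 0). apply sm_div.
  - intros; apply sqrt_lt_R0, u0_pos.
  - apply sm_smooth1, smooth_Derive, (adm_u0 _ _ _ _ _ _ Hadm).
  - exact (sm_smooth1 _ _ smooth_sqrt_u0).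
Qed.

Lemma smooth_rp' : smooth rp'.
Proof.
  apply (sm_slice_smooth (fun a b => rp' a) 0). apply sm_div; [intros; lra| |apply sm_const].
  apply sm_plus; [apply sm_smooth1, (adm_u1 _ _ _ _ _ _ Hadm)|].
  exact (sm_smooth1 _ _ smooth_quot).
Qed.

Lemma smooth_rm' : smooth rm'.
Proof.
  apply (sm_slice_smooth (fun a b => rm' a) 0). apply sm_div; [intros; lra| |apply sm_const].
  apply sm_minus; [apply sm_smooth1, (adm_u1 _ _ _ _ _ _ Hadm)|].
  exact (sm_smooth1 _ _ smooth_quot).
Qed.

Lemma is_derive_sqrt_u0 x : is_derive (fun y => sqrt (u0 y)) x (Derive u0 x / (2 * sqrt (u0 x))).
Proof.
  apply (is_derive_sqrt u0); [|apply u0_pos]. apply smooth_is_derive, (adm_u0 _ _ _ _ _ _ Hadm).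
Qed.

Lemma is_derive_w x : is_derive (fun y => RInt u1 0 y) x (u1 x).
Proof. apply is_derive_RInt_upper, smooth_continuous, (adm_u1 _ _ _ _ _ _ Hadm). Qed.

Lemma is_derive_rp x : is_derive rp x (rp' x).
Proof.
  eapply is_derive_value.
  - apply is_derive_plus_R.
    + apply is_derive_mult_R; [apply is_derive_w|apply is_derive_const_R].
    + apply is_derive_mult_R; [apply is_derive_sqrt_u0|apply is_derive_const_R].
  - unfold rp'. pose proof (sqrt_lt_R0 _ (u0_pos x)). field. lra.
Qed.

Lemma is_derive_rm x : is_derive rm x (rm' x).
Proof.
  assert (D : is_derive (fun y => RInt u1 0 y * / 4 + (sqrt (u0 y) * - / 2)) x (rm' x)).
  { eapply is_derive_value.
    - apply is_derive_plus_R.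
      + apply is_derive_mult_R; [apply is_derive_w|apply is_derive_const_R].
      + apply is_derive_mult_R; [apply is_derive_sqrt_u0|apply is_derive_const_R].
    - unfold rm'. pose proof (sqrt_lt_R0 _ (u0_pos x)). field. lra. }
  eapply is_derive_ext; [|exact D]. intros t. unfold rm. as_R. field.
Qed.

Lemma quot_bound x : Rabs (Derive u0 x / sqrt (u0 x)) <= N0 / sqrt m.
Proof.
  pose proof sqrt_m_pos. pose proof (sqrt_u0_lower x).
  unfold Rdiv. rewrite Rabs_mult, Rabs_inv, (Rabs_pos_eq (sqrt _)) by lra.
  apply Rmult_le_compat; [apply Rabs_pos| | |].
  - left; apply Rinv_0_lt_compat; lra.
  - apply (adm_u0' _ _ _ _ _ _ Hadm).
  - apply Rinv_le_contravar; lra.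
Qed.

Lemma rpm'_bounds x :
  0 <= 4 * rp' x <= slope_bound /\ 0 <= 4 * rm' x <= slope_bound.
Proof.
  pose proof (quot_bound x) as H1. pose proof (adm_cond _ _ _ _ _ _ Hadm x) as H2.
  pose proof (adm_u1_bound _ _ _ _ _ _ Hadm x) as H3.
  assert (E : Rabs (Derive u0 x) / sqrt (u0 x) = Rabs (Derive u0 x / sqrt (u0 x))).
  { pose proof (sqrt_lt_R0 _ (u0_pos x)).
    unfold Rdiv. now rewrite Rabs_mult, Rabs_inv, (Rabs_pos_eq (sqrt _)) by lra. }
  rewrite E in H2. unfold rp', rm', slope_bound. set (z := Derive u0 x / sqrt (u0 x)) in *.
  apply Rabs_le_between in H3. revert H1 H2. unfold Rabs. destruct Rcase_abs; intros; lra.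
Qed.

Lemma slope_bound_pos : 0 < slope_bound.
Proof.
  pose proof (quot_bound 0). pose proof (Rabs_pos (Derive u0 0 / sqrt (u0 0))).
  pose proof (adm_u1_bound _ _ _ _ _ _ Hadm 0). pose proof (Rabs_pos (u1 0)).
  unfold slope_bound. lra.
Qed.

Lemma root_diag x : root x x = sqrt (u0 x).
Proof. unfold root, rp, rm. field. Qed.

Lemma rp_incr a b : a <= b -> rp a <= rp b.
Proof.
  intros H. apply (le_of_derive rp rp'); auto.
  - intros x _. apply (ex_derive_continuous (V := R_NormedModule)). eexists; apply is_derive_rp.
  - intros; apply is_derive_rp.
  - intros x _. pose proof (rpm'_bounds x); lra.
Qed.

(** Here the sign condition keeps u from degenerating: [rp] is nondecreasing, so [root a b] is at
    least its diagonal value [sqrt (u0 b)]. *)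
Lemma root_lower a b : b <= a -> sqrt m <= root a b.
Proof.
  intros H. pose proof (rp_incr b a H). pose proof (root_diag b). unfold root in *.
  pose proof (sqrt_u0_lower b). lra.
Qed.

Lemma root_c_pos a b : 0 < root_c a b.
Proof. pose proof (cut_lower cutoff (root a b) cutoff_pos). pose proof cutoff_pos. unfold root_c. lra. Qed.

Lemma root_c_eq a b : b <= a -> root_c a b = root a b.
Proof.
  intros H. apply cut_id. pose proof (root_lower a b H). pose proof sqrt_m_pos. unfold cutoff. lra.
Qed.

Lemma smooth_rp : smooth rp.
Proof. apply (smooth_antiderivative rp rp' is_derive_rp smooth_rp'). Qed.
Lemma smooth_rm : smooth rm.
Proof. apply (smooth_antiderivative rm rm' is_derive_rm smooth_rm'). Qed.

Lemma sm_root gen : smooth_fn gen root.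
Proof. apply sm_minus; [apply sm_smooth1, smooth_rp|apply sm_smooth2, smooth_rm]. Qed.

Lemma sm_root_c gen : smooth_fn gen root_c.
Proof. apply (sm_comp gen (cut cutoff) root); [apply cut_smooth|apply sm_root]. Qed.

Lemma sm_coefA gen : smooth_fn gen coefA.
Proof.
  apply sm_div; [|apply sm_smooth1, smooth_rp'|apply sm_mult; [apply sm_const|apply sm_root_c]].
  intros a b. pose proof (root_c_pos a b); lra.
Qed.

Lemma sm_coefB gen : smooth_fn gen coefB.
Proof.
  apply sm_div; [|apply sm_smooth2, smooth_rm'|apply sm_mult; [apply sm_const|apply sm_root_c]].
  intros a b. pose proof (root_c_pos a b); lra.
Qed.

(** It comes from [rp', rm' <= slope_bound / 4] and [root_c >= cutoff / 2], both valid on the whole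
    plane. *)
Definition coef_bound : R := slope_bound / (4 * cutoff).

Lemma coef_bounds a b : 0 <= coefA a b <= coef_bound /\ 0 <= coefB a b <= coef_bound.
Proof.
  pose proof (rpm'_bounds a) as [H1 _]. pose proof (rpm'_bounds b) as [_ H2].
  pose proof (cut_lower cutoff (root a b) cutoff_pos) as H3. fold (root_c a b) in H3.
  pose proof cutoff_pos as H4. unfold coefA, coefB, coef_bound.
  assert (Hi : 0 < / (2 * root_c a b) <= / cutoff).
  { split; [apply Rinv_0_lt_compat; lra|apply Rinv_le_contravar; lra]. }
  assert (Hc : 0 < / cutoff) by (now apply Rinv_0_lt_compat).
  replace (slope_bound / (4 * cutoff)) with (slope_bound / 4 * / cutoff) by (field; lra).
  unfold Rdiv at 1 2 4 5.
  repeat split; try (apply Rmult_le_pos; lra); apply Rmult_le_compat; lra.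
Qed.

Lemma is_derive_root_c a b : b <= a ->
  is_derive (fun r => root_c r b) a (rp' a) /\ is_derive (fun r => root_c a r) b (- rm' b).
Proof.
  intros H. pose proof (root_lower a b H). pose proof sqrt_m_pos.
  assert (E : is_derive (cut cutoff) (root a b) 1).
  { rewrite <- (Derive_cut cutoff (root a b)) by (unfold cutoff; lra).
    apply smooth_is_derive, cut_smooth. }
  split.
  - eapply is_derive_value; [apply (is_derive_comp_R (cut cutoff) (fun r => root r b)); [exact E|]|].
    + apply is_derive_plus_R; [apply is_derive_rp|apply is_derive_const_R].
    + ring.
  - eapply is_derive_value; [apply (is_derive_comp_R (cut cutoff) (fun r => root a r)); [exact E|]|].
    + apply (is_derive_plus_R (fun _ => rp a)); [apply is_derive_const_R|].
      apply (is_derive_opp rm). apply is_derive_rm.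
    + unfold opp; simpl. ring.
Qed.

Lemma goursat_solution : exists p q : R -> R -> R, cont2 p /\ cont2 q /\
  (forall a b, p a b = diag_data a + RInt (fun s => coefA a s * q a s) b a) /\
  (forall a b, q a b = diag_data b + RInt (fun s => coefB s b * p s b) b a).
Proof.
  pose proof cutoff_pos. pose proof slope_bound_pos.
  apply goursat_exists with (C := coef_bound) (Phi := sqrt (sqrt M) / 2).
  - apply sm_no_gen_cont, sm_coefA.
  - apply sm_no_gen_cont, sm_coefB.
  - apply smooth_continuous, smooth_diag_data.
  - unfold coef_bound. apply Rdiv_lt_0_compat; lra.
  - intros a b. destruct (coef_bounds a b). rewrite Rabs_pos_eq; lra.
  - intros a b. destruct (coef_bounds a b). rewrite Rabs_pos_eq; lra.
  - intros x. unfold diag_data. rewrite Rabs_pos_eq.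
    + apply Rmult_le_compat_r; [lra|]. apply sqrt_le_1_alt, sqrt_le_1_alt, (adm_bounds _ _ _ _ _ _ Hadm).
    + pose proof (sqrt_pos (sqrt (u0 x))). lra.
Qed.

End Flow.

(** * The Goursat solution and the chart that it defines *)

Section Chart.
Variables (m M N0 N1 : R) (u0 u1 : R -> R).
Hypothesis Hadm : admissible m M N0 N1 u0 u1.
Variables p q : R -> R -> R.
Let f := rp' u0 u1.
Let g := rm' u0 u1.
Let S := root u0 u1.
Let Sc := root_c m u0 u1.
Let cA := coefA m u0 u1.
Let cB := coefB m u0 u1.
Let phi := diag_data u0.
Hypothesis Hpq : cont2 p /\ cont2 q /\
  (forall a b, p a b = phi a + RInt (fun s => cA a s * q a s) b a) /\
  (forall a b, q a b = phi b + RInt (fun s => cB s b * p s b) b a).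

Definition pq_gen (h : R -> R -> R) : Prop := h = p \/ h = q.

Let cp : cont2 p. Proof. apply Hpq. Qed.
Let cq : cont2 q. Proof. apply Hpq. Qed.

Lemma pq_gen_cont h : pq_gen h -> cont2 h.
Proof. intros [-> | ->]; assumption. Qed.

Lemma smg_cont h : smooth_fn pq_gen h -> cont2 h.
Proof. apply sm_cont, pq_gen_cont. Qed.

Let smp : smooth_fn pq_gen p. Proof. apply sm_gen. now left. Qed.
Let smq : smooth_fn pq_gen q. Proof. apply sm_gen. now right. Qed.
Let smA : smooth_fn pq_gen cA. Proof. exact (sm_coefA _ _ _ _ _ _ Hadm _). Qed.
Let smB : smooth_fn pq_gen cB. Proof. exact (sm_coefB _ _ _ _ _ _ Hadm _). Qed.
Let smSc : smooth_fn pq_gen Sc. Proof. exact (sm_root_c _ _ _ _ _ _ Hadm _). Qed.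
Let smphi : smooth phi. Proof. exact (smooth_diag_data _ _ _ _ _ _ Hadm). Qed.

Let cAq : cont2 (fun a s => cA a s * q a s).
Proof. apply smg_cont, sm_mult; [exact smA|exact smq]. Qed.
Let cBp : cont2 (fun s b => cB s b * p s b).
Proof. apply smg_cont, sm_mult; [exact smB|exact smp]. Qed.
Let cAq2 a x : continuous (fun s => cA a s * q a s) x := cont2_snd _ a x (cAq a x).
Let cBp1 b x : continuous (fun s => cB s b * p s b) x := cont2_fst _ x b (cBp x b).

Lemma p_snd a b : is_derive (fun r => p a r) b (- (cA a b * q a b)).
Proof.
  apply (is_derive_ext (fun r => phi a + RInt (fun s => cA a s * q a s) r a)).
  - intros t. symmetry. apply Hpq.
  - eapply is_derive_value; [apply is_derive_plus_R; [apply is_derive_const_R|]|apply Rplus_0_l].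
    apply (is_derive_RInt_lower (fun s => cA a s * q a s)), cAq2.
Qed.

Lemma q_fst a b : is_derive (fun r => q r b) a (cB a b * p a b).
Proof.
  apply (is_derive_ext (fun r => phi b + RInt (fun s => cB s b * p s b) b r)).
  - intros t. symmetry. apply Hpq.
  - eapply is_derive_value; [apply is_derive_plus_R; [apply is_derive_const_R|]|apply Rplus_0_l].
    apply (is_derive_RInt_upper (fun s => cB s b * p s b)), cBp1.
Qed.

(** The equations give [p_b] and [q_a] directly. The other two derivatives come from differentiating
    the integral equations, where only [q_a] and [p_b] appear under the integral. Replacing these by
    the equations leaves [p] and [q] themselves, so no order of differentiability is lost. *)
Lemma pq_gen_partials h :
  pq_gen h -> exists ha hb, partials h ha hb /\ smooth_fn pq_gen ha /\ smooth_fn pq_gen hb.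
Proof.
  intros [-> | ->].
  - destruct (sm_no_gen_partials cA) as (Aa & Ab & PA & HAa & HAb).
    { exact (sm_coefA _ _ _ _ _ _ Hadm _). }
    apply (sm_no_gen pq_gen) in HAa.
    set (ka := fun a s => Aa a s * q a s + cA a s * (cB a s * p a s)).
    assert (Hka : smooth_fn pq_gen ka) 
      by exact (sm_plus _ _ _ (sm_mult _ _ _ HAa smq) (sm_mult _ _ _ smA (sm_mult _ _ _ smB smp))).
    exists (fun a b => Derive phi a + (cA a a * q a a + RInt (fun s => ka a s) b a)),
      (fun a b => - (cA a b * q a b)).
    split; [intros a b; split|split].
    + apply (is_derive_ext (fun r => phi r + RInt (fun s => cA r s * q r s) b r)).
      * intros t. symmetry. apply Hpq.
      * apply is_derive_plus_R; [now apply smooth_is_derive|].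
        apply (is_derive_RInt_fst (fun a s => cA a s * q a s)).
        -- exact cAq.
        -- now apply smg_cont.
        -- intros x y. apply (is_derive_mult_R (fun r => cA r y) (fun r => q r y)); [apply PA|apply q_fst].
    + apply p_snd.
    + apply sm_plus; [now apply sm_smooth1, smooth_Derive|].
      apply sm_plus; [|now apply sm_RInt1].
      exact (sm_diag1 _ _ (sm_mult _ _ _ smA smq)).
    + exact (sm_opp _ _ (sm_mult _ _ _ smA smq)).
  - destruct (sm_no_gen_partials cB) as (Ba & Bb & PB & HBa & HBb).
    { exact (sm_coefB _ _ _ _ _ _ Hadm _). }
    apply (sm_no_gen pq_gen) in HBb.
    set (kb := fun s b => Bb s b * p s b + cB s b * - (cA s b * q s b)).
    assert (Hkb : smooth_fn pq_gen kb).
    { exact (sm_plus _ _ _ (sm_mult _ _ _ HBb smp)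
        (sm_mult _ _ _ smB (sm_opp _ _ (sm_mult _ _ _ smA smq)))). }
    exists (fun a b => cB a b * p a b),
      (fun a b => Derive phi b + (- (cB b b * p b b) + RInt (fun s => kb s b) b a)).
    split; [intros a b; split|split].
    + apply q_fst.
    + apply (is_derive_ext (fun r => phi r + RInt (fun s => cB s r * p s r) r a)).
      * intros t. symmetry. apply Hpq.
      * apply is_derive_plus_R; [now apply smooth_is_derive|].
        apply (is_derive_RInt_snd (fun s b => cB s b * p s b)).
        -- exact cBp.
        -- now apply smg_cont.
        -- intros x y. apply (is_derive_mult_R (fun r => cB x r) (fun r => p x r)); [apply PB|apply p_snd].
    + exact (sm_mult _ _ _ smB smp).
    + apply sm_plus; [now apply sm_smooth2, smooth_Derive|].
      apply sm_plus; [|now apply sm_RInt2]. apply sm_opp.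
      exact (sm_diag2 _ _ (sm_mult _ _ _ smB smp)).
Qed.

Lemma smg_partials h :
  smooth_fn pq_gen h -> exists ha hb, partials h ha hb /\ smooth_fn pq_gen ha /\ smooth_fn pq_gen hb.
Proof. apply sm_partials; [apply pq_gen_cont|apply pq_gen_partials]. Qed.

Let Scp a b : 0 < Sc a b := root_c_pos _ _ _ _ _ _ Hadm a b.
Let mp : 0 < sqrt m := sqrt_m_pos _ _ _ _ _ _ Hadm.

Lemma p_diag a : p a a = phi a.
Proof. destruct Hpq as (_ & _ & H & _). rewrite H, RInt_point. apply Rplus_0_r. Qed.
Lemma q_diag a : q a a = phi a.
Proof. destruct Hpq as (_ & _ & _ & H). rewrite H, RInt_point. apply Rplus_0_r. Qed.

Lemma phi_lower x : sqrt (sqrt m) / 2 <= phi x.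
Proof.
  unfold phi, diag_data. apply Rmult_le_compat_r; [lra|].
  apply sqrt_le_1_alt, (sqrt_u0_lower _ _ _ _ _ _ Hadm).
Qed.

Let rootmp : 0 < sqrt (sqrt m).
Proof. apply sqrt_lt_R0, mp. Qed.

Let Cb := coef_bound m N0 N1.

Let Cbp : 0 < Cb.
Proof.
  unfold Cb, coef_bound. pose proof (slope_bound_pos _ _ _ _ _ _ Hadm).
  pose proof (cutoff_pos _ _ _ _ _ _ Hadm). apply Rdiv_lt_0_compat; lra.
Qed.

(** Nonnegativity comes first, from positivity of the system. It makes the integrands nonnegative,
    and the integral equations then improve the bound to the boundary data. *)
Lemma pq_lower a b : b <= a -> phi a <= p a b /\ phi b <= q a b.
Proof.
  intros Hab.
  assert (N : forall a b, b <= a -> 0 <= p a b /\ 0 <= q a b).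
  { apply (goursat_nonneg cA cB p q Cb); auto.
    - intros x y _. apply (coef_bounds _ _ _ _ _ _ Hadm).
    - intros x y _. apply (coef_bounds _ _ _ _ _ _ Hadm).
    - intros x y _. apply p_snd.
    - intros x y _. apply q_fst.
    - intros x. rewrite p_diag. pose proof (phi_lower x); lra.
    - intros x. rewrite q_diag. pose proof (phi_lower x); lra. }
  destruct Hpq as (_ & _ & E1 & E2). rewrite E1, E2. split.
  - assert (0 <= RInt (fun s => cA a s * q a s) b a); [|lra].
    apply RInt_ge_0; [assumption| |].
    + apply ex_RInt_cont, cAq2.
    + intros s Hs. apply Rmult_le_pos; [apply (coef_bounds _ _ _ _ _ _ Hadm)|apply N; lra].
  - assert (0 <= RInt (fun s => cB s b * p s b) b a); [|lra].
    apply RInt_ge_0; [assumption| |].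
    + apply ex_RInt_cont, cBp1.
    + intros s Hs. apply Rmult_le_pos; [apply (coef_bounds _ _ _ _ _ _ Hadm)|apply N; lra].
Qed.

(* sig = t_a and tau = - t_b; dividing them by the square root of S removes the diagonal terms from
   the system that they satisfy, which leaves that of (p, q). *)
Definition rootS a b := sqrt (Sc a b).
Definition sig a b := p a b * rootS a b.
Definition tau a b := q a b * rootS a b.

Let rSp a b : 0 < rootS a b.
Proof. apply sqrt_lt_R0, Scp. Qed.

Let rS2 a b : rootS a b * rootS a b = Sc a b.
Proof. apply sqrt_sqrt. left; apply Scp. Qed.

Lemma sm_rootS : smooth_fn pq_gen rootS.
Proof. now apply sm_sqrt. Qed.
Lemma sm_sig : smooth_fn pq_gen sig.
Proof. apply sm_mult; [exact smp|apply sm_rootS]. Qed.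
Lemma sm_tau : smooth_fn pq_gen tau.
Proof. apply sm_mult; [exact smq|apply sm_rootS]. Qed.

Lemma rootS_lower a b : b <= a -> sqrt (sqrt m) <= rootS a b.
Proof.
  intros H. apply sqrt_le_1_alt. unfold Sc. rewrite (root_c_eq _ _ _ _ _ _ Hadm) by assumption.
  now apply (root_lower _ _ _ _ _ _ Hadm).
Qed.

Lemma sig_tau_lower a b : b <= a -> sqrt m / 2 <= sig a b /\ sqrt m / 2 <= tau a b.
Proof.
  intros H. pose proof (rootS_lower a b H). pose proof (pq_lower a b H) as [H1 H2].
  pose proof (phi_lower a). pose proof (phi_lower b).
  assert (E : sqrt m = sqrt (sqrt m) * sqrt (sqrt m)) by (rewrite sqrt_sqrt; lra).
  unfold sig, tau. rewrite E. split; nra.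
Qed.

Lemma is_derive_rootS a b : b <= a ->
  is_derive (fun r => rootS r b) a (f a / (2 * rootS a b)) /\
  is_derive (fun r => rootS a r) b (- g b / (2 * rootS a b)).
Proof.
  intros H. destruct (is_derive_root_c _ _ _ _ _ _ Hadm a b H). split.
  - apply (is_derive_sqrt (fun r => Sc r b)); [assumption|apply Scp].
  - apply (is_derive_sqrt (fun r => Sc a r)); [assumption|apply Scp].
Qed.

Let cAE a b : cA a b = f a / (2 * (rootS a b * rootS a b)).
Proof. now rewrite rS2. Qed.
Let cBE a b : cB a b = g b / (2 * (rootS a b * rootS a b)).
Proof. now rewrite rS2. Qed.

(** Together with [tau_fst] this gives [sig_b = - tau_a] and [(sig / S)_b = (tau / S)_a]: the
    conditions for [sig], [- tau] to be the partial derivatives of a time, and [sig / S], [tau / S]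
    those of a position. *)
Lemma sig_snd a b : b <= a ->
  is_derive (fun r => sig a r) b (- (f a * tau a b + g b * sig a b) / (2 * Sc a b)).
Proof.
  intros H. eapply is_derive_value.
  - apply (is_derive_mult_R (fun r => p a r) (fun r => rootS a r)); [exact (p_snd a b)|exact (proj2 (is_derive_rootS a b H))].
  - rewrite cAE, <- rS2. unfold sig, tau. pose proof (rSp a b). field. lra.
Qed.

Lemma tau_fst a b : b <= a ->
  is_derive (fun r => tau r b) a ((f a * tau a b + g b * sig a b) / (2 * Sc a b)).
Proof.
  intros H. eapply is_derive_value.
  - apply (is_derive_mult_R (fun r => q r b) (fun r => rootS r b)); [exact (q_fst a b)|exact (proj1 (is_derive_rootS a b H))].
  - rewrite cBE, <- rS2. unfold sig, tau. pose proof (rSp a b). field. lra.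
Qed.

Lemma sig_tau_diag x : sig x x = Sc x x / 2 /\ tau x x = Sc x x / 2.
Proof.
  unfold sig, tau. rewrite p_diag, q_diag. rewrite <- rS2.
  assert (E : phi x = rootS x x / 2).
  { unfold phi, diag_data, rootS. unfold Sc. rewrite (root_c_eq _ _ _ _ _ _ Hadm) by lra.
    now rewrite root_diag. }
  rewrite E. split; field.
Qed.

(* (f sqrt S, g sqrt S) solves the same linear system as (p, q), so positivity of that system
   propagates the comparison from the diagonal. *)
Lemma slopes_compare s1 s2 : (forall x, 0 <= s1 / 2 + s2 * f x /\ 0 <= s1 / 2 + s2 * g x) ->
  forall a b, b <= a -> 0 <= s1 * sig a b + s2 * f a * Sc a b /\ 0 <= s1 * tau a b + s2 * g b * Sc a b.
Proof.
  intros Hfg.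
  assert (N : forall a b, b <= a -> 0 <= s1 * p a b + s2 * (f a * rootS a b) /\
      0 <= s1 * q a b + s2 * (g b * rootS a b)).
  { apply (goursat_nonneg cA cB _ _ Cb); auto.
    - apply smg_cont. apply sm_plus; (apply sm_mult; [apply sm_const|]); [exact smp|].
      apply sm_mult; [|apply sm_rootS]. apply sm_smooth1, (smooth_rp' _ _ _ _ _ _ Hadm).
    - apply smg_cont. apply sm_plus; (apply sm_mult; [apply sm_const|]); [exact smq|].
      apply sm_mult; [|apply sm_rootS]. apply sm_smooth2, (smooth_rm' _ _ _ _ _ _ Hadm).
    - intros x y _. apply (coef_bounds _ _ _ _ _ _ Hadm).
    - intros x y _. apply (coef_bounds _ _ _ _ _ _ Hadm).
    - intros a b H. eapply is_derive_value.
      + apply is_derive_plus_R; (apply is_derive_mult_R; [apply is_derive_const_R|]); [exact (p_snd a b)|].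
        apply is_derive_mult_R; [apply is_derive_const_R|exact (proj2 (is_derive_rootS a b H))].
      + rewrite cAE. pose proof (rSp a b). field. lra.
    - intros a b H. eapply is_derive_value.
      + apply is_derive_plus_R; (apply is_derive_mult_R; [apply is_derive_const_R|]); [exact (q_fst a b)|].
        apply is_derive_mult_R; [apply is_derive_const_R|exact (proj1 (is_derive_rootS a b H))].
      + rewrite cBE. pose proof (rSp a b). field. lra.
    - intros a. destruct (sig_tau_diag a) as [E _]. rewrite <- rS2 in E. unfold sig in E.
      pose proof (rSp a a). destruct (Hfg a).
      assert (E' : p a a = rootS a a / 2) by nra. rewrite E'.
      replace (s1 * (rootS a a / 2) + s2 * (f a * rootS a a)) with ((s1 / 2 + s2 * f a) * rootS a a) by field.
      apply Rmult_le_pos; lra.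
    - intros a. destruct (sig_tau_diag a) as [_ E]. rewrite <- rS2 in E. unfold tau in E.
      pose proof (rSp a a). destruct (Hfg a).
      assert (E' : q a a = rootS a a / 2) by nra. rewrite E'.
      replace (s1 * (rootS a a / 2) + s2 * (g a * rootS a a)) with ((s1 / 2 + s2 * g a) * rootS a a) by field.
      apply Rmult_le_pos; lra. }
  intros a b H. destruct (N a b H) as [H1 H2]. pose proof (rSp a b). rewrite <- rS2. unfold sig, tau. split.
  - replace (s1 * (p a b * rootS a b) + s2 * f a * (rootS a b * rootS a b)) with
      ((s1 * p a b + s2 * (f a * rootS a b)) * rootS a b) by ring. apply Rmult_le_pos; lra.
  - replace (s1 * (q a b * rootS a b) + s2 * g b * (rootS a b * rootS a b)) with
      ((s1 * q a b + s2 * (g b * rootS a b)) * rootS a b) by ring. apply Rmult_le_pos; lra.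
Qed.

(** The quotients [2 f S / sig] and [2 g S / tau] will be u_t + u_x / sqrt u and u_t - u_x / sqrt u,
    so this propagates their initial upper bound. *)
Lemma slopes_upper k : (forall x, 4 * f x <= k /\ 4 * g x <= k) ->
  forall a b, b <= a -> 2 * f a * Sc a b <= k * sig a b /\ 2 * g b * Sc a b <= k * tau a b.
Proof.
  intros Hfg a b H. destruct (slopes_compare k (-2)) with (a := a) (b := b); auto; [|lra].
  intros x. destruct (Hfg x). lra.
Qed.

Lemma slopes_lower k : (forall x, k <= 4 * f x /\ k <= 4 * g x) ->
  forall a b, b <= a -> k * sig a b <= 2 * f a * Sc a b /\ k * tau a b <= 2 * g b * Sc a b.
Proof.
  intros Hfg a b H. destruct (slopes_compare (- k) 2) with (a := a) (b := b); auto; [|lra].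
  intros x. destruct (Hfg x). lra.
Qed.

Definition time_of a b : R := RInt (fun s => sig s b) b a.
Definition pos_of a b : R := b + RInt (fun s => sig s b / Sc s b) b a.

Lemma sm_time_of : smooth_fn pq_gen time_of.
Proof. apply (sm_RInt2 _ sig), sm_sig. Qed.
Let sm_speed : smooth_fn pq_gen (fun a b => sig a b / Sc a b).
Proof. apply sm_div; [apply Scp|apply sm_sig|exact smSc]. Qed.
Lemma sm_pos_of : smooth_fn pq_gen pos_of.
Proof. apply sm_plus; [apply sm_id2|]. now apply (sm_RInt2 _ (fun a b => sig a b / Sc a b)). Qed.

(** For the derivative in [b], [sig_b = - tau_a] turns the integral into boundary values of [tau].
    The diagonal terms then cancel because [sig] and [tau] agree there. *)
Lemma time_of_partials a b : b <= a ->
  is_derive (fun r => time_of r b) a (sig a b) /\ is_derive (fun r => time_of a r) b (- tau a b).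
Proof.
  intros H. split.
  - apply (is_derive_RInt_upper (fun s => sig s b)).
    intros x. apply (cont2_fst sig), smg_cont, sm_sig.
  - destruct (smg_partials sig sm_sig) as (sa & sb & P & Ha & Hb).
    eapply is_derive_value.
    + apply (is_derive_RInt_snd sig sb); [apply smg_cont, sm_sig|now apply smg_cont|intros; apply P].
    + assert (I : is_RInt (fun s => sb s b) b a (- tau a b - - tau b b)).
      { apply (is_RInt_derive (fun s => - tau s b)).
        - rewrite Rmin_left, Rmax_right by assumption. intros x Hx.
          eapply is_derive_value; [apply (is_derive_opp (fun s => tau s b)), tau_fst; lra|].
          assert (U := is_derive_unique _ _ _ (proj2 (P x b))).
          rewrite (is_derive_unique _ _ _ (sig_snd x b ltac:(lra))) in U. rewrite <- U.
          unfold opp; simpl. pose proof (Scp x b). field. lra.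
        - intros x _. apply (cont2_fst sb), smg_cont, Hb. }
      rewrite (is_RInt_unique _ _ _ _ I). destruct (sig_tau_diag b). lra.
Qed.

Lemma pos_of_partials a b : b <= a ->
  is_derive (fun r => pos_of r b) a (sig a b / Sc a b) /\
  is_derive (fun r => pos_of a r) b (tau a b / Sc a b).
Proof.
  intros H. split.
  - eapply is_derive_value; [apply is_derive_plus_R; [apply is_derive_const_R|]|apply Rplus_0_l].
    apply (is_derive_RInt_upper (fun s => sig s b / Sc s b)).
    intros x. apply (cont2_fst (fun s b => sig s b / Sc s b)), smg_cont, sm_speed.
  - destruct (smg_partials _ sm_speed) as (sa & sb & P & Ha & Hb).
    eapply is_derive_value; [apply is_derive_plus_R|].
    + apply (is_derive_id (K := R_AbsRing)).
    + apply (is_derive_RInt_snd (fun a b => sig a b / Sc a b) sb);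
        [apply smg_cont, sm_speed|now apply smg_cont|intros; apply P].
    + assert (I : is_RInt (fun s => sb s b) b a (tau a b / Sc a b - tau b b / Sc b b)).
      { apply (is_RInt_derive (fun s => tau s b / Sc s b)).
        - rewrite Rmin_left, Rmax_right by assumption. intros x Hx.
          assert (h : b <= x) by lra. destruct (is_derive_root_c _ _ _ _ _ _ Hadm x b h) as [D1 D2].
          fold f in D1. fold g in D2. fold Sc in D1, D2. pose proof (Scp x b) as Hp.
          eapply is_derive_value.
          { apply (is_derive_div (fun s => tau s b) (fun s => Sc s b)); [apply tau_fst, h|exact D1|lra]. }
          assert (U := is_derive_unique _ _ _ (proj2 (P x b))).
          rewrite <- U. symmetry. apply is_derive_unique. eapply is_derive_value.
          { apply (is_derive_div (fun s => sig x s) (fun s => Sc x s)); [apply sig_snd, h|exact D2|lra]. }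
          fold f g. field. lra.
        - intros x _. apply (cont2_fst sb), smg_cont, Hb. }
      rewrite (is_RInt_unique _ _ _ _ I). destruct (sig_tau_diag b) as [E1 E2].
      rewrite E1, E2. pose proof (Scp a b). pose proof (Scp b b). unfold one; simpl. field. lra.
Qed.

End Chart.

(** * Inverting the characteristic chart *)

(** Differentiability relative to the closed half-plane: only times [t' >= 0] are compared, so it is
    one-sided at [t = 0]. It yields [dt] and the space derivative together. *)
Definition half_differentiable (F : R -> R -> R) (t x lt lx : R) : Prop :=
  forall eps, 0 < eps -> exists delta, 0 < delta /\ forall t' x', 0 <= t' ->
    Rabs (t' - t) < delta -> Rabs (x' - x) < delta ->
    Rabs (F t' x' - F t x - (lt * (t' - t) + lx * (x' - x))) <= eps * (Rabs (t' - t) + Rabs (x' - x)).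

Section InverseChart.
Variables (T X sg ta S : R -> R -> R) (c s0 : R).
Hypotheses (cpos : 0 < c) (s0pos : 0 < s0)
  (HT : forall a b, b <= a -> differentiable_pt_lim T a b (sg a b) (- ta a b))
  (HX : forall a b, b <= a -> differentiable_pt_lim X a b (sg a b / S a b) (ta a b / S a b))
  (Hlow : forall a b, b <= a -> c <= sg a b /\ c <= ta a b)
  (HS : forall a b, b <= a -> s0 <= S a b)
  (T0 : forall b, T b b = 0) (X0 : forall b, X b b = b)
  (cT : cont2 T) (cX : cont2 X) (cS : cont2 S) (cta : cont2 ta).

Let diff_fst F a b lx ly : differentiable_pt_lim F a b lx ly -> is_derive (fun r => F r b) a lx.
Proof.
  intros H. apply is_derive_Reals. replace lx with (lx * 1 + ly * 0) by ring.
  apply (derivable_pt_lim_comp_2d F (fun r => r) (fun _ => b)); auto.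
  - apply derivable_pt_lim_id.
  - apply derivable_pt_lim_const.
Qed.

Let diff_snd F a b lx ly : differentiable_pt_lim F a b lx ly -> is_derive (fun r => F a r) b ly.
Proof.
  intros H. apply is_derive_Reals. replace ly with (lx * 0 + ly * 1) by ring.
  apply (derivable_pt_lim_comp_2d F (fun _ => a) (fun r => r)); auto.
  - apply derivable_pt_lim_const.
  - apply derivable_pt_lim_id.
Qed.

Let growth (y dy : R -> R) a b k :
  a <= b -> (forall x, a <= x <= b -> is_derive y x (dy x)) ->
  (forall x, a <= x <= b -> k <= dy x) -> k * (b - a) <= y b - y a.
Proof.
  intros Hab Hd Hk.
  assert (H : y a - k * a <= y b - k * b); [|lra].
  assert (D : forall x, a <= x <= b -> is_derive (fun s => y s - k * s) x (dy x - k)).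
  { intros x Hx. apply (is_derive_minus y (fun s => k * s)); [auto|]. auto_derive; [trivial|ring]. }
  apply (le_of_derive (fun s => y s - k * s) (fun s => dy s - k)); auto.
  - intros x Hx. apply (ex_derive_continuous (V := R_NormedModule)). eexists; apply D, Hx.
  - intros x Hx. apply D; lra.
  - intros x Hx. specialize (Hk x). lra.
Qed.

Let T_fst a a' b : b <= a -> a <= a' -> c * (a' - a) <= T a' b - T a b.
Proof.
  intros H1 H2. apply (growth (fun r => T r b) (fun r => sg r b)); auto.
  - intros x Hx. eapply diff_fst, HT; lra.
  - intros x Hx. apply Hlow; lra.
Qed.

Let T_snd a b b' : b' <= b -> b <= a -> c * (b - b') <= T a b' - T a b.
Proof.
  intros H1 H2.
  assert (c * (b - b') <= - T a b - - T a b'); [|lra].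
  apply (growth (fun r => - T a r) (fun r => ta a r)); auto.
  - intros x Hx. eapply is_derive_value; [apply (is_derive_opp (fun r => T a r)); eapply diff_snd, HT; lra|].
    unfold opp; simpl; ring.
  - intros x Hx. apply Hlow; lra.
Qed.

Let X_fst a a' b k : b <= a -> a <= a' -> (forall r, a <= r <= a' -> S r b <= k) ->
  c / k * (a' - a) <= X a' b - X a b.
Proof.
  intros H1 H2 Hk. apply (growth (fun r => X r b) (fun r => sg r b / S r b)); auto.
  - intros x Hx. eapply diff_fst, HX; lra.
  - intros x Hx. specialize (Hk x Hx). destruct (Hlow x b ltac:(lra)) as [h _].
    pose proof (HS x b ltac:(lra)). unfold Rdiv. apply Rmult_le_compat; try lra.
    + left; apply Rinv_0_lt_compat; lra.
    + apply Rinv_le_contravar; lra.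
Qed.

Let X_snd a b b' k : b <= b' -> b' <= a -> (forall r, b <= r <= b' -> S a r <= k) ->
  c / k * (b' - b) <= X a b' - X a b.
Proof.
  intros H1 H2 Hk. apply (growth (fun r => X a r) (fun r => ta a r / S a r)); auto.
  - intros x Hx. eapply diff_snd, HX; lra.
  - intros x Hx. specialize (Hk x Hx). destruct (Hlow a x ltac:(lra)) as [_ h].
    pose proof (HS a x ltac:(lra)). unfold Rdiv. apply Rmult_le_compat; try lra.
    + left; apply Rinv_0_lt_compat; lra.
    + apply Rinv_le_contravar; lra.
Qed.

Lemma time_lower a b : b <= a -> c * (a - b) <= T a b.
Proof. intros H. pose proof (T_fst b a b ltac:(lra) H). rewrite T0 in *. lra. Qed.

(** Finite speed: [X_a = T_a / S] with [S >= s0], integrated from the diagonal. *)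
Let X_range a b : b <= a -> b <= X a b <= b + T a b / s0.
Proof.
  intros H. split.
  - assert (0 * (a - b) <= X a b - X b b).
    { apply (growth (fun r => X r b) (fun r => sg r b / S r b)); auto.
      - intros x Hx. eapply diff_fst, HX; lra.
      - intros x Hx. destruct (Hlow x b ltac:(lra)). pose proof (HS x b ltac:(lra)).
        apply Rdiv_le_0_compat; lra. }
    rewrite X0 in *. lra.
  - assert (0 * (a - b) <= (T a b / s0 - X a b) - (T b b / s0 - X b b)).
    { apply (growth (fun r => T r b / s0 - X r b) (fun r => sg r b / s0 - sg r b / S r b)); auto.
      - intros x Hx. apply (is_derive_minus (fun r => T r b / s0) (fun r => X r b)).
        + eapply is_derive_value; [apply is_derive_mult_R; [eapply diff_fst, HT; lra|apply is_derive_const_R]|].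
          unfold Rdiv; ring.
        + eapply diff_fst, HX; lra.
      - intros x Hx. destruct (Hlow x b ltac:(lra)). pose proof (HS x b ltac:(lra)).
        assert (/ S x b <= / s0) by (apply Rinv_le_contravar; lra). unfold Rdiv. nra. }
    rewrite T0, X0 in *. unfold Rdiv in *. lra.
Qed.

(** [T] increases in [a] and decreases in [b], while [X] increases in both. When [a] and [b] move in
    the same direction their effects on [X] add up; otherwise those on [T] do. Either way one of the
    two functions sees the whole displacement, and the argument holds up to the diagonal. *)
Let expansive lo hi : lo <= hi -> exists k, 0 < k /\ forall a b a' b',
  lo <= b -> b <= a -> a <= hi -> lo <= b' -> b' <= a' -> a' <= hi ->
  Rabs (a' - a) + Rabs (b' - b) <= k * (Rabs (T a' b' - T a b) + Rabs (X a' b' - X a b)).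
Proof.
  intros Hlh. destruct (cont2_bounded_box S lo hi cS Hlh) as [s1 [s1p Hs1]].
  set (K := s1 + s0). assert (Kp : 0 < K) by (unfold K; lra).
  assert (HK : forall a b, lo <= a <= hi -> lo <= b <= hi -> S a b <= K).
  { intros a b Ha Hb. specialize (Hs1 a b Ha Hb). pose proof (Rle_abs (S a b)). unfold K. lra. }
  assert (cK : 0 < c / K) by (apply Rdiv_lt_0_compat; lra).
  exists (/ c + K / c).
  assert (ic : 0 < / c) by now apply Rinv_0_lt_compat.
  assert (iK : 0 < K / c) by (apply Rdiv_lt_0_compat; lra).
  split; [lra|].
  assert (Tc : forall d D, 0 <= d -> c * d <= D -> d <= (/ c + K / c) * Rabs D).
  { intros d D Hd H. pose proof (Rle_abs D). apply Rle_trans with (/ c * Rabs D).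
    - apply Rmult_le_reg_l with c; [lra|]. rewrite <- Rmult_assoc, Rinv_r by lra. lra.
    - pose proof (Rabs_pos D). nra. }
  assert (Xc : forall d D, 0 <= d -> c / K * d <= D -> d <= (/ c + K / c) * Rabs D).
  { intros d D Hd H. pose proof (Rle_abs D). apply Rle_trans with (K / c * Rabs D).
    - apply Rmult_le_reg_l with (c / K); [lra|]. rewrite <- Rmult_assoc.
      replace (c / K * (K / c)) with 1 by (field; lra). lra.
    - pose proof (Rabs_pos D). nra. }
  assert (Main : forall a b a' b', lo <= b -> b <= a -> a <= hi -> lo <= b' -> b' <= a' -> a' <= hi ->
    a <= a' -> Rabs (a' - a) + Rabs (b' - b) <= (/ c + K / c) * (Rabs (T a' b' - T a b) + Rabs (X a' b' - X a b))).
  { intros a b a' b' h1 h2 h3 h4 h5 h6 h7. rewrite (Rabs_pos_eq (a' - a)) by lra.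
    rewrite Rmult_plus_distr_l.
    pose proof (Rabs_pos (T a' b' - T a b)). pose proof (Rabs_pos (X a' b' - X a b)).
    destruct (Rle_dec b b') as [h|h].
    - rewrite (Rabs_pos_eq (b' - b)) by lra.
      pose proof (X_fst a a' b K h2 h7 ltac:(intros; apply HK; lra)) as E1.
      pose proof (X_snd a' b b' K h h5 ltac:(intros; apply HK; lra)) as E2.
      pose proof (Xc (a' - a + (b' - b)) (X a' b' - X a b) ltac:(lra) ltac:(lra)). nra.
    - rewrite (Rabs_left (b' - b)) by lra.
      pose proof (T_fst a a' b h2 h7) as E1.
      pose proof (T_snd a' b b' ltac:(lra) ltac:(lra)) as E2.
      pose proof (Tc (a' - a + - (b' - b)) (T a' b' - T a b) ltac:(lra) ltac:(lra)). nra. }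
  intros a b a' b' h1 h2 h3 h4 h5 h6. destruct (Rle_dec a a') as [h|h]; [now apply Main|].
  rewrite (Rabs_minus_sym a' a), (Rabs_minus_sym b' b), (Rabs_minus_sym (T a' b')), (Rabs_minus_sym (X a' b')).
  apply Main; lra.
Qed.

Let level t : 0 <= t -> forall b, exists a, b <= a <= b + t / c /\ T a b = t.
Proof.
  intros Ht b. assert (Htc : 0 <= t / c) by (apply Rdiv_le_0_compat; lra).
  destruct (IVT_gen (fun r => T r b) b (b + t / c) t) as [a [Ha E]].
  - intros x. apply continuity_pt_filterlim, (cont2_fst T), cT.
  - pose proof (time_lower (b + t / c) b ltac:(lra)) as L.
    replace (c * (b + t / c - b)) with t in L by (field; lra). rewrite T0.
    rewrite Rmin_left, Rmax_right; lra.
  - rewrite Rmin_left, Rmax_right in Ha by lra. exists a. auto.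
Qed.

(** The level set [T = t] is a graph [a = A b] over all [b]. Along it [X] is at least [x] at [b = x]
    and, by finite speed, at most [x] at [b = x - t / s0]; the intermediate value theorem gives the
    point. *)
Lemma chart_surjective t x : 0 <= t -> exists a b, b <= a /\ T a b = t /\ X a b = x.
Proof.
  intros Ht. assert (Htc : 0 <= t / c) by (apply Rdiv_le_0_compat; lra).
  assert (Hts : 0 <= t / s0) by (apply Rdiv_le_0_compat; lra).
  set (A := fun b => proj1_sig (constructive_indefinite_description _ (level t Ht b))).
  assert (HA : forall b, b <= A b <= b + t / c /\ T (A b) b = t).
  { intros b. unfold A. now destruct constructive_indefinite_description. }
  (* A step in [b] changes [T] by at most a local bound of [ta] times its length, and a change of
     [a] compensates at rate at least [c]. *)
  assert (Lip : forall lo hi, lo <= hi -> exists L, 0 < L /\ forall b b', lo <= b -> b <= b' -> b' <= hi ->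
     0 <= A b' - A b <= L * (b' - b)).
  { intros lo hi Hlh. destruct (cont2_bounded_box ta lo (hi + t / c) cta ltac:(lra)) as [L [Lp HL]].
    exists ((L + 1) / c). split; [apply Rdiv_lt_0_compat; lra|].
    intros b b' h1 h2 h3. destruct (HA b) as [Hb Eb]. destruct (HA b') as [Hb' Eb'].
    pose proof (T_snd (A b') b' b h2 ltac:(lra)) as M1.
    assert (M2 : T (A b') b - T (A b') b' <= L * (b' - b)).
    { assert (- L * (b' - b) <= T (A b') b' - T (A b') b); [|lra].
      apply (growth (fun r => T (A b') r) (fun r => - ta (A b') r)); auto.
      - intros r Hr. eapply diff_snd, HT; lra.
      - intros r Hr. specialize (HL (A b') r ltac:(lra) ltac:(lra)). apply Rabs_le_between in HL. lra. }
    assert (A b <= A b').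
    { apply Rnot_lt_le. intros Hlt. pose proof (T_fst (A b') (A b) b ltac:(lra) ltac:(lra)). nra. }
    pose proof (T_fst (A b) (A b') b ltac:(lra) ltac:(lra)) as M3.
    split; [lra|]. apply Rmult_le_reg_l with c; [lra|].
    replace (c * ((L + 1) / c * (b' - b))) with ((L + 1) * (b' - b)) by (field; lra). lra. }
  assert (cA : forall b, continuous A b).
  { intros b. apply filterlim_locally. intros eps.
    destruct (Lip (b - 1) (b + 1) ltac:(lra)) as [L [Lp HL]].
    assert (Hd : 0 < Rmin 1 (eps / L)) by (apply Rmin_pos; [lra|apply Rdiv_lt_0_compat; [apply cond_pos|lra]]).
    exists (mkposreal _ Hd). intros y Hy.
    assert (Hy' : Rabs (y - b) < Rmin 1 (eps / L)) by exact Hy.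
    pose proof (Rmin_l 1 (eps / L)). pose proof (Rmin_r 1 (eps / L)).
    assert (Hy2 : Rabs (y - b) < eps / L) by lra. apply (Rlt_div_r _ eps L) in Hy2; [|lra].
    assert (Hy1 := Rabs_def2 (y - b) 1 ltac:(lra)).
    change (Rabs (A y - A b) < eps). destruct (Rle_dec b y) as [h|h].
    - destruct (HL b y ltac:(lra) h ltac:(lra)). rewrite Rabs_pos_eq in * by lra. lra.
    - destruct (HL y b ltac:(lra) ltac:(lra) ltac:(lra)). rewrite Rabs_left1 in * by lra. lra. }
  destruct (IVT_gen (fun b => X (A b) b) (x - t / s0) x x) as [b [Hb E]].
  - intros b. apply continuity_pt_filterlim.
    apply (continuous_comp_2 A (fun r => r) X); [apply cA|apply continuous_id|].
    apply continuity_2d_pt_filterlim, cX.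
  - destruct (HA x) as [hx Ex]. destruct (HA (x - t / s0)) as [hy Ey].
    pose proof (X_range (A x) x ltac:(lra)). pose proof (X_range (A (x - t / s0)) (x - t / s0) ltac:(lra)) as R2.
    rewrite Ey in R2. rewrite Rmin_left, Rmax_right; lra.
  - exists (A b), b. destruct (HA b). repeat split; auto; lra.
Qed.

(** For [t >= 0] the choice is forced by [chart_injective]; for [t < 0] the value is unspecified. *)
Definition inv_pair (t x : R) : R * R :=
  epsilon (inhabits (0, 0)) (fun ab => snd ab <= fst ab /\ T (fst ab) (snd ab) = t /\ X (fst ab) (snd ab) = x).
Definition inv1 t x := fst (inv_pair t x).
Definition inv2 t x := snd (inv_pair t x).

Lemma inv_spec t x : 0 <= t ->
  inv2 t x <= inv1 t x /\ T (inv1 t x) (inv2 t x) = t /\ X (inv1 t x) (inv2 t x) = x.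
Proof.
  intros Ht. unfold inv1, inv2, inv_pair. apply epsilon_spec.
  destruct (chart_surjective t x Ht) as (a & b & H). now exists (a, b).
Qed.

Lemma chart_injective a b a' b' : b <= a -> b' <= a' -> T a b = T a' b' -> X a b = X a' b' ->
  a = a' /\ b = b'.
Proof.
  intros H H' E1 E2.
  destruct (expansive (Rmin b b') (Rmax a a')) as [k [kp Hk]].
  { pose proof (Rmin_l b b'). pose proof (Rmax_l a a'). lra. }
  specialize (Hk a b a' b' (Rmin_l _ _) H (Rmax_l _ _) (Rmin_r _ _) H' (Rmax_r _ _)).
  rewrite E1, E2, !Rminus_diag, Rabs_R0, Rplus_0_r, Rmult_0_r in Hk.
  pose proof (Rabs_pos (a' - a)). pose proof (Rabs_pos (b' - b)).
  assert (Z : forall z, Rabs z <= 0 -> z = 0).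
  { intros z Hz. destruct (Req_dec z 0) as [|n]; [assumption|]. pose proof (Rabs_pos_lt z n). lra. }
  split; apply eq_sym, Rminus_diag_uniq, Z; lra.
Qed.

Lemma inv_chart a b : b <= a -> 0 <= T a b /\ inv1 (T a b) (X a b) = a /\ inv2 (T a b) (X a b) = b.
Proof.
  intros H. assert (Ht : 0 <= T a b).
  { pose proof (time_lower a b H). nra. }
  destruct (inv_spec (T a b) (X a b) Ht) as (h & E1 & E2).
  split; [assumption|]. now apply chart_injective.
Qed.

Lemma inv_zero x : inv1 0 x = x /\ inv2 0 x = x.
Proof. destruct (inv_chart x x (Rle_refl x)) as [_ H]. now rewrite T0, X0 in H. Qed.

Lemma inv_gap t x : 0 <= t -> inv1 t x - inv2 t x <= t / c.
Proof.
  intros Ht. destruct (inv_spec t x Ht) as (h & E1 & _). pose proof (time_lower _ _ h) as L.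
  rewrite E1 in L. apply (Rle_div_r _ t c); lra.
Qed.

Let inv_box t x : 0 <= t -> x - t / s0 <= inv2 t x <= x.
Proof.
  intros Ht. destruct (inv_spec t x Ht) as (h & E1 & E2). pose proof (X_range _ _ h) as L.
  rewrite E1, E2 in L. lra.
Qed.

(** By finite speed and [inv_gap], the preimages of a neighbourhood stay in a fixed box, on which
    [expansive] is a Lipschitz bound for the inverse. *)
Let inv_lipschitz t x : 0 <= t -> exists k, 0 < k /\ forall t' x', 0 <= t' ->
  Rabs (t' - t) < 1 -> Rabs (x' - x) < 1 ->
  Rabs (inv1 t' x' - inv1 t x) + Rabs (inv2 t' x' - inv2 t x) <= k * (Rabs (t' - t) + Rabs (x' - x)).
Proof.
  intros Ht.
  assert (H1 : 0 <= (t + 1) / c) by (apply Rdiv_le_0_compat; lra).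
  assert (H2 : 0 <= (t + 1) / s0) by (apply Rdiv_le_0_compat; lra).
  destruct (expansive (x - 1 - (t + 1) / s0) (x + 1 + (t + 1) / c) ltac:(lra)) as [k [kp Hk]].
  exists k. split; [assumption|]. intros t' x' Ht' A1 A2.
  assert (B : forall t' x', 0 <= t' -> Rabs (t' - t) < 1 -> Rabs (x' - x) < 1 ->
    x - 1 - (t + 1) / s0 <= inv2 t' x' /\ inv2 t' x' <= inv1 t' x' /\ inv1 t' x' <= x + 1 + (t + 1) / c).
  { intros t1 x1 h A B. pose proof (inv_box t1 x1 h). pose proof (inv_gap t1 x1 h).
    destruct (inv_spec t1 x1 h) as [h' _]. apply Rabs_def2 in A. apply Rabs_def2 in B.
    assert (t1 / c <= (t + 1) / c) by (apply Rmult_le_compat_r; [left; apply Rinv_0_lt_compat|]; lra).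
    assert (t1 / s0 <= (t + 1) / s0) by (apply Rmult_le_compat_r; [left; apply Rinv_0_lt_compat|]; lra).
    lra. }
  destruct (B t x Ht) as (?&?&?); [rewrite Rminus_diag, Rabs_R0; lra..|].
  destruct (B t' x' Ht' A1 A2) as (?&?&?).
  specialize (Hk (inv1 t x) (inv2 t x) (inv1 t' x') (inv2 t' x') ltac:(assumption) ltac:(assumption)
    ltac:(assumption) ltac:(assumption) ltac:(assumption) ltac:(assumption)).
  destruct (inv_spec t x Ht) as (_ & E1 & E2). destruct (inv_spec t' x' Ht') as (_ & E3 & E4).
  now rewrite E1, E2, E3, E4 in Hk.
Qed.

(** The Jacobian of the chart has determinant [2 sg ta / S]. Its inverse reads [a_t = 1 / (2 sg)],
    [b_t = - 1 / (2 ta)], [a_x = S / (2 sg)], [b_x = S / (2 ta)]. *)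
Lemma half_differentiable_inv (h : R -> R -> R) t x ha hb : 0 <= t ->
  let a := inv1 t x in let b := inv2 t x in
  differentiable_pt_lim h a b ha hb ->
  half_differentiable (fun t x => h (inv1 t x) (inv2 t x)) t x
    (ha / (2 * sg a b) - hb / (2 * ta a b)) (S a b * (ha / (2 * sg a b) + hb / (2 * ta a b))).
Proof.
  intros Ht a b Dh eps Heps.
  destruct (inv_spec t x Ht) as (hab & E1 & E2). fold a b in hab, E1, E2.
  destruct (Hlow a b hab) as [sgp tap]. pose proof (HS a b hab) as Sp.
  destruct (inv_lipschitz t x Ht) as [k [kp Hk]].
  set (Dt := ha / (2 * sg a b) - hb / (2 * ta a b)).
  set (Dx := S a b * (ha / (2 * sg a b) + hb / (2 * ta a b))).
  (* The linearization errors of [h], [T] and [X] are each at most [eps / Q] times [k N] and enter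
     with weights 1, [|Dt|] and [|Dx|]; this [Q] makes their total [eps N]. *)
  set (Q := k * (1 + Rabs Dt + Rabs Dx)).
  assert (Qp : 0 < Q).
  { unfold Q. pose proof (Rabs_pos Dt). pose proof (Rabs_pos Dx). nra. }
  assert (He1 : 0 < eps / Q) by (apply Rdiv_lt_0_compat; lra).
  destruct (Dh (mkposreal _ He1)) as [d1 H1]. destruct (HT a b hab (mkposreal _ He1)) as [d2 H2].
  destruct (HX a b hab (mkposreal _ He1)) as [d3 H3]. simpl in H1, H2, H3.
  set (d := Rmin d1 (Rmin d2 d3)).
  assert (dp : 0 < d) by (unfold d; repeat apply Rmin_pos; apply cond_pos).
  assert (dk : 0 < d / (2 * k)) by (apply Rdiv_lt_0_compat; lra).
  exists (Rmin 1 (d / (2 * k))). split; [apply Rmin_pos; lra|].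
  intros t' x' Ht' At Ax.
  pose proof (Rmin_l 1 (d / (2 * k))). pose proof (Rmin_r 1 (d / (2 * k))).
  specialize (Hk t' x' Ht' ltac:(lra) ltac:(lra)).
  set (a' := inv1 t' x') in *. set (b' := inv2 t' x') in *. fold a b in Hk. fold a b.
  destruct (inv_spec t' x' Ht') as (hab' & E3 & E4). fold a' b' in hab', E3, E4.
  set (N := Rabs (t' - t) + Rabs (x' - x)) in *.
  assert (Nd : k * N < d).
  { assert (N < d / k); [|apply (Rlt_div_r N d k) in H4; lra].
    replace (d / k) with (d / (2 * k) + d / (2 * k)) by (field; lra). unfold N; lra. }
  pose proof (Rabs_pos (a' - a)). pose proof (Rabs_pos (b' - b)).
  assert (dl : d <= d1 /\ d <= d2 /\ d <= d3).
  { unfold d. pose proof (Rmin_l d1 (Rmin d2 d3)). pose proof (Rmin_r d1 (Rmin d2 d3)).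
    pose proof (Rmin_l d2 d3). pose proof (Rmin_r d2 d3). lra. }
  specialize (H1 a' b' ltac:(lra) ltac:(lra)). specialize (H2 a' b' ltac:(lra) ltac:(lra)).
  specialize (H3 a' b' ltac:(lra) ltac:(lra)). rewrite E1, E3 in H2. rewrite E2, E4 in H3.
  assert (Mx : Rmax (Rabs (a' - a)) (Rabs (b' - b)) <= k * N) by (apply Rmax_lub; lra).
  set (e := eps / Q * (k * N)).
  assert (Me : eps / Q * Rmax (Rabs (a' - a)) (Rabs (b' - b)) <= e) by (apply Rmult_le_compat_l; lra).
  set (r1 := h a' b' - h a b - (ha * (a' - a) + hb * (b' - b))) in *.
  set (r2 := t' - t - (sg a b * (a' - a) + - ta a b * (b' - b))) in *.
  set (r3 := x' - x - (sg a b / S a b * (a' - a) + ta a b / S a b * (b' - b))) in *.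
  (* The inverse is never expanded: the error in [(t, x)] is a combination of the errors of [h], [T]
     and [X] at [(a, b)]. *)
  assert (Id : h a' b' - h a b - (Dt * (t' - t) + Dx * (x' - x)) = r1 - Dt * r2 - Dx * r3).
  { unfold r1, r2, r3, Dt, Dx. field. lra. }
  rewrite Id.
  pose proof (Rabs_triang (r1 - Dt * r2) (- (Dx * r3))) as T1.
  pose proof (Rabs_triang r1 (- (Dt * r2))) as T2. rewrite Rabs_Ropp, Rabs_mult in T1, T2.
  assert (Fin : e * (1 + Rabs Dt + Rabs Dx) = eps * N).
  { unfold e, Q. pose proof (Rabs_pos Dt). pose proof (Rabs_pos Dx). field. lra. }
  pose proof (Rabs_pos Dt). pose proof (Rabs_pos Dx). pose proof (Rabs_pos r2). pose proof (Rabs_pos r3).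
  unfold Rminus at 1. unfold Rminus in T1 at 1. unfold Rminus at 1. 
  assert (Rabs Dt * Rabs r2 <= Rabs Dt * e) by (apply Rmult_le_compat_l; lra).
  assert (Rabs Dx * Rabs r3 <= Rabs Dx * e) by (apply Rmult_le_compat_l; lra).
  unfold Rminus in *. lra.
Qed.

End InverseChart.

(** * Smoothness on the closed half-space *)

Lemma is_dt_iff (f : R -> R) (t l : R) : 0 <= t ->
  is_dt f t l <-> forall eps, 0 < eps -> exists delta, 0 < delta /\ forall s, 0 <= s ->
    Rabs (s - t) < delta -> Rabs (f s - f t - l * (s - t)) <= eps * Rabs (s - t).
Proof.
  intros Ht. split.
  - intros [_ H] eps Heps.
    assert (HF : is_filter_lim (T := R_UniformSpace) (within (Rle 0) (locally t)) t).
    { intros P HP. now apply filter_le_within. }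
    destruct (H t HF (mkposreal eps Heps)) as [d Hd].
    exists d. split; [apply cond_pos|]. intros s Hs Hst. specialize (Hd s Hst Hs).
    unfold norm, minus, plus, opp, scal in Hd; simpl in Hd. unfold abs, mult in Hd; simpl in Hd.
    replace (f s - f t - l * (s - t)) with (f s + - f t + - ((s + - t) * l)) by ring. exact Hd.
  - intros H. split; [apply (is_linear_scal_l (K := R_AbsRing) (V := R_NormedModule))|].
    (* [filterdiff] quantifies over all limits of the filter; [t] is the only one. *)
    intros x Hx. assert (x = t) as ->.
    { destruct (Req_dec x t) as [|n]; [assumption|exfalso].
      assert (Hp : 0 < Rabs (x - t) / 2) by (pose proof (Rabs_pos_lt (x - t) ltac:(lra)); lra).
      assert (HB : locally x (fun y : R => Rabs (y - x) < Rabs (x - t) / 2)).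
      { exists (mkposreal _ Hp). intros y Hy. exact Hy. }
      destruct (Hx _ HB) as [d Hd]. specialize (Hd t). 
      assert (Hb : ball t d t) by apply ball_center. specialize (Hd Hb Ht). simpl in Hd.
      rewrite Rabs_minus_sym in Hd. lra. }
    intros eps. destruct (H eps (cond_pos eps)) as [d [dp Hd]].
    exists (mkposreal d dp). intros s Hst Hs. specialize (Hd s Hs Hst).
    unfold norm, minus, plus, opp, scal; simpl. unfold abs, mult; simpl.
    replace (f s + - f t + - ((s + - t) * l)) with (f s - f t - l * (s - t)) by ring. exact Hd.
Qed.

Lemma is_dt_unique (f : R -> R) (t l1 l2 : R) : 0 <= t -> is_dt f t l1 -> is_dt f t l2 -> l1 = l2.
Proof.
  intros Ht H1 H2. rewrite is_dt_iff in H1, H2 by assumption.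
  destruct (Req_dec l1 l2) as [|n]; [assumption|exfalso].
  pose proof (Rabs_pos_lt (l1 - l2) ltac:(lra)) as Hp.
  destruct (H1 (Rabs (l1 - l2) / 4) ltac:(lra)) as [d1 [p1 K1]].
  destruct (H2 (Rabs (l1 - l2) / 4) ltac:(lra)) as [d2 [p2 K2]].
  set (d := Rmin d1 d2 / 2). pose proof (Rmin_l d1 d2). pose proof (Rmin_r d1 d2).
  assert (dp : 0 < d) by (unfold d; pose proof (Rmin_pos d1 d2 p1 p2); lra).
  assert (E : Rabs (t + d - t) = d) by (replace (t + d - t) with d by ring; apply Rabs_pos_eq; lra).
  specialize (K1 (t + d) ltac:(lra) ltac:(rewrite E; unfold d; lra)).
  specialize (K2 (t + d) ltac:(lra) ltac:(rewrite E; unfold d; lra)).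
  rewrite E in K1, K2. replace (t + d - t) with d in K1, K2 by ring.
  pose proof (Rabs_triang (f (t + d) - f t - l2 * d) (- (f (t + d) - f t - l1 * d))) as T.
  rewrite Rabs_Ropp in T.
  replace (f (t + d) - f t - l2 * d + - (f (t + d) - f t - l1 * d)) with ((l1 - l2) * d) in T by ring.
  rewrite Rabs_mult, (Rabs_pos_eq d) in T by lra. nra.
Qed.

Lemma dt_eq (f : R -> R) (t l : R) : 0 <= t -> is_dt f t l -> dt f t = l.
Proof.
  intros Ht H. apply (iota_unique (V := R_CompleteNormedModule)); [|exact H].
  intros y Hy. now apply (is_dt_unique f t).
Qed.

Lemma dt_correct (f : R -> R) (t : R) : 0 <= t -> (exists l, is_dt f t l) -> is_dt f t (dt f t).
Proof. intros Ht [l H]. now rewrite (dt_eq f t l). Qed.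

Lemma is_dt_ext (f g : R -> R) (t l : R) : 0 <= t -> (forall s, 0 <= s -> f s = g s) ->
  is_dt f t l -> is_dt g t l.
Proof.
  intros Ht E H. rewrite is_dt_iff in * by assumption. intros eps Heps.
  destruct (H eps Heps) as [d [dp Hd]]. exists d. split; [assumption|]. intros s Hs Hst.
  rewrite <- !E by assumption. auto.
Qed.

Lemma is_dt_interior (f : R -> R) (t l : R) : 0 < t -> is_dt f t l -> is_derive f t l.
Proof.
  intros Ht H. rewrite is_dt_iff in H by lra. apply is_derive_Reals. intros eps Heps.
  destruct (H (eps / 2) ltac:(lra)) as [d [dp Hd]].
  assert (Hm : 0 < Rmin d t) by (apply Rmin_pos; lra). exists (mkposreal _ Hm). simpl. intros h Hh Hhd.
  pose proof (Rmin_l d t). pose proof (Rmin_r d t).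
  assert (Hb := Rabs_def2 h t ltac:(lra)).
  specialize (Hd (t + h) ltac:(lra)). replace (t + h - t) with h in Hd by ring.
  specialize (Hd ltac:(lra)). pose proof (Rabs_pos_lt h Hh).
  replace ((f (t + h) - f t) / h - l) with ((f (t + h) - f t - l * h) / h) by (field; assumption).
  unfold Rdiv. rewrite Rabs_mult, Rabs_inv. apply Rle_lt_trans with (eps / 2); [|lra].
  apply Rmult_le_reg_r with (Rabs h); [assumption|]. rewrite Rmult_assoc, Rinv_l by lra. lra.
Qed.

Lemma half_differentiable_dt F t x lt lx : 0 <= t -> half_differentiable F t x lt lx ->
  is_dt (fun s => F s x) t lt.
Proof.
  intros Ht H. apply is_dt_iff; [assumption|]. intros eps Heps.
  destruct (H eps Heps) as [d [dp Hd]]. exists d. split; [assumption|]. intros s Hs Hst.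
  specialize (Hd s x Hs Hst). rewrite Rminus_diag, Rabs_R0, Rmult_0_r, !Rplus_0_r in Hd. auto.
Qed.

Lemma half_differentiable_dx F t x lt lx : 0 <= t -> half_differentiable F t x lt lx ->
  is_derive (fun r => F t r) x lx.
Proof.
  intros Ht H. apply is_derive_Reals. intros eps Heps.
  destruct (H (eps / 2) ltac:(lra)) as [d [dp Hd]]. exists (mkposreal _ dp). simpl. intros h Hh Hhd.
  specialize (Hd t (x + h) Ht). replace (x + h - x) with h in Hd by ring.
  rewrite Rminus_diag, Rabs_R0, Rmult_0_r, !Rplus_0_l in Hd.
  specialize (Hd dp Hhd). pose proof (Rabs_pos_lt h Hh).
  replace ((F t (x + h) - F t x) / h - lx) with ((F t (x + h) - F t x - lx * h) / h) by (field; assumption).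
  unfold Rdiv. rewrite Rabs_mult, Rabs_inv. apply Rle_lt_trans with (eps / 2); [|lra].
  apply Rmult_le_reg_r with (Rabs h); [assumption|]. rewrite Rmult_assoc, Rinv_l by lra. lra.
Qed.

Lemma half_differentiable_cont F : (forall t x, 0 <= t -> exists lt lx, half_differentiable F t x lt lx) ->
  continuous_on half_space (fun p => F (fst (fst p)) (snd (fst p))).
Proof.
  intros HF [[t x] y] Ht. unfold half_space in Ht. simpl in Ht.
  destruct (HF t x Ht) as (lt & lx & H).
  apply filterlim_locally. intros eps. destruct (H 1 Rlt_0_1) as [d [dp Hd]].
  set (M := Rabs lt + Rabs lx + 2). assert (Mp : 0 < M).
  { unfold M. pose proof (Rabs_pos lt). pose proof (Rabs_pos lx). lra. }
  assert (Hm : 0 < Rmin d (eps / (2 * M))).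
  { apply Rmin_pos; [lra|]. apply Rdiv_lt_0_compat; [apply cond_pos|lra]. }
  exists (mkposreal _ Hm). intros [[t' x'] y'] [[Bt Bx] By] Ht'. simpl in *. unfold half_space in Ht'. simpl in Ht'.
  assert (At : Rabs (t' - t) < Rmin d (eps / (2 * M))) by exact Bt.
  assert (Ax : Rabs (x' - x) < Rmin d (eps / (2 * M))) by exact Bx.
  change (Rabs (F t' x' - F t x) < eps).
  pose proof (Rmin_l d (eps / (2 * M))). pose proof (Rmin_r d (eps / (2 * M))).
  specialize (Hd t' x' Ht' ltac:(lra) ltac:(lra)).
  assert (Ht2 : Rabs (t' - t) < eps / (2 * M)) by lra.
  assert (Hx2 : Rabs (x' - x) < eps / (2 * M)) by lra.
  apply (Rlt_div_r _ eps (2 * M)) in Ht2; [|lra]. apply (Rlt_div_r _ eps (2 * M)) in Hx2; [|lra].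
  pose proof (Rabs_triang (F t' x' - F t x - (lt * (t' - t) + lx * (x' - x))) (lt * (t' - t) + lx * (x' - x))) as T1.
  replace (F t' x' - F t x - (lt * (t' - t) + lx * (x' - x)) + (lt * (t' - t) + lx * (x' - x)))
    with (F t' x' - F t x) in T1 by ring.
  pose proof (Rabs_triang (lt * (t' - t)) (lx * (x' - x))) as T2. rewrite !Rabs_mult in T2.
  pose proof (Rabs_pos lt). pose proof (Rabs_pos lx). pose proof (Rabs_pos (t' - t)). pose proof (Rabs_pos (x' - x)).
  unfold M in *. nra.
Qed.

Lemma continuous_on_half_ext (f g : R -> R -> R -> R) :
  (forall t x y, 0 <= t -> f t x y = g t x y) ->
  continuous_on half_space (fun p => f (fst (fst p)) (snd (fst p)) (snd p)) ->
  continuous_on half_space (fun p => g (fst (fst p)) (snd (fst p)) (snd p)).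
Proof.
  intros E H p Hp. specialize (H p Hp). unfold half_space in Hp. rewrite <- E by exact Hp.
  eapply filterlim_within_ext; [|exact H]. intros [[t x] y] Ht. now apply E.
Qed.

(** Formulas for derivatives are established for [t >= 0] only, so membership must not depend on
    negative times. *)
Lemma class_C_ext n : forall f g : R -> R -> R -> R,
  (forall t x y, 0 <= t -> f t x y = g t x y) -> class_C n f -> class_C n g.
Proof.
  induction n as [|n IH]; intros f g E [Hc H]; (split; [now apply (continuous_on_half_ext f g)|]); [exact I|].
  destruct H as (Hd & Ht & H1 & H2). split; [|split; [|split]].
  - intros t x y h. destruct (Hd t x y h) as ([l Hl] & Dx & Dy). split; [|split].
    + exists l. apply (is_dt_ext (fun s => f s x y)); auto.
    + apply (ex_derive_ext (fun r => f t r y)); auto.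
    + apply (ex_derive_ext (fun r => f t x r)); auto.
  - apply (IH (fun t x y => dt (fun s => f s x y) t)); [|assumption]. intros t x y h.
    destruct (Hd t x y h) as ([l Hl] & _ & _). rewrite (dt_eq _ _ l h Hl). symmetry. apply dt_eq; [assumption|].
    apply (is_dt_ext (fun s => f s x y)); auto.
  - apply (IH (fun t => pd i1 (f t))); [|assumption]. intros t x y h. apply Derive_ext. intros; now apply E.
  - apply (IH (fun t => pd i2 (f t))); [|assumption]. intros t x y h. apply Derive_ext. intros; now apply E.
Qed.

(** The members do not depend on y; their y-derivative is 0, which is why the family has to contain
    0. *)
Lemma class_C_of_family (Fam : (R -> R -> R) -> Prop) :
  Fam (fun _ _ => 0) ->
  (forall F, Fam F -> exists Ft Fx, Fam Ft /\ Fam Fx /\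
     forall t x, 0 <= t -> half_differentiable F t x (Ft t x) (Fx t x)) ->
  forall n F, Fam F -> class_C n (fun t x y => F t x).
Proof.
  intros F0 HF. induction n as [|n IH]; intros F HFam;
    destruct (HF F HFam) as (Ft & Fx & At & Ax & D);
    (split; [apply (half_differentiable_cont F); eauto|]); [exact I|].
  split; [|split; [|split]].
  - intros t x y h. split; [|split].
    + eexists. eapply half_differentiable_dt; eauto.
    + eexists. eapply half_differentiable_dx; eauto.
    + exists 0. apply is_derive_const_R.
  - apply (class_C_ext n (fun t x y => Ft t x)); [|now apply IH]. intros t x y h. symmetry.
    apply dt_eq; [assumption|]. eapply half_differentiable_dt; eauto.
  - apply (class_C_ext n (fun t x y => Fx t x)); [|now apply IH]. intros t x y h. symmetry.
    apply is_derive_unique. eapply half_differentiable_dx; eauto.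
  - apply (class_C_ext n (fun t x y => 0)); [|now apply (IH (fun _ _ => 0))]. intros t x y h. symmetry.
    exact (Derive_const (F t x) y).
Qed.

Lemma class_C_cont n f : class_C n f ->
  continuous_on half_space (fun p => f (fst (fst p)) (snd (fst p)) (snd p)).
Proof. destruct n; now intros [H _]. Qed.

(** * Curvature of a conformal metric *)

Section ConformalCurvature.
Variable w : R -> R.
Hypothesis Hw : forall x, 0 < w x.

Let h : tensor2 := fun i j x y => w x * kronecker i j.
Let psi x := Derive w x / w x.

Let pd1_h i j x y : pd i1 (h i j) x y = Derive w x * kronecker i j.
Proof. unfold pd, h. rewrite Derive_scal_l. reflexivity. Qed.

Let pd2_h i j x y : pd i2 (h i j) x y = 0.
Proof. unfold pd, h. apply Derive_const. Qed.

(* Christoffel symbols of w * delta are psi/2 times these constants. *)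
Let e (k i j : idx) : R :=
  match k, i, j with
  | i1, i1, i1 => 1
  | i1, i2, i2 => -1
  | i2, i1, i2 => 1
  | i2, i2, i1 => 1
  | _, _, _ => 0
  end.

Let christoffel_h k i j : christoffel h k i j = fun x y => psi x * (e k i j / 2).
Proof.
  extensionality x; extensionality y. unfold christoffel, isum.
  specialize (Hw x).
  destruct k, i, j; rewrite ?pd1_h, ?pd2_h; unfold inv_metric, det_metric, h, psi; simpl; field; lra.
Qed.

Let pd_christoffel_h k i j l x y : pd l (christoffel h k i j) x y =
  match l with i1 => Derive psi x * (e k i j / 2) | i2 => 0 end.
Proof.
  rewrite christoffel_h. destruct l; unfold pd.
  - apply Derive_scal_l.
  - apply Derive_const.
Qed.

(** The products of Christoffel symbols cancel, which leaves minus half the second derivative of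
    [ln w]. *)
Lemma ricci_conformal i j x y :
  ricci h i j x y = - / 2 * Derive (fun r => Derive w r / w r) x * kronecker i j.
Proof.
  unfold ricci, isum. rewrite !pd_christoffel_h, !christoffel_h. fold psi.
  destruct i, j; simpl; field.
Qed.

Lemma scalar_curvature_conformal x y :
  scalar_curvature h x y = - Derive (fun r => Derive w r / w r) x / w x.
Proof.
  unfold scalar_curvature, isum. rewrite !ricci_conformal.
  unfold inv_metric, det_metric, h. simpl. specialize (Hw x). field. lra.
Qed.

Lemma riemannian_conformal : riemannian h.
Proof.
  intros x y. split.
  - intros [] []; reflexivity.
  - intros v [i Hi]. unfold isum, h. simpl. specialize (Hw x).
    assert (0 < v i1 * v i1 + v i2 * v i2).
    { pose proof (Rle_0_sqr (v i1)). pose proof (Rle_0_sqr (v i2)). unfold Rsqr in *.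
      destruct i; pose proof (Rsqr_pos_lt _ Hi) as Hp; unfold Rsqr in Hp; lra. }
    nra.
Qed.

End ConformalCurvature.

Lemma riemannian_conformal_pos (w : R -> R) (x : R) :
  riemannian (fun i j x y => w x * kronecker i j) -> 0 < w x.
Proof.
  intros H. destruct (H x 0) as [_ P]. specialize (P (fun i => kronecker i1 i)).
  unfold isum in P; simpl in P. assert (Hv : exists i, kronecker i1 i <> 0) by (exists i1; simpl; lra).
  specialize (P Hv). lra.
Qed.

(** * Uniqueness for linear characteristic systems *)

(** Freezing the function at its value for time 0 when [t < 0] turns continuity up to the boundary
    into continuity on the plane, where the [cont2] calculus applies. *)
Definition half_cont (F : R -> R -> R) : Prop := cont2 (fun t x => F (Rmax 0 t) x).

Lemma class_C_half_cont n F : class_C n (fun t x y => F t x) -> half_cont F.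
Proof.
  intros H. apply class_C_cont in H. intros t x eps.
  assert (Hp : half_space (Rmax 0 t, x, 0)) by apply Rmax_l.
  destruct (H _ Hp _ (locally_ball _ eps)) as [d Hd]. exists d. intros u v Hu Hv.
  apply (Hd (Rmax 0 u, v, 0)); [|apply Rmax_l].
  split; [split|]; simpl.
  - change (Rabs (Rmax 0 u - Rmax 0 t) < d). eapply Rle_lt_trans; [|exact Hu].
    unfold Rmax. repeat destruct Rle_dec; unfold Rabs; repeat destruct Rcase_abs; lra.
  - exact Hv.
  - apply ball_center.
Qed.

(** Derivatives are asked for [t > 0] only, where they are two-sided; at [t = 0] continuity carries
    the information. *)
Record half_C1 (F Ft Fx : R -> R -> R) : Prop := {
  half_C1_cont : half_cont F;
  half_C1_cont_t : half_cont Ft;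
  half_C1_cont_x : half_cont Fx;
  half_C1_t : forall t x, 0 < t -> is_derive (fun s => F s x) t (Ft t x);
  half_C1_x : forall t x, 0 < t -> is_derive (fun r => F t r) x (Fx t x)
}.

Lemma class_C_half_C1 n F : class_C (S n) (fun t x y => F t x) ->
  let Ft := fun t x => dt (fun s => F s x) t in let Fx := fun t x => Derive (F t) x in
  half_C1 F Ft Fx /\ class_C n (fun t x y => Ft t x) /\ class_C n (fun t x y => Fx t x).
Proof.
  intros H Ft Fx. assert (H' := H). destruct H as [_ (D & Ht & Hx & _)]. split; [|split; assumption].
  split.
  - exact (class_C_half_cont _ _ H').
  - exact (class_C_half_cont _ _ Ht).
  - exact (class_C_half_cont _ _ Hx).
  - intros t x Htp. destruct (D t x 0 (Rlt_le _ _ Htp)) as (E & _ & _).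
    apply is_dt_interior; [assumption|]. apply dt_correct; [lra|exact E].
  - intros t x Htp. destruct (D t x 0 (Rlt_le _ _ Htp)) as (_ & E & _). now apply Derive_correct.
Qed.

Lemma half_cont_interior F t x : half_cont F -> 0 < t -> continuity_2d_pt F t x.
Proof.
  intros H Ht. apply (continuity_2d_pt_ext_loc (fun t x => F (Rmax 0 t) x)); [|apply H].
  exists (mkposreal t Ht). simpl. intros u v Hu _. apply Rabs_def2 in Hu.
  now rewrite Rmax_right by lra.
Qed.

Lemma locally_2d_pos (P : R -> R -> Prop) t x : 0 < t -> (forall s y, 0 < s -> P s y) -> locally_2d P t x.
Proof.
  intros Ht H. exists (mkposreal t Ht). simpl. intros u v Hu _. apply H. apply Rabs_def2 in Hu. lra.
Qed.

Lemma half_C1_differentiable F Ft Fx t x : half_C1 F Ft Fx -> 0 < t ->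
  differentiable_pt_lim F t x (Ft t x) (Fx t x).
Proof.
  intros H Ht. apply differentiable_of_partials.
  - apply locally_2d_pos; [assumption|]. intros s y Hs. split; apply H; assumption.
  - apply half_cont_interior; [apply H|assumption].
  - apply half_cont_interior; [apply H|assumption].
Qed.

Lemma half_C1_mixed v vt vx vtt vtx vxt vxx : half_C1 v vt vx -> half_C1 vt vtt vtx ->
  half_C1 vx vxt vxx -> forall t x, 0 < t -> vtx t x = vxt t x.
Proof.
  intros H Ht Hx t x Hp.
  assert (E1 : forall s y, 0 < s -> Derive (fun z => v z y) s = vt s y)
    by (intros; apply is_derive_unique; now apply H).
  assert (E2 : forall s y, 0 < s -> Derive (fun z => v s z) y = vx s y)
    by (intros; apply is_derive_unique; now apply H).
  assert (D1 : forall s y, 0 < s -> is_derive (fun z => Derive (fun r => v z r) y) s (vxt s y)).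
  { intros s y Hs. apply (is_derive_ext_gt (fun z => vx z y) _ 0); [assumption| |now apply Hx].
    intros z Hz. symmetry. now apply E2. }
  assert (D2 : forall s y, 0 < s -> is_derive (fun z => Derive (fun r => v r z) s) y (vtx s y)).
  { intros s y Hs. apply (is_derive_ext (fun z => vt s z)); [|now apply Ht].
    intros z. symmetry. now apply E1. }
  rewrite <- (is_derive_unique _ _ _ (D1 t x Hp)), <- (is_derive_unique _ _ _ (D2 t x Hp)).
  symmetry. apply Schwarz.
  - apply locally_2d_pos; [assumption|]. intros s y Hs. repeat split.
    + exists (vt s y). now apply H.
    + exists (vx s y). now apply H.
    + eexists; now apply D1.
    + eexists; now apply D2.
  - apply (continuity_2d_pt_ext_loc vxt).
    + apply locally_2d_pos; [assumption|]. intros s y Hs. symmetry. now apply is_derive_unique, D1.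
    + apply half_cont_interior; [apply Hx|assumption].
  - apply (continuity_2d_pt_ext_loc vtx).
    + apply locally_2d_pos; [assumption|]. intros s y Hs. symmetry. now apply is_derive_unique, D2.
    + apply half_cont_interior; [apply Ht|assumption].
Qed.

Lemma linear_combination_bound (c1 c2 c3 : R -> R -> R) lo hi : lo <= hi ->
  cont2 c1 -> cont2 c2 -> cont2 c3 -> exists C, 0 <= C /\ forall a b, lo <= a <= hi -> lo <= b <= hi ->
  forall z1 z2 z3, Rabs (c1 a b * z1 + c2 a b * z2 + c3 a b * z3) <= C * (Rabs z1 + Rabs z2 + Rabs z3).
Proof.
  intros Hlh H1 H2 H3.
  destruct (cont2_bounded_box c1 lo hi H1 Hlh) as [C1 [P1 B1]].
  destruct (cont2_bounded_box c2 lo hi H2 Hlh) as [C2 [P2 B2]].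
  destruct (cont2_bounded_box c3 lo hi H3 Hlh) as [C3 [P3 B3]].
  exists (C1 + C2 + C3). split; [lra|]. intros a b Ha Hb z1 z2 z3.
  specialize (B1 a b Ha Hb). specialize (B2 a b Ha Hb). specialize (B3 a b Ha Hb).
  eapply Rle_trans; [apply Rabs_triang|].
  pose proof (Rabs_triang (c1 a b * z1) (c2 a b * z2)) as T.
  rewrite !Rabs_mult in *.
  pose proof (Rabs_pos z1). pose proof (Rabs_pos z2). pose proof (Rabs_pos z3).
  assert (Rabs (c1 a b) * Rabs z1 <= C1 * Rabs z1) by (apply Rmult_le_compat_r; lra).
  assert (Rabs (c2 a b) * Rabs z2 <= C2 * Rabs z2) by (apply Rmult_le_compat_r; lra).
  assert (Rabs (c3 a b) * Rabs z3 <= C3 * Rabs z3) by (apply Rmult_le_compat_r; lra).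
  nra.
Qed.

(* A bound N exp(L(a-b)) on the three unknowns improves to N/2 exp(L(a-b)). *)
Lemma characteristic_uniqueness (y1 y2 y3 c11 c12 c13 c21 c22 c23 c31 c32 c33 : R -> R -> R) :
  cont2 y1 -> cont2 y2 -> cont2 y3 -> cont2 c11 -> cont2 c12 -> cont2 c13 ->
  cont2 c21 -> cont2 c22 -> cont2 c23 -> cont2 c31 -> cont2 c32 -> cont2 c33 ->
  (forall x, y1 x x = 0 /\ y2 x x = 0 /\ y3 x x = 0) ->
  (forall a b, b < a ->
     is_derive (fun r => y1 a r) b (c11 a b * y1 a b + c12 a b * y2 a b + c13 a b * y3 a b)) ->
  (forall a b, b < a ->
     is_derive (fun r => y2 a r) b (c21 a b * y1 a b + c22 a b * y2 a b + c23 a b * y3 a b)) ->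
  (forall a b, b < a ->
     is_derive (fun r => y3 r b) a (c31 a b * y1 a b + c32 a b * y2 a b + c33 a b * y3 a b)) ->
  forall a b, b <= a -> y1 a b = 0.
Proof.
  intros c1 c2 c3 k11 k12 k13 k21 k22 k23 k31 k32 k33 Y0 D1 D2 D3 a0 b0 Hab0.
  destruct (linear_combination_bound c11 c12 c13 b0 a0 Hab0 k11 k12 k13) as [C1 [Cp1 HC1]].
  destruct (linear_combination_bound c21 c22 c23 b0 a0 Hab0 k21 k22 k23) as [C2 [Cp2 HC2]].
  destruct (linear_combination_bound c31 c32 c33 b0 a0 Hab0 k31 k32 k33) as [C3 [Cp3 HC3]].
  destruct (cont2_bounded_box y1 b0 a0 c1 Hab0) as [M1 [P1 B1]].
  destruct (cont2_bounded_box y2 b0 a0 c2 Hab0) as [M2 [P2 B2]].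
  destruct (cont2_bounded_box y3 b0 a0 c3 Hab0) as [M3 [P3 B3]].
  pose (d1 := fun a b => c11 a b * y1 a b + c12 a b * y2 a b + c13 a b * y3 a b).
  pose (d2 := fun a b => c21 a b * y1 a b + c22 a b * y2 a b + c23 a b * y3 a b).
  pose (d3 := fun a b => c31 a b * y1 a b + c32 a b * y2 a b + c33 a b * y3 a b).
  set (C := C1 + C2 + C3). assert (Cp : 0 <= C) by (unfold C; lra).
  (* Three unknowns bounded by [N] drive a rate of at most [3 C N <= N / 2 * L], which is the rate
     of a bound half as large. *)
  set (L := 6 * (C + 1)).
  assert (Wp : forall a b, 0 < exp (L * (a - b))) by (intros; apply exp_pos).
  assert (W1 : forall a b, b <= a -> 1 <= exp (L * (a - b))).
  { intros a b h. pose proof (exp_ineq1_le (L * (a - b))). unfold L in *. nra. }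
  set (Pr := fun N => forall a b, b0 <= b -> b <= a -> a <= a0 ->
     Rabs (y1 a b) <= N * exp (L * (a - b)) /\ Rabs (y2 a b) <= N * exp (L * (a - b)) /\
     Rabs (y3 a b) <= N * exp (L * (a - b))).
  assert (Rate : forall N d a b, 0 <= N -> Pr N -> b0 <= b -> b < a -> a <= a0 ->
     (exists Ci, Ci <= C /\ Rabs d <= Ci * (Rabs (y1 a b) + Rabs (y2 a b) + Rabs (y3 a b))) ->
     Rabs d <= N / 2 * L * exp (L * (a - b))).
  { intros N d a b HN HPr h1 h2 h3 [Ci [HCi Hd]]. destruct (HPr a b h1 ltac:(lra) h3) as (E1 & E2 & E3).
    eapply Rle_trans; [exact Hd|]. unfold L at 1. specialize (Wp a b).
    set (w := exp (L * (a - b))) in *.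
    assert (0 <= N * w) by (apply Rmult_le_pos; lra).
    pose proof (Rabs_pos (y1 a b)). pose proof (Rabs_pos (y2 a b)). pose proof (Rabs_pos (y3 a b)).
    apply Rle_trans with (C * (Rabs (y1 a b) + Rabs (y2 a b) + Rabs (y3 a b))).
    { apply Rmult_le_compat_r; lra. }
    apply Rle_trans with (C * (3 * (N * w))); [apply Rmult_le_compat_l; lra|].
    replace (N / 2 * (6 * (C + 1)) * w) with ((C + 1) * (3 * (N * w))) by field.
    apply Rmult_le_compat_r; lra. }
  assert (Key : forall e, 0 < e -> Rabs (y1 a0 b0) <= e).
  { intros e He.
    destruct (halving Pr (M1 + M2 + M3) (e / exp (L * (a0 - b0)))) as [N [HN HPr]].
    - apply Rdiv_lt_0_compat; auto.
    - lra.
    - intros a b h1 h2 h3. specialize (B1 a b ltac:(lra) ltac:(lra)). specialize (B2 a b ltac:(lra) ltac:(lra)).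
      specialize (B3 a b ltac:(lra) ltac:(lra)). specialize (W1 a b h2).
      repeat split; nra.
    - intros N HN HPr a b h1 h2 h3. destruct (Y0 a) as (Z1 & Z2 & _). destruct (Y0 b) as (_ & _ & Z3).
      assert (HN2 : 0 <= N / 2) by lra.
      split; [|split].
      + apply (bound_of_exp_rate_backward (fun s => y1 a s) (fun s => d1 a s)); auto.
        { intros s _. exact (cont2_snd y1 a s (c1 a s)). }
        { intros s Hs. exact (D1 a s (proj2 Hs)). }
        intros s Hs. apply Rate; auto; try lra. exists C1. split; [unfold C; lra|apply HC1; lra].
      + apply (bound_of_exp_rate_backward (fun s => y2 a s) (fun s => d2 a s)); auto.
        { intros s _. exact (cont2_snd y2 a s (c2 a s)). }
        { intros s Hs. exact (D2 a s (proj2 Hs)). }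
        intros s Hs. apply Rate; auto; try lra. exists C2. split; [unfold C; lra|apply HC2; lra].
      + apply (bound_of_exp_rate_forward (fun s => y3 s b) (fun s => d3 s b)); auto.
        { intros s _. exact (cont2_fst y3 s b (c3 s b)). }
        { intros s Hs. exact (D3 s b (proj1 Hs)). }
        intros s Hs. apply Rate; auto; try lra. exists C3. split; [unfold C; lra|apply HC3; lra].
    - destruct (HPr a0 b0 ltac:(lra) Hab0 ltac:(lra)) as [E _].
      destruct HN as [HN0 HN]. apply (Rlt_div_r N e _) in HN; [|apply Wp]. lra. }
  destruct (Req_dec (y1 a0 b0) 0) as [|n]; [assumption|].
  pose proof (Rabs_pos_lt _ n). specialize (Key (Rabs (y1 a0 b0) / 2) ltac:(lra)). lra.
Qed.

(** * The solution in characteristic coordinates *)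

Lemma partials_schwarz h ha hb haa hab hba hbb :
  partials h ha hb -> partials ha haa hab -> partials hb hba hbb -> cont2 hab -> cont2 hba ->
  forall a b, hab a b = hba a b.
Proof.
  intros P Pa Pb Ca Cb a b.
  assert (E1 : (fun x y => Derive (fun z => h z y) x) = ha).
  { extensionality x; extensionality y. apply is_derive_unique, P. }
  assert (E2 : (fun x y => Derive (fun z => h x z) y) = hb).
  { extensionality x; extensionality y. apply is_derive_unique, P. }
  assert (E1' : forall x y, Derive (fun z => h z y) x = ha x y) by (intros; now rewrite <- E1).
  assert (E2' : forall x y, Derive (fun z => h x z) y = hb x y) by (intros; now rewrite <- E2).
  assert (E3 : forall x y, Derive (fun z => Derive (fun t => h t z) x) y = hab x y).
  { intros x y. rewrite (Derive_ext _ (fun z => ha x z)) by (intros; apply E1').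
    apply is_derive_unique, Pa. }
  assert (E4 : forall x y, Derive (fun z => Derive (fun t => h z t) y) x = hba x y).
  { intros x y. rewrite (Derive_ext _ (fun z => hb z y)) by (intros; apply E2').
    apply is_derive_unique, Pb. }
  rewrite <- E3, <- E4. symmetry. apply Schwarz.
  - apply locally_2d_forall. intros x y. repeat split.
    + exists (ha x y). apply P.
    + exists (hb x y). apply P.
    + apply (ex_derive_ext (fun z => hb z y)); [intros; symmetry; apply E2'|]. exists (hba x y). apply Pb.
    + apply (ex_derive_ext (fun z => ha x z)); [intros; symmetry; apply E1'|]. exists (hab x y). apply Pa.
  - apply (continuity_2d_pt_ext hba); [intros; symmetry; apply E4|apply Cb].
  - apply (continuity_2d_pt_ext hab); [intros; symmetry; apply E3|apply Ca].
Qed.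

(* y stays below Y when moving left, because c >= 0 pushes y towards G <= Y. *)
Lemma relaxation_backward (y c G : R -> R) (Y b a : R) :
  b <= a -> (forall s, b <= s <= a -> continuous y s) -> (forall s, continuous c s) ->
  (forall s, b < s < a -> is_derive y s (c s * (y s - G s))) ->
  (forall s, b < s < a -> 0 <= c s /\ G s <= Y) -> y a <= Y -> y b <= Y.
Proof.
  intros Hab Hy Hc D HcG Ha.
  (* Integrating factor: [(y - Y) E] has derivative [c (Y - G) E >= 0]. *)
  set (E := fun s => exp (- RInt c b s)).
  assert (DE : forall s, is_derive E s (- c s * E s)).
  { intros s. unfold E. eapply is_derive_value.
    - apply (is_derive_comp_R exp (fun s => - RInt c b s)); [apply is_derive_exp|].
      apply (is_derive_opp (fun s => RInt c b s)). now apply is_derive_RInt_upper.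
    - reflexivity. }
  assert (Ep : forall s, 0 < E s) by (intros; apply exp_pos).
  assert (L : (y b - Y) * E b <= (y a - Y) * E a).
  { apply (le_of_derive (fun s => (y s - Y) * E s)
      (fun s => c s * (y s - G s) * E s + (y s - Y) * (- c s * E s))); auto.
    - intros x Hx. apply (continuous_mult (K := R_AbsRing) (fun s => y s - Y) E).
      + apply (continuous_minus (V := R_NormedModule) y (fun _ => Y)); [auto|apply continuous_const].
      + apply (ex_derive_continuous (V := R_NormedModule)). eexists; apply DE.
    - intros x Hx. apply (is_derive_mult_R (fun s => y s - Y) E); [|apply DE].
      assert (DY : is_derive (fun s => y s + - Y) x (c x * (y x - G x) + 0)).
      { apply is_derive_plus_R; [apply D, Hx|apply is_derive_const_R]. }
      rewrite Rplus_0_r in DY. exact DY.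
    - intros x Hx. destruct (HcG x Hx). specialize (Ep x).
      replace (c x * (y x - G x) * E x + (y x - Y) * (- c x * E x)) with (c x * (Y - G x) * E x) by ring.
      apply Rmult_le_pos; [apply Rmult_le_pos; lra|lra]. }
  pose proof (Ep a). pose proof (Ep b). nra.
Qed.

Lemma relaxation_backward_abs (y c G : R -> R) (Y b a : R) :
  b <= a -> (forall s, continuous y s) -> (forall s, continuous c s) ->
  (forall s, b < s < a -> is_derive y s (c s * (y s - G s))) ->
  (forall s, b < s < a -> 0 <= c s /\ Rabs (G s) <= Y) -> Rabs (y a) <= Y -> Rabs (y b) <= Y.
Proof.
  intros Hab Hy Hc D HcG Ha. apply Rabs_le_between in Ha. apply Rabs_le_between. split.
  - apply Ropp_le_cancel. rewrite Ropp_involutive.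
    apply (relaxation_backward (fun s => - y s) c (fun s => - G s) Y b a); auto; try lra.
    + intros s _. now apply (continuous_opp (V := R_NormedModule) y).
    + intros s Hs. eapply is_derive_value; [apply is_derive_opp_R, D, Hs|]. ring.
    + intros s Hs. destruct (HcG s Hs) as [h1 h2]. apply Rabs_le_between in h2. lra.
  - apply (relaxation_backward y c G Y b a); auto; try lra.
    intros s Hs. destruct (HcG s Hs) as [h1 h2]. apply Rabs_le_between in h2. lra.
Qed.

Lemma relaxation_forward_abs (y c G : R -> R) (Y b a : R) :
  b <= a -> (forall s, continuous y s) -> (forall s, continuous c s) ->
  (forall s, b < s < a -> is_derive y s (- c s * (y s - G s))) ->
  (forall s, b < s < a -> 0 <= c s /\ Rabs (G s) <= Y) -> Rabs (y b) <= Y -> Rabs (y a) <= Y.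
Proof.
  intros Hab Hy Hc D HcG Hb.
  assert (Ho : forall s, continuous Ropp s).
  { intros s. apply (continuous_opp (V := R_NormedModule) (fun x => x)), continuous_id. }
  replace (y a) with ((fun s => y (- s)) (- a)) by (simpl; f_equal; ring).
  apply (relaxation_backward_abs (fun s => y (- s)) (fun s => c (- s)) (fun s => G (- s)) Y (- a) (- b)).
  - lra.
  - intros s. apply (continuous_comp Ropp y); auto.
  - intros s. apply (continuous_comp Ropp c); auto.
  - intros s Hs. assert (D' : is_derive (fun x : R => - x) s (-1)) by (auto_derive; [trivial|ring]).
    eapply is_derive_value; [apply (is_derive_comp_R y Ropp); [apply D; lra|exact D']|]. ring.
  - intros s Hs. apply HcG. lra.
  - now rewrite Ropp_involutive.
Qed.

Section CharacteristicSolution.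
Variables (gen : (R -> R -> R) -> Prop) (f g : R -> R) (S sg ta T X : R -> R -> R) (c s0 : R).
Hypotheses
  (Hcont : forall h, smooth_fn gen h -> cont2 h)
  (Hpart : forall h, smooth_fn gen h -> exists ha hb, partials h ha hb /\ smooth_fn gen ha /\ smooth_fn gen hb)
  (smf : smooth f) (smg : smooth g)
  (smS : smooth_fn gen S) (smsg : smooth_fn gen sg) (smta : smooth_fn gen ta) (smT : smooth_fn gen T) (smX : smooth_fn gen X)
  (cpos : 0 < c) (s0pos : 0 < s0) (Spos : forall a b, 0 < S a b)
  (SD : forall a b, b <= a -> is_derive (fun r => S r b) a (f a) /\ is_derive (fun r => S a r) b (- g b))
  (S0 : forall a b, b <= a -> s0 <= S a b)
  (low : forall a b, b <= a -> c <= sg a b /\ c <= ta a b)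
  (sgD : forall a b, b <= a ->
     is_derive (fun r => sg a r) b (- (f a * ta a b + g b * sg a b) / (2 * S a b)))
  (taD : forall a b, b <= a ->
     is_derive (fun r => ta r b) a ((f a * ta a b + g b * sg a b) / (2 * S a b)))
  (diag : forall x, sg x x = S x x / 2 /\ ta x x = S x x / 2)
  (TD : forall a b, b <= a ->
     is_derive (fun r => T r b) a (sg a b) /\ is_derive (fun r => T a r) b (- ta a b))
  (XD : forall a b, b <= a ->
     is_derive (fun r => X r b) a (sg a b / S a b) /\ is_derive (fun r => X a r) b (ta a b / S a b))
  (T0 : forall b, T b b = 0) (X0 : forall b, X b b = b).

Let differentiable_on_chart h la lb : smooth_fn gen h ->
  (forall a b, b <= a -> is_derive (fun r => h r b) a (la a b) /\ is_derive (fun r => h a r) b (lb a b)) ->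
  forall a b, b <= a -> differentiable_pt_lim h a b (la a b) (lb a b).
Proof.
  intros Hh Hd a b Hab. destruct (Hpart h Hh) as (ha & hb & P & Ha & Hb).
  destruct (Hd a b Hab) as [D1 D2].
  rewrite <- (is_derive_unique _ _ _ D1), <- (is_derive_unique _ _ _ D2).
  rewrite (is_derive_unique _ _ _ (proj1 (P a b))), (is_derive_unique _ _ _ (proj2 (P a b))).
  apply partials_differentiable; auto.
Qed.

Let HT : forall a b, b <= a -> differentiable_pt_lim T a b (sg a b) (- ta a b).
Proof. exact (differentiable_on_chart T sg (fun a b => - ta a b) smT TD). Qed.

Let HX : forall a b, b <= a -> differentiable_pt_lim X a b (sg a b / S a b) (ta a b / S a b).
Proof. exact (differentiable_on_chart X (fun a b => sg a b / S a b) (fun a b => ta a b / S a b) smX XD). Qed.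

Definition al : R -> R -> R := inv1 T X.
Definition be : R -> R -> R := inv2 T X.

Lemma al_be_spec t x : 0 <= t -> be t x <= al t x /\ T (al t x) (be t x) = t /\ X (al t x) (be t x) = x.
Proof. apply (inv_spec T X sg ta S c s0); auto. Qed.

Lemma al_be_chart a b : b <= a -> 0 <= T a b /\ al (T a b) (X a b) = a /\ be (T a b) (X a b) = b.
Proof. apply (inv_chart T X sg ta S c s0); auto. Qed.

Lemma al_be_zero x : al 0 x = x /\ be 0 x = x.
Proof. apply (inv_zero T X sg ta S c s0); auto. Qed.

Lemma pullback_differentiable h la lb t x Dt Dx : smooth_fn gen h -> 0 <= t ->
  let a := al t x in let b := be t x in
  is_derive (fun r => h r b) a la -> is_derive (fun r => h a r) b lb ->
  la / (2 * sg a b) - lb / (2 * ta a b) = Dt ->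
  S a b * (la / (2 * sg a b) + lb / (2 * ta a b)) = Dx ->
  half_differentiable (fun t x => h (al t x) (be t x)) t x Dt Dx.
Proof.
  intros Hh Ht a b Da Db <- <-. destruct (Hpart h Hh) as (ha & hb & P & Ha & Hb).
  apply (half_differentiable_inv T X sg ta S c s0); auto. fold al be. fold a b.
  rewrite <- (is_derive_unique _ _ _ Da), <- (is_derive_unique _ _ _ Db).
  rewrite (is_derive_unique _ _ _ (proj1 (P a b))), (is_derive_unique _ _ _ (proj2 (P a b))).
  apply partials_differentiable; auto.
Qed.

(* Extensions of sig and tau with a positive lower bound, so that their inverses are smooth on R^2. *)
Definition sgc a b := cut (c / 2) (sg a b).
Definition tac a b := cut (c / 2) (ta a b).

Let sgc_pos a b : 0 < sgc a b.
Proof. pose proof (cut_lower (c / 2) (sg a b) ltac:(lra)). unfold sgc. lra. Qed.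
Let tac_pos a b : 0 < tac a b.
Proof. pose proof (cut_lower (c / 2) (ta a b) ltac:(lra)). unfold tac. lra. Qed.
Let sgc_eq a b : b <= a -> sgc a b = sg a b.
Proof. intros H. apply cut_id. destruct (low a b H). lra. Qed.
Let tac_eq a b : b <= a -> tac a b = ta a b.
Proof. intros H. apply cut_id. destruct (low a b H). lra. Qed.
Let sm_sgc : smooth_fn gen sgc.
Proof. apply (sm_comp gen (cut (c / 2)) sg); [apply cut_smooth|assumption]. Qed.
Let sm_tac : smooth_fn gen tac.
Proof. apply (sm_comp gen (cut (c / 2)) ta); [apply cut_smooth|assumption]. Qed.

Let cut_along (y : R -> R) z l : c <= y z -> is_derive y z l -> is_derive (fun r => cut (c / 2) (y r)) z l.
Proof.
  intros H D. eapply is_derive_value; [|apply Rmult_1_r].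
  apply (is_derive_comp_R (cut (c / 2)) y); [|exact D].
  rewrite <- (Derive_cut (c / 2) (y z)) by lra. apply smooth_is_derive, cut_smooth.
Qed.

(* u_t + u_x / sqrt u and u_t - u_x / sqrt u in characteristic coordinates. *)
Definition Wa a b := 2 * f a * S a b / sgc a b.
Definition Wb a b := 2 * g b * S a b / tac a b.

Let sm_f : smooth_fn gen (fun a b => f a). Proof. now apply sm_smooth1. Qed.
Let sm_g : smooth_fn gen (fun a b => g b). Proof. now apply sm_smooth2. Qed.

Lemma sm_Wa : smooth_fn gen Wa.
Proof.
  exact (sm_div gen _ _ sgc_pos (sm_mult gen _ _ (sm_mult gen _ _ (sm_const gen 2) sm_f) smS) sm_sgc).
Qed.
Lemma sm_Wb : smooth_fn gen Wb.
Proof.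
  exact (sm_div gen _ _ tac_pos (sm_mult gen _ _ (sm_mult gen _ _ (sm_const gen 2) sm_g) smS) sm_tac).
Qed.

(** Since [t_b = - ta] on lines of constant [a], this says that A changes there at the rate A (B -
    A) / 4u per unit of time, with no derivative of A or B involved. *)
Lemma Wa_snd a b : b <= a ->
  is_derive (fun r => Wa a r) b (f a * (f a * ta a b - g b * sg a b) / (sg a b * sg a b)).
Proof.
  intros H. pose proof (Spos a b). destruct (low a b H). eapply is_derive_value.
  - apply (is_derive_div (fun r => 2 * f a * S a r) (fun r => sgc a r)).
    + exact (is_derive_mult_R (fun _ => 2 * f a) (fun r => S a r) b _ _ (is_derive_const_R _ _) (proj2 (SD a b H))).
    + exact (cut_along (fun r => sg a r) b _ (proj1 (low a b H)) (sgD a b H)).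
    + specialize (sgc_pos a b); lra.
  - rewrite (sgc_eq a b H). field. lra.
Qed.

Lemma Wb_fst a b : b <= a ->
  is_derive (fun r => Wb r b) a (g b * (f a * ta a b - g b * sg a b) / (ta a b * ta a b)).
Proof.
  intros H. pose proof (Spos a b). destruct (low a b H). eapply is_derive_value.
  - apply (is_derive_div (fun r => 2 * g b * S r b) (fun r => tac r b)).
    + exact (is_derive_mult_R (fun _ => 2 * g b) (fun r => S r b) a _ _ (is_derive_const_R _ _) (proj1 (SD a b H))).
    + exact (cut_along (fun r => ta r b) a _ (proj2 (low a b H)) (taD a b H)).
    + specialize (tac_pos a b); lra.
  - rewrite (tac_eq a b H). field. lra.
Qed.

Definition sol t x := S (al t x) (be t x) * S (al t x) (be t x).

Definition pulled_back (F : R -> R -> R) : Prop :=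
  exists h, smooth_fn gen h /\ F = fun t x => h (al t x) (be t x).

(** The inverse Jacobian is built from [S], [sgc] and [tac], all in the class, so derivatives in t
    and x are again pulled back from the class. Smoothness up to [t = 0] follows. *)
Lemma pulled_back_family F : pulled_back F -> exists Ft Fx, pulled_back Ft /\ pulled_back Fx /\
  forall t x, 0 <= t -> half_differentiable F t x (Ft t x) (Fx t x).
Proof.
  intros [h [Hh ->]]. destruct (Hpart h Hh) as (ha & hb & P & Ha & Hb).
  pose (k1 := fun a b => ha a b / (2 * sgc a b)). pose (k2 := fun a b => hb a b / (2 * tac a b)).
  assert (K1 : smooth_fn gen k1).
  { refine (sm_div gen _ _ _ Ha (sm_mult gen _ _ (sm_const gen 2) sm_sgc)).
    intros a b. specialize (sgc_pos a b). lra. }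
  assert (K2 : smooth_fn gen k2).
  { refine (sm_div gen _ _ _ Hb (sm_mult gen _ _ (sm_const gen 2) sm_tac)).
    intros a b. specialize (tac_pos a b). lra. }
  exists (fun t x => k1 (al t x) (be t x) - k2 (al t x) (be t x)),
    (fun t x => S (al t x) (be t x) * (k1 (al t x) (be t x) + k2 (al t x) (be t x))).
  split; [|split].
  - exists (fun a b => k1 a b - k2 a b). split; [|reflexivity]. now apply sm_minus.
  - exists (fun a b => S a b * (k1 a b + k2 a b)). split; [|reflexivity].
    exact (sm_mult gen _ _ smS (sm_plus gen _ _ K1 K2)).
  - intros t x Ht. destruct (al_be_spec t x Ht) as [Hab _]. unfold k1, k2.
    rewrite sgc_eq, tac_eq by assumption.
    now apply (pullback_differentiable h (ha (al t x) (be t x)) (hb (al t x) (be t x))); auto; apply P.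
Qed.

Lemma sol_class_C n k : class_C n (fun t x y => sol t x * k).
Proof.
  apply (class_C_of_family pulled_back) with (F := fun t x => sol t x * k).
  - exists (fun _ _ => 0). split; [apply sm_const|reflexivity].
  - apply pulled_back_family.
  - exists (fun a b => S a b * S a b * k). split; [|reflexivity].
    exact (sm_mult gen _ _ (sm_mult gen _ _ smS smS) (sm_const gen k)).
Qed.

Lemma sol_derivatives t x : 0 <= t ->
  let a := al t x in let b := be t x in
  half_differentiable sol t x ((Wa a b + Wb a b) / 2) (S a b * (Wa a b - Wb a b) / 2).
Proof.
  intros Ht a b. destruct (al_be_spec t x Ht) as [Hab _]. fold a b in Hab.
  destruct (low a b Hab) as [sgp tap]. destruct (SD a b Hab) as [D1 D2].
  apply (pullback_differentiable (fun a b => S a b * S a b) (f a * S a b + S a b * f a)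
    (- g b * S a b + S a b * - g b)); auto.
  - exact (sm_mult gen _ _ smS smS).
  - exact (is_derive_mult_R (fun r => S r b) (fun r => S r b) a _ _ D1 D1).
  - exact (is_derive_mult_R (fun r => S a r) (fun r => S a r) b _ _ D2 D2).
  - fold a b. unfold Wa, Wb. rewrite sgc_eq, tac_eq by assumption. field. lra.
  - fold a b. unfold Wa, Wb. rewrite sgc_eq, tac_eq by assumption. field. lra.
Qed.

Lemma sol_zero x : sol 0 x = S x x * S x x.
Proof. unfold sol. destruct (al_be_zero x) as [-> ->]. reflexivity. Qed.

Lemma sol_dt_zero x : dt (fun s => sol s x) 0 = 2 * (f x + g x).
Proof.
  apply dt_eq; [lra|].
  assert (H := half_differentiable_dt _ _ _ _ _ (Rle_refl 0) (sol_derivatives 0 x (Rle_refl 0))).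
  cbv zeta in H. destruct (al_be_zero x) as [E1 E2]. rewrite E1, E2 in H.
  replace (2 * (f x + g x)) with ((Wa x x + Wb x x) / 2); [exact H|].
  unfold Wa, Wb. rewrite sgc_eq, tac_eq by lra. destruct (diag x) as [-> ->].
  pose proof (Spos x x). field. lra.
Qed.

Lemma sol_pos t x : 0 < sol t x.
Proof. unfold sol. pose proof (Spos (al t x) (be t x)). nra. Qed.

(** * Second derivatives of the solution and their bound *)

Section SecondOrder.
Variables (Aa Ab Ba Bb : R -> R -> R).
Hypotheses (PA : partials Wa Aa Ab) (PB : partials Wb Ba Bb)
  (smAa : smooth_fn gen Aa) (smAb : smooth_fn gen Ab) (smBa : smooth_fn gen Ba) (smBb : smooth_fn gen Bb).

Let Ab_eq a b : b <= a -> Ab a b = f a * (f a * ta a b - g b * sg a b) / (sg a b * sg a b).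
Proof.
  intros H. rewrite <- (is_derive_unique _ _ _ (proj2 (PA a b))). apply is_derive_unique, Wa_snd, H.
Qed.
Let Ba_eq a b : b <= a -> Ba a b = g b * (f a * ta a b - g b * sg a b) / (ta a b * ta a b).
Proof.
  intros H. rewrite <- (is_derive_unique _ _ _ (proj1 (PB a b))). apply is_derive_unique, Wb_fst, H.
Qed.

(* Derivatives of Wa along a and of Wb along b, per unit of time. *)
Definition Pq a b := Aa a b / sgc a b.
Definition Qq a b := - Bb a b / tac a b.
(** Half the time derivative of A + B. [Pq] and [Qq] contribute a quarter each; along the other
    coordinate A and B change at the rates A (B - A) / 4u and B (A - B) / 4u, and these combine into
    the square. *)
Definition utt a b := (Pq a b + Qq a b) / 4 - (Wa a b - Wb a b) ^ 2 / (16 * S a b * S a b).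

Lemma sol_dtt t x : 0 <= t -> is_dt (fun s => dt (fun r => sol r x) s) t (utt (al t x) (be t x)).
Proof.
  intros Ht. apply (is_dt_ext (fun s => (Wa (al s x) (be s x) + Wb (al s x) (be s x)) / 2)); [assumption| |].
  { intros s Hs. symmetry. apply dt_eq; [assumption|].
    eapply half_differentiable_dt; [assumption|]. now apply sol_derivatives. }
  destruct (al_be_spec t x Ht) as [Hab _].
  set (a := al t x) in *. set (b := be t x) in *. destruct (low a b Hab) as [sgp tap].
  apply (half_differentiable_dt (fun t x => (Wa (al t x) (be t x) + Wb (al t x) (be t x)) / 2) t x _
     (S a b * ((Aa a b + Ba a b) / 2 / (2 * sg a b) + (Ab a b + Bb a b) / 2 / (2 * ta a b)))); [assumption|].
  apply (pullback_differentiable (fun a b => (Wa a b + Wb a b) / 2) ((Aa a b + Ba a b) / 2)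
    ((Ab a b + Bb a b) / 2)); auto; fold a b.
  - exact (sm_mult gen _ _ (sm_plus gen _ _ sm_Wa sm_Wb) (sm_const gen (/ 2))).
  - apply (is_derive_div_const (fun r => Wa r b + Wb r b)).
    apply (is_derive_plus_R (fun r => Wa r b) (fun r => Wb r b)); [apply PA|apply PB].
  - apply (is_derive_div_const (fun r => Wa a r + Wb a r)).
    apply (is_derive_plus_R (fun r => Wa a r) (fun r => Wb a r)); [apply PA|apply PB].
  - unfold utt, Pq, Qq. rewrite Ab_eq, Ba_eq by assumption. unfold Wa, Wb.
    rewrite sgc_eq, tac_eq by assumption. pose proof (Spos a b). field. lra.
Qed.

(** Here [(ln u)_x = (A - B) / (2 S)] is differentiated through the chart. That the result is the
    same [utt] as in [sol_dtt] is the flow equation. *)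
Lemma sol_dxx_log t x : 0 <= t ->
  is_derive (fun r => Derive (sol t) r / sol t r) x (utt (al t x) (be t x)).
Proof.
  intros Ht.
  apply (is_derive_ext (fun r => (Wa (al t r) (be t r) - Wb (al t r) (be t r)) / (2 * S (al t r) (be t r)))).
  { intros r. assert (D := half_differentiable_dx _ _ _ _ _ Ht (sol_derivatives t r Ht)).
    assert (E := is_derive_unique (sol t) r _ D). cbv zeta in E. rewrite E.
    unfold sol. pose proof (Spos (al t r) (be t r)). as_R. field. lra. }
  destruct (al_be_spec t x Ht) as [Hab _].
  set (a := al t x) in *. set (b := be t x) in *. destruct (low a b Hab) as [sgp tap].
  destruct (SD a b Hab) as [D1 D2]. pose proof (Spos a b).
  pose (la := ((Aa a b - Ba a b) * (2 * S a b) - (Wa a b - Wb a b) * (0 * S a b + 2 * f a)) / (2 * S a b) ^ 2).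
  pose (lb := ((Ab a b - Bb a b) * (2 * S a b) - (Wa a b - Wb a b) * (0 * S a b + 2 * - g b)) / (2 * S a b) ^ 2).
  apply (half_differentiable_dx
     (fun t x => (Wa (al t x) (be t x) - Wb (al t x) (be t x)) / (2 * S (al t x) (be t x))) t x
     (la / (2 * sg a b) - lb / (2 * ta a b)) _); [assumption|].
  apply (pullback_differentiable (fun a b => (Wa a b - Wb a b) / (2 * S a b)) la lb); auto; fold a b.
  - apply sm_div; [intros x' y'; specialize (Spos x' y'); lra|exact (sm_minus gen _ _ sm_Wa sm_Wb)|].
    exact (sm_mult gen _ _ (sm_const gen 2) smS).
  - apply (is_derive_div (fun r => Wa r b - Wb r b) (fun r => 2 * S r b)); [| |lra].
    + apply (is_derive_minus (fun r => Wa r b) (fun r => Wb r b)); [apply PA|apply PB].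
    + exact (is_derive_mult_R (fun _ => 2) (fun r => S r b) a _ _ (is_derive_const_R _ _) D1).
  - apply (is_derive_div (fun r => Wa a r - Wb a r) (fun r => 2 * S a r)); [| |lra].
    + apply (is_derive_minus (fun r => Wa a r) (fun r => Wb a r)); [apply PA|apply PB].
    + exact (is_derive_mult_R (fun _ => 2) (fun r => S a r) b _ _ (is_derive_const_R _ _) D2).
  - unfold la, lb, utt, Pq, Qq. rewrite Ab_eq, Ba_eq by assumption. unfold Wa, Wb.
    rewrite sgc_eq, tac_eq by assumption. field. lra.
Qed.

Variable K : R.
Hypotheses (Kpos : 0 < K) (fpos : forall x, 0 <= f x) (gpos : forall x, 0 <= g x)
  (HK : forall a b, b <= a -> 2 * f a * S a b <= K * sg a b /\ 2 * g b * S a b <= K * ta a b).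

Let W_bounds a b : b <= a -> 0 <= Wa a b <= K /\ 0 <= Wb a b <= K.
Proof.
  intros H. destruct (HK a b H) as [h1 h2]. destruct (low a b H) as [sgp tap].
  pose proof (Spos a b). specialize (fpos a). specialize (gpos b).
  unfold Wa, Wb. rewrite sgc_eq, tac_eq by assumption.
  repeat split.
  - apply Rdiv_le_0_compat; [|lra]. repeat apply Rmult_le_pos; lra.
  - apply Rle_div_l; lra.
  - apply Rdiv_le_0_compat; [|lra]. repeat apply Rmult_le_pos; lra.
  - apply Rle_div_l; lra.
Qed.

Definition rateP a b := 3 * Wa a b * tac a b / (4 * (S a b * S a b)).
Definition targetP a b := Wa a b * (Wa a b - Wb a b) / (4 * (S a b * S a b)).
Definition rateQ a b := 3 * Wb a b * sgc a b / (4 * (S a b * S a b)).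
Definition targetQ a b := Wb a b * (Wb a b - Wa a b) / (4 * (S a b * S a b)).

Let smSS : smooth_fn gen (fun a b => 4 * (S a b * S a b)).
Proof. exact (sm_mult gen _ _ (sm_const gen 4) (sm_mult gen _ _ smS smS)). Qed.
Let SSpos a b : 0 < 4 * (S a b * S a b).
Proof. specialize (Spos a b). nra. Qed.
Let sm_rateP : smooth_fn gen rateP.
Proof. exact (sm_div gen _ _ SSpos (sm_mult gen _ _ (sm_mult gen _ _ (sm_const gen 3) sm_Wa) sm_tac) smSS). Qed.
Let sm_rateQ : smooth_fn gen rateQ.
Proof. exact (sm_div gen _ _ SSpos (sm_mult gen _ _ (sm_mult gen _ _ (sm_const gen 3) sm_Wb) sm_sgc) smSS). Qed.
Let sm_Pq : smooth_fn gen Pq.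
Proof. exact (sm_div gen _ _ sgc_pos smAa sm_sgc). Qed.
Let sm_Qq : smooth_fn gen Qq.
Proof. exact (sm_div gen _ _ tac_pos (sm_opp gen _ smBb) sm_tac). Qed.

(** By equality of mixed derivatives, [Aa_b] comes from differentiating the formula of [Wa_snd] in
    [a]. This brings in [f'] and the derivative of [sg] in [a], for which no bound is at hand. Both
    enter only in the combination that forms [Pq], so what remains is a linear law with coefficients
    in A, B, S and [ta]. *)
Lemma Pq_transport a b : b < a -> is_derive (fun r => Pq a r) b (rateP a b * (Pq a b - targetP a b)).
Proof.
  intros Hlt. assert (H : b <= a) by lra.
  destruct (low a b H) as [sgp tap]. pose proof (Spos a b) as Sp.
  destruct (Hpart sg smsg) as (sa & sb & Ps & _ & _).
  destruct (Hpart Aa smAa) as (Aaa & Aab & PAa & _ & smAab).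
  destruct (Hpart Ab smAb) as (Aba & Abb & PAb & smAba & _).
  destruct (SD a b H) as [DS1 DS2].
  pose proof (smooth_is_derive f smf a) as Df.
  assert (EA : Aa a b = 2 * Derive f a * S a b / sg a b + 2 * f a * f a / sg a b
      - 2 * f a * S a b * sa a b / (sg a b * sg a b)).
  { rewrite <- (is_derive_unique _ _ _ (proj1 (PA a b))). apply is_derive_unique.
    eapply is_derive_value.
    - apply (is_derive_div (fun r => 2 * f r * S r b) (fun r => sgc r b)).
      + apply (is_derive_mult_R (fun r => 2 * f r) (fun r => S r b)); [|exact DS1].
        exact (is_derive_mult_R (fun _ => 2) f a _ _ (is_derive_const_R _ _) Df).
      + exact (cut_along (fun r => sg r b) a _ sgp (proj1 (Ps a b))).
      + specialize (sgc_pos a b); lra.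
    - rewrite (sgc_eq a b H). field. lra. }
  assert (EAab : Aab a b = Derive f a * (f a * ta a b - g b * sg a b) / (sg a b * sg a b)
      + f a * (Derive f a * ta a b + f a * ((f a * ta a b + g b * sg a b) / (2 * S a b)) - g b * sa a b) / (sg a b * sg a b)
      - 2 * f a * (f a * ta a b - g b * sg a b) * sa a b / (sg a b * sg a b * sg a b)).
  { rewrite (partials_schwarz Wa Aa Ab Aaa Aab Aba Abb PA PAa PAb (Hcont _ smAab) (Hcont _ smAba)).
    rewrite <- (is_derive_unique _ _ _ (proj1 (PAb a b))). apply is_derive_unique.
    (* The formula for [Ab] is known for [b <= r] only; [b < a] makes it hold on a neighbourhood of
       [a]. *)
    apply (is_derive_ext_gt (fun r => f r * (f r * ta r b - g b * sg r b) / (sg r b * sg r b)) _ b); [assumption| |].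
    - intros y Hy. symmetry. apply Ab_eq. lra.
    - eapply is_derive_value.
      + apply (is_derive_div (fun r => f r * (f r * ta r b - g b * sg r b)) (fun r => sg r b * sg r b)).
        * apply (is_derive_mult_R f (fun r => f r * ta r b - g b * sg r b)); [exact Df|].
          apply (is_derive_minus (fun r => f r * ta r b) (fun r => g b * sg r b)).
          -- apply (is_derive_mult_R f (fun r => ta r b)); [exact Df|exact (taD a b H)].
          -- exact (is_derive_mult_R (fun _ => g b) (fun r => sg r b) a _ _ (is_derive_const_R _ _) (proj1 (Ps a b))).
        * exact (is_derive_mult_R (fun r => sg r b) (fun r => sg r b) a _ _ (proj1 (Ps a b)) (proj1 (Ps a b))).
        * nra.
      + unfold minus, plus, opp; simpl. field. lra. }
  eapply is_derive_value.
  - apply (is_derive_div (fun r => Aa a r) (fun r => sgc a r)).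
    + apply PAa.
    + exact (cut_along (fun r => sg a r) b _ sgp (sgD a b H)).
    + specialize (sgc_pos a b); lra.
  - unfold rateP, targetP, Pq, Wa, Wb. rewrite EAab, EA. rewrite sgc_eq, tac_eq by assumption.
    field. lra.
Qed.

Lemma Qq_transport a b : b < a -> is_derive (fun r => Qq r b) a (- rateQ a b * (Qq a b - targetQ a b)).
Proof.
  intros Hlt. assert (H : b <= a) by lra.
  destruct (low a b H) as [sgp tap]. pose proof (Spos a b) as Sp.
  destruct (Hpart ta smta) as (sa & sb & Ps & _ & _).
  destruct (Hpart Bb smBb) as (Bba & Bbb & PBb & smBba & _).
  destruct (Hpart Ba smBa) as (Baa & Bab & PBa & _ & smBab).
  destruct (SD a b H) as [DS1 DS2].
  pose proof (smooth_is_derive g smg b) as Dg.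
  assert (EB : Bb a b = 2 * Derive g b * S a b / ta a b - 2 * g b * g b / ta a b
      - 2 * g b * S a b * sb a b / (ta a b * ta a b)).
  { rewrite <- (is_derive_unique _ _ _ (proj2 (PB a b))). apply is_derive_unique.
    eapply is_derive_value.
    - apply (is_derive_div (fun r => 2 * g r * S a r) (fun r => tac a r)).
      + apply (is_derive_mult_R (fun r => 2 * g r) (fun r => S a r)); [|exact DS2].
        exact (is_derive_mult_R (fun _ => 2) g b _ _ (is_derive_const_R _ _) Dg).
      + exact (cut_along (fun r => ta a r) b _ tap (proj2 (Ps a b))).
      + specialize (tac_pos a b); lra.
    - rewrite (tac_eq a b H). field. lra. }
  assert (EBba : Bba a b = Derive g b * (f a * ta a b - g b * sg a b) / (ta a b * ta a b)
      + g b * (f a * sb a b - Derive g b * sg a b + g b * ((f a * ta a b + g b * sg a b) / (2 * S a b))) / (ta a b * ta a b)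
      - 2 * g b * (f a * ta a b - g b * sg a b) * sb a b / (ta a b * ta a b * ta a b)).
  { rewrite <- (partials_schwarz Wb Ba Bb Baa Bab Bba Bbb PB PBa PBb (Hcont _ smBab) (Hcont _ smBba)).
    rewrite <- (is_derive_unique _ _ _ (proj2 (PBa a b))). apply is_derive_unique.
    apply (is_derive_ext_lt (fun r => g r * (f a * ta a r - g r * sg a r) / (ta a r * ta a r)) _ a); [assumption| |].
    - intros y Hy. symmetry. apply Ba_eq. lra.
    - eapply is_derive_value.
      + apply (is_derive_div (fun r => g r * (f a * ta a r - g r * sg a r)) (fun r => ta a r * ta a r)).
        * apply (is_derive_mult_R g (fun r => f a * ta a r - g r * sg a r)); [exact Dg|].
          apply (is_derive_minus (fun r => f a * ta a r) (fun r => g r * sg a r)).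
          -- exact (is_derive_mult_R (fun _ => f a) (fun r => ta a r) b _ _ (is_derive_const_R _ _) (proj2 (Ps a b))).
          -- apply (is_derive_mult_R g (fun r => sg a r)); [exact Dg|exact (sgD a b H)].
        * exact (is_derive_mult_R (fun r => ta a r) (fun r => ta a r) b _ _ (proj2 (Ps a b)) (proj2 (Ps a b))).
        * nra.
      + unfold minus, plus, opp; simpl. field. lra. }
  eapply is_derive_value.
  - apply (is_derive_div (fun r => - Bb r b) (fun r => tac r b)).
    + exact (is_derive_opp_R (fun r => Bb r b) a _ (proj1 (PBb a b))).
    + exact (cut_along (fun r => ta r b) a _ tap (taD a b H)).
    + specialize (tac_pos a b); lra.
  - unfold rateQ, targetQ, Qq, Wa, Wb, opp; simpl. rewrite EBba, EB. rewrite sgc_eq, tac_eq by assumption.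
    field. lra.
Qed.

(** On the diagonal A equals [4 f], so its two partial derivatives add up to [4 f'], and the one in
    [b] is already known. *)
Lemma Pq_diag x : Pq x x = 2 * (4 * Derive f x - 2 * f x * (f x - g x) / S x x) / S x x.
Proof.
  pose proof (Spos x x) as Sp. destruct (diag x) as [E1 E2].
  assert (D := partials_diag Wa Aa Ab PA (Hcont _ smAa) (Hcont _ smAb) x).
  assert (D2 : is_derive (fun r => Wa r r) x (4 * Derive f x)).
  { apply (is_derive_ext (fun r => 4 * f r)).
    - intros r. unfold Wa. rewrite sgc_eq by lra. destruct (diag r) as [-> _].
      pose proof (Spos r r). as_R. field. lra.
    - eapply is_derive_value; [exact (is_derive_mult_R (fun _ => 4) f x _ _ (is_derive_const_R _ _) (smooth_is_derive f smf x))|]. cbv beta. ring. }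
  assert (E : Aa x x = 4 * Derive f x - Ab x x).
  { rewrite <- (is_derive_unique _ _ _ D2), (is_derive_unique _ _ _ D). ring. }
  unfold Pq. rewrite E, Ab_eq, sgc_eq, E1, E2 by lra. field. lra.
Qed.

Lemma Qq_diag x : Qq x x = - 2 * (4 * Derive g x - 2 * g x * (f x - g x) / S x x) / S x x.
Proof.
  pose proof (Spos x x) as Sp. destruct (diag x) as [E1 E2].
  assert (D := partials_diag Wb Ba Bb PB (Hcont _ smBa) (Hcont _ smBb) x).
  assert (D2 : is_derive (fun r => Wb r r) x (4 * Derive g x)).
  { apply (is_derive_ext (fun r => 4 * g r)).
    - intros r. unfold Wb. rewrite tac_eq by lra. destruct (diag r) as [_ ->].
      pose proof (Spos r r). as_R. field. lra.
    - eapply is_derive_value; [exact (is_derive_mult_R (fun _ => 4) g x _ _ (is_derive_const_R _ _) (smooth_is_derive g smg x))|]. cbv beta. ring. }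
  assert (E : Bb x x = 4 * Derive g x - Ba x x).
  { rewrite <- (is_derive_unique _ _ _ D2), (is_derive_unique _ _ _ D). ring. }
  unfold Qq. rewrite E, Ba_eq, tac_eq, E1, E2 by lra. field. lra.
Qed.

Let target_bound Y a b : b <= a -> K ^ 2 / (4 * s0 ^ 2) <= Y ->
  Rabs (targetP a b) <= Y /\ Rabs (targetQ a b) <= Y.
Proof.
  intros H HY. destruct (W_bounds a b H) as [h1 h2]. pose proof (S0 a b H) as Sb.
  assert (Hs : 0 < s0 ^ 2) by nra.
  assert (Hi : / (4 * (S a b * S a b)) <= / (4 * s0 ^ 2)) by (apply Rinv_le_contravar; nra).
  assert (Hi0 : 0 < / (4 * (S a b * S a b))) by (apply Rinv_0_lt_compat; nra).
  assert (B : forall z, Rabs z <= K ^ 2 -> Rabs (z / (4 * (S a b * S a b))) <= Y).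
  { intros z Hz. unfold Rdiv. rewrite Rabs_mult, (Rabs_pos_eq (/ _)) by lra.
    eapply Rle_trans; [|exact HY]. apply Rmult_le_compat; try lra. apply Rabs_pos. }
  split; apply B; rewrite Rabs_mult; simpl; rewrite Rmult_1_r; apply Rmult_le_compat;
    try apply Rabs_pos; apply Rabs_le_between; lra.
Qed.

(** From the diagonal, [Pq] is followed with decreasing [b] and [Qq] with increasing [a]. The rates
    are nonnegative because A and B are, so both stay within [Y], which dominates the data and the
    targets. Then [utt] is at most [Y / 2 + Y / 4] in absolute value. *)
Lemma utt_bound Y : K ^ 2 / (4 * s0 ^ 2) <= Y ->
  (forall x, Rabs (Pq x x) <= Y) -> (forall x, Rabs (Qq x x) <= Y) ->
  forall a b, b <= a -> Rabs (utt a b) <= Y.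
Proof.
  intros HY HP HQ a b H.
  assert (rp0 : forall a b, b <= a -> 0 <= rateP a b /\ 0 <= rateQ a b).
  { intros a' b' H'. destruct (W_bounds a' b' H') as [h1 h2]. unfold rateP, rateQ.
    specialize (SSpos a' b'). specialize (sgc_pos a' b'). specialize (tac_pos a' b').
    split; (apply Rdiv_le_0_compat; [|assumption]); (apply Rmult_le_pos; [apply Rmult_le_pos|]); lra. }
  assert (BP : Rabs (Pq a b) <= Y).
  { apply (relaxation_backward_abs (fun s => Pq a s) (fun s => rateP a s) (fun s => targetP a s) Y b a); auto.
    - intros s. apply cont2_snd, (Hcont _ sm_Pq).
    - intros s. apply cont2_snd, (Hcont _ sm_rateP).
    - intros s Hs. apply Pq_transport; lra.
    - intros s Hs. split; [apply rp0; lra|]. apply (target_bound Y a s); lra. }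
  assert (BQ : Rabs (Qq a b) <= Y).
  { apply (relaxation_forward_abs (fun s => Qq s b) (fun s => rateQ s b) (fun s => targetQ s b) Y b a); auto.
    - intros s. apply (cont2_fst Qq), (Hcont _ sm_Qq).
    - intros s. apply (cont2_fst rateQ), (Hcont _ sm_rateQ).
    - intros s Hs. apply Qq_transport; lra.
    - intros s Hs. split; [apply rp0; lra|]. apply (target_bound Y s b); lra. }
  assert (B3 : 0 <= (Wa a b - Wb a b) ^ 2 / (16 * S a b * S a b) <= Y / 4).
  { destruct (W_bounds a b H) as [h1 h2]. pose proof (S0 a b H) as Sb. pose proof (Spos a b).
    assert (Hs : 0 < s0 ^ 2) by nra.
    assert (HSS : s0 ^ 2 <= S a b * S a b) by nra.
    assert (Hd : (Wa a b - Wb a b) ^ 2 <= K ^ 2).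
    { assert (0 <= (K - (Wa a b - Wb a b)) * (K + (Wa a b - Wb a b))) by (apply Rmult_le_pos; lra). nra. }
    pose proof (pow2_ge_0 (Wa a b - Wb a b)). split.
    - apply Rdiv_le_0_compat; [assumption|nra].
    - apply Rle_trans with (K ^ 2 / (4 * s0 ^ 2) / 4); [|lra].
      replace (K ^ 2 / (4 * s0 ^ 2) / 4) with (K ^ 2 * / (16 * s0 ^ 2)) by (field; lra).
      apply Rmult_le_compat; try lra.
      + left; apply Rinv_0_lt_compat; nra.
      + apply Rinv_le_contravar; nra. }
  unfold utt. apply Rabs_le_between in BP, BQ. apply Rabs_le_between. lra.
Qed.

End SecondOrder.

(** * Uniqueness: a second solution in the chart of the first *)

Section Uniqueness.
Variable v : R -> R -> R.
Let vt t x := dt (fun s => v s x) t.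
Let vx t x := Derive (v t) x.
Let vtt t x := dt (fun s => vt s x) t.
Let vtx t x := Derive (vt t) x.
Let vxt t x := dt (fun s => vx s x) t.
Let vxx t x := Derive (vx t) x.
Hypotheses (vC : class_C 3 (fun t x y => v t x)) (vpos : forall t x, 0 <= t -> 0 < v t x)
  (veq : forall t x, 0 < t -> vtt t x = Derive (fun r => vx t r / v t r) x)
  (v0 : forall x, v 0 x = S x x * S x x)
  (vt0 : forall x, vt 0 x = 2 * (f x + g x))
  (vx0 : forall x, vx 0 x = 2 * (f x - g x) * S x x).

Let h0 : half_C1 v vt vx. Proof. apply (class_C_half_C1 2 v vC). Qed.
Let ht : half_C1 vt vtt vtx.
Proof. apply (class_C_half_C1 1 vt). apply (class_C_half_C1 2 v vC). Qed.
Let hx : half_C1 vx vxt vxx.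
Proof. apply (class_C_half_C1 1 vx). apply (class_C_half_C1 2 v vC). Qed.

Let r t x := sqrt (v t x).
Let rpos t x : 0 <= t -> 0 < r t x.
Proof. intros H. apply sqrt_lt_R0, vpos, H. Qed.
Let rsq t x : 0 <= t -> r t x * r t x = v t x.
Proof. intros H. apply sqrt_sqrt. left. apply vpos, H. Qed.

Let av t x := vt t x + vx t x / r t x.
Let bv t x := vt t x - vx t x / r t x.
Let qx t x := (vxx t x * r t x - vx t x * (vx t x / (2 * r t x))) / v t x.
Let avx t x := vtx t x + qx t x.
Let bvx t x := vtx t x - qx t x.
(** Riemann form of the equation for [v]: [av] travels with speed [- 1 / r] up to a quadratic term.
    That this formula is the time derivative of [av] is part of [h_av]. *)
Let avt t x := avx t x / r t x + av t x * (bv t x - av t x) / (4 * v t x).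
Let bvt t x := - bvx t x / r t x + bv t x * (av t x - bv t x) / (4 * v t x).

Let hc_plus F G : half_cont F -> half_cont G -> half_cont (fun t x => F t x + G t x).
Proof. exact (cont2_plus _ _). Qed.
Let hc_mult F G : half_cont F -> half_cont G -> half_cont (fun t x => F t x * G t x).
Proof. exact (cont2_mult _ _). Qed.
Let hc_opp F : half_cont F -> half_cont (fun t x => - F t x).
Proof. exact (cont2_opp _). Qed.
Let hc_minus F G : half_cont F -> half_cont G -> half_cont (fun t x => F t x - G t x).
Proof. exact (cont2_minus _ _). Qed.
Let hc_div F G : half_cont F -> half_cont G -> (forall t x, 0 <= t -> 0 < G t x) ->
  half_cont (fun t x => F t x / G t x).
Proof.
  intros HF HG Hp. apply (cont2_mult _ _ HF), cont2_inv; [exact HG|]. intros a b. apply Hp, Rmax_l.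
Qed.
Let hc_const k : half_cont (fun _ _ => k).
Proof. exact (cont2_const k). Qed.
Let hc_v : half_cont v. Proof. apply h0. Qed.
Let hc_vt : half_cont vt. Proof. apply h0. Qed.
Let hc_vx : half_cont vx. Proof. apply h0. Qed.
Let hc_r : half_cont r.
Proof. apply (cont2_comp1 sqrt (fun t x => v (Rmax 0 t) x)); [apply continuous_sqrt|exact hc_v]. Qed.
Let hc_av : half_cont av. Proof. apply hc_plus; [exact hc_vt|]. now apply hc_div. Qed.
Let hc_bv : half_cont bv. Proof. apply hc_minus; [exact hc_vt|]. now apply hc_div. Qed.
Let hc_qx : half_cont qx.
Proof.
  apply hc_div; [|exact hc_v|exact vpos]. apply hc_minus.
  - apply hc_mult; [apply hx|exact hc_r].
  - apply hc_mult; [exact hc_vx|]. apply hc_div; [exact hc_vx|now apply hc_mult|].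
    intros t x Ht. specialize (rpos t x Ht). lra.
Qed.
Let hc_avx : half_cont avx. Proof. apply hc_plus; [apply ht|exact hc_qx]. Qed.
Let hc_bvx : half_cont bvx. Proof. apply hc_minus; [apply ht|exact hc_qx]. Qed.

Let quot_x t x : 0 < t -> is_derive (fun s => vx t s / r t s) x (qx t x).
Proof.
  intros Ht. pose proof (rpos t x ltac:(lra)) as rp. pose proof (rsq t x ltac:(lra)) as rs.
  eapply is_derive_value.
  - apply (is_derive_div (fun s => vx t s) (fun s => r t s)).
    + exact (half_C1_x _ _ _ hx t x Ht).
    + exact (is_derive_sqrt (fun s => v t s) x _ (half_C1_x _ _ _ h0 t x Ht) (vpos t x (Rlt_le _ _ Ht))).
    + lra.
  - unfold qx. change (sqrt (v t x)) with (r t x). rewrite <- rs. field. lra.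
Qed.

Let quot_t t x : 0 < t ->
  is_derive (fun s => vx s x / r s x) t ((vxt t x * r t x - vx t x * (vt t x / (2 * r t x))) / v t x).
Proof.
  intros Ht. pose proof (rpos t x ltac:(lra)) as rp. pose proof (rsq t x ltac:(lra)) as rs.
  eapply is_derive_value.
  - apply (is_derive_div (fun s => vx s x) (fun s => r s x)).
    + exact (half_C1_t _ _ _ hx t x Ht).
    + exact (is_derive_sqrt (fun s => v s x) t _ (half_C1_t _ _ _ h0 t x Ht) (vpos t x (Rlt_le _ _ Ht))).
    + lra.
  - cbv beta. change (sqrt (v t x)) with (r t x). rewrite <- rs. field. lra.
Qed.

Let veq' t x : 0 < t -> vtt t x = (vxx t x * v t x - vx t x * vx t x) / (v t x * v t x).
Proof.
  intros Ht. rewrite veq by assumption. apply is_derive_unique.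
  pose proof (vpos t x ltac:(lra)). eapply is_derive_value.
  - apply (is_derive_div (fun s => vx t s) (fun s => v t s)); [exact (half_C1_x _ _ _ hx t x Ht)|exact (half_C1_x _ _ _ h0 t x Ht)|lra].
  - field. lra.
Qed.

Let h_av : half_C1 av avt avx.
Proof.
  split.
  - exact hc_av.
  - apply hc_plus; [now apply hc_div|]. apply hc_div; [apply hc_mult; [exact hc_av|now apply hc_minus]|now apply hc_mult|].
    intros t x Ht. specialize (vpos t x Ht). lra.
  - exact hc_avx.
  - intros t x Ht. pose proof (rpos t x ltac:(lra)) as rp. pose proof (rsq t x ltac:(lra)) as rs.
    eapply is_derive_value.
    + apply (is_derive_plus_R (fun s => vt s x) (fun s => vx s x / r s x)); [exact (half_C1_t _ _ _ ht t x Ht)|exact (quot_t t x Ht)].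
    + unfold avt, avx, av, bv, qx. rewrite (half_C1_mixed v vt vx vtt vtx vxt vxx h0 ht hx t x Ht), veq' by assumption.
      rewrite <- rs. field. lra.
  - intros t x Ht. apply (is_derive_plus_R (fun s => vt t s) (fun s => vx t s / r t s)); [exact (half_C1_x _ _ _ ht t x Ht)|exact (quot_x t x Ht)].
Qed.

Let h_bv : half_C1 bv bvt bvx.
Proof.
  split.
  - exact hc_bv.
  - apply hc_plus; [apply hc_div; [now apply hc_opp|assumption|assumption]|].
    apply hc_div; [apply hc_mult; [exact hc_bv|now apply hc_minus]|now apply hc_mult|].
    intros t x Ht. specialize (vpos t x Ht). lra.
  - exact hc_bvx.
  - intros t x Ht. pose proof (rpos t x ltac:(lra)) as rp. pose proof (rsq t x ltac:(lra)) as rs.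
    eapply is_derive_value.
    + apply (is_derive_minus (fun s => vt s x) (fun s => vx s x / r s x)); [exact (half_C1_t _ _ _ ht t x Ht)|exact (quot_t t x Ht)].
    + unfold bvt, bvx, av, bv, qx. rewrite (half_C1_mixed v vt vx vtt vtx vxt vxx h0 ht hx t x Ht), veq' by assumption.
      unfold minus, plus, opp; simpl. rewrite <- rs. field. lra.
  - intros t x Ht. apply (is_derive_minus (fun s => vt t s) (fun s => vx t s / r t s)); [exact (half_C1_x _ _ _ ht t x Ht)|exact (quot_x t x Ht)].
Qed.

(** Clamping [T] at 0 makes the pull-back continuous on the whole plane and changes nothing on the
    chart, where [T] is nonnegative. *)
Let pb (F : R -> R -> R) a b := F (Rmax 0 (T a b)) (X a b).

Let pb_cont F : half_cont F -> cont2 (pb F).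
Proof.
  intros H a b. apply (continuity_2d_pt_filterlim (pb F)).
  apply (continuous_comp_2 (fun p : R * R => T (fst p) (snd p)) (fun p => X (fst p) (snd p))
    (fun t x => F (Rmax 0 t) x) (a, b)).
  - apply continuity_2d_pt_filterlim, (Hcont _ smT).
  - apply continuity_2d_pt_filterlim, (Hcont _ smX).
  - exact (proj1 (continuity_2d_pt_filterlim (fun t x => F (Rmax 0 t) x) (T a b) (X a b)) (H _ _)).
Qed.

Let Tpos a b : b < a -> 0 < T a b.
Proof.
  intros H. assert (Hab : b <= a) by lra.
  assert (L := time_lower T sg ta c HT low T0 a b Hab). nra.
Qed.

Let pb_eq F a b : b <= a -> pb F a b = F (T a b) (X a b).
Proof.
  intros H. unfold pb. destruct (al_be_chart a b H) as [Ht _]. now rewrite Rmax_right.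
Qed.

(** The coordinate lines are characteristics of the constructed solution, so the speed is [1 / S]
    and not [1 / r]. The mismatch is later expressed through [den]. *)
Let pb_snd F Ft Fx a b : half_C1 F Ft Fx -> b < a ->
  is_derive (fun s => pb F a s) b (- ta a b * (pb Ft a b - pb Fx a b / S a b)).
Proof.
  intros H Hab. assert (Hle : b <= a) by lra. rewrite !pb_eq by assumption. pose proof (Spos a b).
  apply (is_derive_ext_lt (fun s => F (T a s) (X a s)) _ a); [assumption| |].
  { intros y Hy. symmetry. apply pb_eq. lra. }
  apply is_derive_Reals.
  replace (- ta a b * (Ft (T a b) (X a b) - Fx (T a b) (X a b) / S a b)) with
    (Ft (T a b) (X a b) * - ta a b + Fx (T a b) (X a b) * (ta a b / S a b)) by (field; lra).
  apply (derivable_pt_lim_comp_2d F (fun s => T a s) (fun s => X a s)).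
  - apply half_C1_differentiable; auto.
  - apply is_derive_Reals, TD, Hle.
  - apply is_derive_Reals, XD, Hle.
Qed.

Let pb_fst F Ft Fx a b : half_C1 F Ft Fx -> b < a ->
  is_derive (fun s => pb F s b) a (sg a b * (pb Ft a b + pb Fx a b / S a b)).
Proof.
  intros H Hab. assert (Hle : b <= a) by lra. rewrite !pb_eq by assumption. pose proof (Spos a b).
  apply (is_derive_ext_gt (fun s => F (T s b) (X s b)) _ b); [assumption| |].
  { intros y Hy. symmetry. apply pb_eq. lra. }
  apply is_derive_Reals.
  replace (sg a b * (Ft (T a b) (X a b) + Fx (T a b) (X a b) / S a b)) with
    (Ft (T a b) (X a b) * sg a b + Fx (T a b) (X a b) * (sg a b / S a b)) by (field; lra).
  apply (derivable_pt_lim_comp_2d F (fun s => T s b) (fun s => X s b)).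
  - apply half_C1_differentiable; auto.
  - apply is_derive_Reals, TD, Hle.
  - apply is_derive_Reals, XD, Hle.
Qed.

Let V := pb v.
Let Rt := pb r.
Let A := pb av.
Let B := pb bv.
Let Vx := pb vx.
Let Ax := pb avx.
Let Bx := pb bvx.

Let Rt_pos a b : 0 < Rt a b. Proof. apply rpos, Rmax_l. Qed.
Let Rt_sq a b : Rt a b * Rt a b = V a b. Proof. apply rsq, Rmax_l. Qed.
Let V_pos a b : 0 < V a b. Proof. apply vpos, Rmax_l. Qed.

Let y1 a b := V a b - S a b * S a b.
Let y2 a b := A a b - Wa a b.
Let y3 a b := B a b - Wb a b.
(* 1/sqrt v - 1/sqrt u = - den * (v - u). *)
Let den a b := / (S a b * Rt a b * (S a b + Rt a b)).

Let den_id a b : / Rt a b - / S a b = - den a b * y1 a b.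
Proof.
  unfold den, y1. specialize (Rt_pos a b). pose proof (Spos a b). rewrite <- Rt_sq. field. lra.
Qed.

(** The differences solve a linear system once [Vx], [Ax], [Bx] and one factor of each quadratic
    term are regarded as given continuous coefficients. The mismatch of the speeds enters as [den]
    times [y1]. *)
Let c11 a b := ta a b * (Vx a b * den a b).
Let c13 a b := - ta a b.
Let c21 a b := ta a b * (Wa a b * (Wb a b - Wa a b) / (4 * V a b * (S a b * S a b)) + Ax a b * den a b).
Let c22 a b := - ta a b * (B a b - A a b - Wa a b) / (4 * V a b).
Let c23 a b := - ta a b * Wa a b / (4 * V a b).
Let c31 a b := sg a b * (- (Wb a b * (Wa a b - Wb a b)) / (4 * V a b * (S a b * S a b)) + Bx a b * den a b).
Let c32 a b := sg a b * Wb a b / (4 * V a b).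
Let c33 a b := sg a b * (A a b - B a b - Wb a b) / (4 * V a b).

Let y1_derive a b : b < a ->
  is_derive (fun s => y1 a s) b (c11 a b * y1 a b + 0 * y2 a b + c13 a b * y3 a b).
Proof.
  intros H. assert (Hle : b <= a) by lra. destruct (SD a b Hle) as [_ DS].
  destruct (low a b Hle) as [sgp tap]. pose proof (Spos a b). pose proof (Rt_pos a b).
  eapply is_derive_value.
  - apply (is_derive_minus (fun s => V a s) (fun s => S a s * S a s)).
    + exact (pb_snd v vt vx a b h0 H).
    + exact (is_derive_mult_R (fun s => S a s) (fun s => S a s) b _ _ DS DS).
  - unfold minus, plus, opp; simpl. fold Vx.
    assert (Evt : pb vt a b = B a b + Vx a b / Rt a b).
    { unfold B, Vx, Rt, bv, pb. ring. }
    rewrite Evt. unfold c11, c13.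
    replace (ta a b * (Vx a b * den a b) * y1 a b) with (- ta a b * Vx a b * (- den a b * y1 a b)) by ring.
    rewrite <- den_id. unfold y3, Wb. rewrite (tac_eq a b Hle). field. lra.
Qed.

Let y2_derive a b : b < a ->
  is_derive (fun s => y2 a s) b (c21 a b * y1 a b + c22 a b * y2 a b + c23 a b * y3 a b).
Proof.
  intros H. assert (Hle : b <= a) by lra.
  destruct (low a b Hle) as [sgp tap]. pose proof (Spos a b). pose proof (Rt_pos a b). pose proof (V_pos a b).
  eapply is_derive_value.
  - apply (is_derive_minus (fun s => A a s) (fun s => Wa a s)).
    + exact (pb_snd av avt avx a b h_av H).
    + exact (Wa_snd a b Hle).
  - unfold minus, plus, opp; simpl. fold Ax.
    assert (Et : pb avt a b = Ax a b * (/ Rt a b - / S a b) + Ax a b / S a b + A a b * (B a b - A a b) / (4 * V a b)).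
    { unfold Ax, A, B, V, Rt, avt, pb. unfold Rdiv. ring. }
    rewrite Et, den_id.
    assert (EW : f a * (f a * ta a b - g b * sg a b) / (sg a b * sg a b) =
      - ta a b * (Wa a b * (Wb a b - Wa a b) / (4 * (S a b * S a b)))).
    { unfold Wa, Wb. rewrite sgc_eq, tac_eq by assumption. field. lra. }
    rewrite EW. unfold c21, c22, c23. set (D := den a b). unfold y1, y2, y3. field. lra.
Qed.

Let y3_derive a b : b < a ->
  is_derive (fun s => y3 s b) a (c31 a b * y1 a b + c32 a b * y2 a b + c33 a b * y3 a b).
Proof.
  intros H. assert (Hle : b <= a) by lra.
  destruct (low a b Hle) as [sgp tap]. pose proof (Spos a b). pose proof (Rt_pos a b). pose proof (V_pos a b).
  eapply is_derive_value.
  - apply (is_derive_minus (fun s => B s b) (fun s => Wb s b)).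
    + exact (pb_fst bv bvt bvx a b h_bv H).
    + exact (Wb_fst a b Hle).
  - unfold minus, plus, opp; simpl. fold Bx.
    assert (Et : pb bvt a b = - Bx a b * (/ Rt a b - / S a b) - Bx a b / S a b + B a b * (A a b - B a b) / (4 * V a b)).
    { unfold Bx, A, B, V, Rt, bvt, pb. unfold Rdiv. ring. }
    rewrite Et, den_id.
    assert (EW : g b * (f a * ta a b - g b * sg a b) / (ta a b * ta a b) =
      sg a b * (Wb a b * (Wa a b - Wb a b) / (4 * (S a b * S a b)))).
    { unfold Wa, Wb. rewrite sgc_eq, tac_eq by assumption. field. lra. }
    rewrite EW. unfold c31, c32, c33. set (D := den a b). unfold y1, y2, y3. field. lra.
Qed.

Let cV : cont2 V := pb_cont v hc_v.
Let cRt : cont2 Rt := pb_cont r hc_r.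
Let cAv : cont2 A := pb_cont av hc_av.
Let cBv : cont2 B := pb_cont bv hc_bv.
Let cVx : cont2 Vx := pb_cont vx hc_vx.
Let cAx : cont2 Ax := pb_cont avx hc_avx.
Let cBx : cont2 Bx := pb_cont bvx hc_bvx.
Let cS : cont2 S := Hcont S smS.
Let csg : cont2 sg := Hcont sg smsg.
Let cta : cont2 ta := Hcont ta smta.
Let cWa : cont2 Wa := Hcont Wa sm_Wa.
Let cWb : cont2 Wb := Hcont Wb sm_Wb.
Let cSS : cont2 (fun a b => S a b * S a b) := cont2_mult S S cS cS.
Let cden : cont2 den.
Proof.
  apply cont2_inv; [exact (cont2_mult _ _ (cont2_mult _ _ cS cRt) (cont2_plus _ _ cS cRt))|].
  intros a b. specialize (Rt_pos a b). specialize (Spos a b).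
  apply Rmult_lt_0_compat; [apply Rmult_lt_0_compat|]; lra.
Qed.
Let ciV : cont2 (fun a b => / (4 * V a b)).
Proof.
  apply cont2_inv; [exact (cont2_mult _ _ (cont2_const 4) cV)|]. intros a b. specialize (V_pos a b). lra.
Qed.
Let ciVS : cont2 (fun a b => / (4 * V a b * (S a b * S a b))).
Proof.
  apply cont2_inv; [exact (cont2_mult _ _ (cont2_mult _ _ (cont2_const 4) cV) cSS)|].
  intros a b. specialize (V_pos a b). specialize (Spos a b).
  repeat apply Rmult_lt_0_compat; lra.
Qed.

Let diag_zero x : y1 x x = 0 /\ y2 x x = 0 /\ y3 x x = 0.
Proof.
  pose proof (Spos x x) as Sp. assert (Hx : x <= x) by lra.
  assert (ER : r 0 x = S x x) by (unfold r; rewrite v0; apply sqrt_square; lra).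
  unfold y1, y2, y3, V, A, B. rewrite !pb_eq by assumption. rewrite T0, X0.
  unfold av, bv. rewrite v0, vt0, vx0, ER.
  unfold Wa, Wb. rewrite sgc_eq, tac_eq by assumption. destruct (diag x) as [-> ->].
  repeat split; field; lra.
Qed.

Lemma solution_unique t x : 0 <= t -> v t x = sol t x.
Proof.
  intros Ht. destruct (al_be_spec t x Ht) as (Hab & E1 & E2).
  assert (Z : y1 (al t x) (be t x) = 0).
  { apply (characteristic_uniqueness y1 y2 y3 c11 (fun _ _ => 0) c13 c21 c22 c23 c31 c32 c33); auto.
    - exact (cont2_minus _ _ cV cSS).
    - exact (cont2_minus _ _ cAv cWa).
    - exact (cont2_minus _ _ cBv cWb).
    - exact (cont2_mult _ _ cta (cont2_mult _ _ cVx cden)).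
    - apply cont2_const.
    - exact (cont2_opp _ cta).
    - exact (cont2_mult _ _ cta (cont2_plus _ _ (cont2_mult _ _ (cont2_mult _ _ cWa (cont2_minus _ _ cWb cWa)) ciVS)
        (cont2_mult _ _ cAx cden))).
    - exact (cont2_mult _ _ (cont2_mult _ _ (cont2_opp _ cta) (cont2_minus _ _ (cont2_minus _ _ cBv cAv) cWa)) ciV).
    - exact (cont2_mult _ _ (cont2_mult _ _ (cont2_opp _ cta) cWa) ciV).
    - exact (cont2_mult _ _ csg (cont2_plus _ _ (cont2_mult _ _ (cont2_opp _ (cont2_mult _ _ cWb (cont2_minus _ _ cWa cWb))) ciVS)
        (cont2_mult _ _ cBx cden))).
    - exact (cont2_mult _ _ (cont2_mult _ _ csg cWb) ciV).
    - exact (cont2_mult _ _ (cont2_mult _ _ csg (cont2_minus _ _ (cont2_minus _ _ cAv cBv) cWb)) ciV). }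
  unfold y1, V in Z. rewrite pb_eq, E1, E2 in Z by assumption. unfold sol. lra.
Qed.

End Uniqueness.

(** * The constructed metric: flow equation, growth and curvature *)

Section Flow.
Variables (u0 u1 : R -> R).
Hypotheses (Hu0 : forall x, S x x * S x x = u0 x) (Hu1 : forall x, 2 * (f x + g x) = u1 x)
  (Hu0' : forall x, 2 * (f x - g x) * S x x = Derive u0 x).

Let second_order : exists W : R -> R -> R, forall t x, 0 <= t ->
  is_dt (fun s => dt (fun r => sol r x) s) t (W t x) /\
  is_derive (fun r => Derive (sol t) r / sol t r) x (W t x).
Proof.
  destruct (Hpart Wa sm_Wa) as (Aa & Ab & PA & HAa & HAb).
  destruct (Hpart Wb sm_Wb) as (Ba & Bb & PB & HBa & HBb).
  exists (fun t x => utt Aa Bb (al t x) (be t x)). intros t x Ht. split.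
  - now apply (sol_dtt Aa Ab Ba Bb).
  - now apply (sol_dxx_log Aa Ab Ba Bb).
Qed.

Let is_dt_scal_r (y : R -> R) t l k : 0 <= t -> is_dt y t l -> is_dt (fun s => y s * k) t (l * k).
Proof.
  intros Ht H. rewrite is_dt_iff in * by assumption. intros eps Heps.
  destruct (H (eps / (Rabs k + 1))) as [d [dp Hd]].
  { apply Rdiv_lt_0_compat; [assumption|]. pose proof (Rabs_pos k). lra. }
  exists d. split; [assumption|]. intros s Hs Hst. specialize (Hd s Hs Hst).
  replace (y s * k - y t * k - l * k * (s - t)) with ((y s - y t - l * (s - t)) * k) by ring.
  rewrite Rabs_mult. pose proof (Rabs_pos k). pose proof (Rabs_pos (s - t)).
  apply Rle_trans with (eps / (Rabs k + 1) * Rabs (s - t) * (Rabs k + 1)).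
  - apply Rmult_le_compat; try lra. apply Rabs_pos.
  - right. field. lra.
Qed.

Lemma sol_hgf : hgf_solution u0 u1 (conformal sol).
Proof.
  destruct second_order as [W HW]. split; [|split; [|split; [|split]]].
  - intros n i j. apply sol_class_C.
  - intros t _. apply (riemannian_conformal (sol t)). intros x. apply sol_pos.
  - intros t x y i j Ht. destruct (HW t x Ht) as [W1 W2].
    assert (R1 := ricci_conformal (sol t) (fun r => sol_pos t r) i j x y).
    assert (U : Derive (fun r : R => Derive (sol t) r / sol t r) x = W t x) by exact (is_derive_unique _ _ _ W2).
    rewrite U in R1. change (ricci (conformal sol t) i j x y = - / 2 * W t x * kronecker i j) in R1. rewrite R1.
    replace (- 2 * (- / 2 * W t x * kronecker i j)) with (W t x * kronecker i j) by field.
    apply dt_eq; [assumption|].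
    apply (is_dt_ext (fun s => dt (fun r => sol r x) s * kronecker i j)); [assumption| |].
    + intros s Hs. symmetry. apply dt_eq; [assumption|]. apply is_dt_scal_r; [assumption|].
      apply dt_correct; [assumption|]. eexists.
      exact (half_differentiable_dt _ _ _ _ _ Hs (sol_derivatives s x Hs)).
    + now apply is_dt_scal_r.
  - intros x y i j. unfold conformal. now rewrite sol_zero, Hu0.
  - intros x y i j. apply dt_eq; [lra|]. apply is_dt_scal_r; [lra|]. rewrite <- Hu1, <- sol_dt_zero.
    apply dt_correct; [lra|]. eexists.
    exact (half_differentiable_dt _ _ _ _ _ (Rle_refl 0) (sol_derivatives 0 x (Rle_refl 0))).
Qed.

Lemma sol_unique_conformal : unique_conformal_solution u0 u1 sol.
Proof.
  split; [exact sol_hgf|]. intros v (Hs & Hr & Heq & H0 & H1).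
  assert (vC : forall n, class_C n (fun t x y => v t x)).
  { intros n. apply (class_C_ext n (fun t => conformal v t i1 i1)); [|apply Hs].
    intros t x y _. apply Rmult_1_r. }
  assert (vpos : forall t x, 0 <= t -> 0 < v t x).
  { intros t x Ht. apply riemannian_conformal_pos, (Hr t Ht). }
  assert (E1 : forall w : R -> R -> R, forall x, (fun s => w s x * 1) = (fun s => w s x)).
  { intros w x. extensionality s. apply Rmult_1_r. }
  assert (V0 : forall x, v 0 x = u0 x).
  { intros x. specialize (H0 x 0 i1 i1). unfold conformal in H0. simpl in H0. now rewrite !Rmult_1_r in H0. }
  apply (solution_unique v (vC 3%nat) vpos).
  - intros t x Ht. assert (Ht' : 0 <= t) by lra. specialize (Heq t x 0 i1 i1 Ht').
    unfold conformal at 2 in Heq.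
    rewrite (ricci_conformal (v t) (fun r => vpos t r Ht')) in Heq.
    unfold conformal in Heq. simpl kronecker in Heq.
    replace (fun s => dt (fun r => v r x * 1) s) with (fun s => dt (fun r => v r x) s) in Heq
      by (now rewrite E1).
    rewrite Heq. field.
  - intros x. now rewrite V0, Hu0.
  - intros x. specialize (H1 x 0 i1 i1). unfold conformal in H1. simpl in H1.
    rewrite E1, Rmult_1_r in H1. now rewrite H1, Hu1.
  - intros x. rewrite Hu0'. apply Derive_ext. exact V0.
Qed.

Lemma sol_lower t x : 0 <= t -> s0 ^ 2 <= sol t x.
Proof.
  intros Ht. destruct (al_be_spec t x Ht) as [H _]. pose proof (S0 _ _ H). unfold sol. nra.
Qed.

(** On a line of constant [b], [u - e t] has derivative [2 f S - e sg >= 0] and starts at [t = 0]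
    from at least [s0 ^ 2]. *)
Lemma sol_growth e : (forall a b, b <= a -> e * sg a b <= 2 * f a * S a b) ->
  forall t x, 0 <= t -> s0 ^ 2 + e * t <= sol t x.
Proof.
  intros He t x Ht. destruct (al_be_spec t x Ht) as (H & E & _). unfold sol.
  set (a := al t x) in *. set (b := be t x) in *.
  assert (D : forall r, b <= r ->
    is_derive (fun r => S r b * S r b - e * T r b) r (f r * S r b + S r b * f r - (0 * T r b + e * sg r b))).
  { intros r Hr. apply (is_derive_minus (fun r => S r b * S r b) (fun r => e * T r b)).
    - exact (is_derive_mult_R (fun r => S r b) (fun r => S r b) r _ _ (proj1 (SD r b Hr)) (proj1 (SD r b Hr))).
    - exact (is_derive_mult_R (fun _ => e) (fun r => T r b) r _ _ (is_derive_const_R _ _) (proj1 (TD r b Hr))). }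
  assert (L : S b b * S b b - e * T b b <= S a b * S a b - e * T a b).
  { apply (le_of_derive (fun r => S r b * S r b - e * T r b)
      (fun r => f r * S r b + S r b * f r - (0 * T r b + e * sg r b))); [assumption| | |].
    - intros r Hr. apply (ex_derive_continuous (V := R_NormedModule)). eexists. apply D; lra.
    - intros r Hr. apply D; lra.
    - intros r Hr. specialize (He r b ltac:(lra)). lra. }
  rewrite E, T0 in L. pose proof (S0 b b (Rle_refl b)). nra.
Qed.

(** The curvature is [- (ln u)_xx / u], and its numerator is [- utt]. The two pointwise hypotheses
    bound [Pq] and [Qq] on the diagonal. *)
Lemma sol_curvature K Y : 0 < K -> (forall x, 0 <= f x) -> (forall x, 0 <= g x) ->
  (forall a b, b <= a -> 2 * f a * S a b <= K * sg a b /\ 2 * g b * S a b <= K * ta a b) ->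
  K ^ 2 / (4 * s0 ^ 2) <= Y ->
  (forall x, Rabs (2 * (4 * Derive f x - 2 * f x * (f x - g x) / S x x) / S x x) <= Y) ->
  (forall x, Rabs (2 * (4 * Derive g x - 2 * g x * (f x - g x) / S x x) / S x x) <= Y) ->
  forall t x y, 0 <= t -> Rabs (scalar_curvature (conformal sol t) x y) <= Y / sol t x.
Proof.
  intros Kp fp gp HK HY HP HQ t x y Ht.
  destruct (Hpart Wa sm_Wa) as (Aa & Ab & PA & HAa & HAb).
  destruct (Hpart Wb sm_Wb) as (Ba & Bb & PB & HBa & HBb).
  assert (W2 := sol_dxx_log Aa Ab Ba Bb PA PB t x Ht).
  unfold conformal.
  rewrite (scalar_curvature_conformal (sol t) (fun r => sol_pos t r)).
  assert (U := is_derive_unique _ _ _ W2). cbv beta in U.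
  change (Derive (fun r : R => Derive (sol t) r / sol t r) x = utt Aa Bb (al t x) (be t x)) in U.
  rewrite U. pose proof (sol_pos t x) as Sp.
  unfold Rdiv. rewrite Rabs_mult, Rabs_Ropp, Rabs_inv, (Rabs_pos_eq (sol t x)) by lra.
  apply Rmult_le_compat_r; [left; now apply Rinv_0_lt_compat|].
  destruct (al_be_spec t x Ht) as [H _].
  apply (utt_bound Aa Ab Ba Bb PA PB HAa HAb HBa HBb K Kp fp gp HK Y HY); [| |exact H].
  - intros z. rewrite (Pq_diag Aa Ab PA HAa HAb). apply HP.
  - intros z. rewrite (Qq_diag Ba Bb PB HBa HBb).
    replace (-2 * (4 * Derive g z - 2 * g z * (f z - g z) / S z z) / S z z) with
      (- (2 * (4 * Derive g z - 2 * g z * (f z - g z) / S z z) / S z z)) by (pose proof (Spos z z); field; lra).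
    rewrite Rabs_Ropp. apply HQ.
Qed.

End Flow.

End CharacteristicSolution.

(** * The flow *)

Lemma Ck_norm_bound k h (N : R) : Rbar_le (Ck_norm k h) N ->
  forall j x, (j <= k)%nat -> Rabs (Derive_n h j x) <= N.
Proof.
  intros H j x Hj.
  destruct (Lub_Rbar_correct (fun r => exists j x, (j <= k)%nat /\ r = Rabs (Derive_n h j x))) as [U _].
  specialize (U (Rabs (Derive_n h j x)) (ex_intro _ j (ex_intro _ x (conj Hj eq_refl)))).
  change (Rbar_le (Rabs (Derive_n h j x)) N). exact (Rbar_le_trans _ _ _ U H).
Qed.

Lemma admissible_initial_data m M N0 N1 u0 u1 : 0 < m -> initial_data m M N0 N1 u0 u1 ->
  (forall x, u1 x >= Rabs (Derive u0 x) / sqrt (u0 x)) -> admissible m M N0 N1 u0 u1.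
Proof.
  intros Hm (S0 & B0 & Hb & S1 & B1) Hc. split; auto.
  - intros x. exact (Ck_norm_bound 2 u0 N0 B0 1 x ltac:(lia)).
  - intros x. exact (Ck_norm_bound 2 u0 N0 B0 2 x ltac:(lia)).
  - intros x. exact (Ck_norm_bound 1 u1 N1 B1 0 x ltac:(lia)).
  - intros x. exact (Ck_norm_bound 1 u1 N1 B1 1 x ltac:(lia)).
Qed.

Lemma Rabs_div_le x X s S : 0 < s -> s <= S -> Rabs x <= X -> Rabs (x / S) <= X / s.
Proof.
  intros Hs HS Hx. unfold Rdiv. rewrite Rabs_mult, Rabs_inv, (Rabs_pos_eq S) by lra.
  apply Rmult_le_compat; [apply Rabs_pos|left; apply Rinv_0_lt_compat; lra|assumption|].
  apply Rinv_le_contravar; lra.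
Qed.

(** Bounds [u1'] plus or minus the derivative of [u0' / sqrt u0], expanded by the quotient rule. *)
Definition slope_derivative_bound (m N0 N1 : R) : R :=
  N1 + (N0 / sqrt m + N0 * N0 / (2 * m * sqrt m)).

(** The first summand bounds [Pq] and [Qq] at [t = 0]; the second is the bound [K ^ 2 / (4 s0 ^ 2)]
    for their targets, with [s0 ^ 2 = m]. The sum dominates both. *)
Definition second_derivative_bound (m N0 N1 : R) : R :=
  2 * (slope_derivative_bound m N0 N1 + 2 * (slope_bound m N0 N1 / 4) ^ 2 / sqrt m) / sqrt m
  + slope_bound m N0 N1 ^ 2 / (4 * m) + 1.

Lemma slope_derivatives m M N0 N1 u0 u1 : admissible m M N0 N1 u0 u1 -> forall x,
  Rabs (4 * Derive (rp' u0 u1) x) <= slope_derivative_bound m N0 N1 /\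
  Rabs (4 * Derive (rm' u0 u1) x) <= slope_derivative_bound m N0 N1.
Proof.
  intros H x.
  assert (Hm := adm_m _ _ _ _ _ _ H).
  assert (up := u0_pos _ _ _ _ _ _ H x). assert (sp := sqrt_lt_R0 _ up).
  assert (smp := sqrt_lt_R0 _ Hm). assert (sl := sqrt_u0_lower _ _ _ _ _ _ H x).
  assert (ss : sqrt (u0 x) * sqrt (u0 x) = u0 x) by (apply sqrt_sqrt; lra).
  set (s := sqrt (u0 x)) in *.
  set (q := Derive (Derive u0) x / s - Derive u0 x * Derive u0 x / (2 * u0 x * s)).
  assert (Dq : is_derive (fun x => Derive u0 x / sqrt (u0 x)) x q).
  { eapply is_derive_value.
    - apply (is_derive_div (Derive u0) (fun x => sqrt (u0 x))).
      + apply smooth_is_derive, smooth_Derive, (adm_u0 _ _ _ _ _ _ H).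
      + exact (is_derive_sqrt_u0 _ _ _ _ _ _ H x).
      + fold s; lra.
    - unfold q. fold s. rewrite <- ss. field. lra. }
  assert (D1 := smooth_is_derive u1 (adm_u1 _ _ _ _ _ _ H) x).
  assert (Ep : Derive (rp' u0 u1) x = (Derive u1 x + q) / 4).
  { apply is_derive_unique. apply (is_derive_div_const (fun x => u1 x + Derive u0 x / sqrt (u0 x))).
    now apply is_derive_plus_R. }
  assert (Em : Derive (rm' u0 u1) x = (Derive u1 x + - q) / 4).
  { apply is_derive_unique. apply (is_derive_div_const (fun x => u1 x + - (Derive u0 x / sqrt (u0 x)))).
    apply is_derive_plus_R; [assumption|]. now apply (is_derive_opp_R (fun x => Derive u0 x / sqrt (u0 x))). }
  assert (Bq : Rabs q <= N0 / sqrt m + N0 * N0 / (2 * m * sqrt m)).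
  { pose proof (adm_u0' _ _ _ _ _ _ H x) as A1. pose proof (adm_u0'' _ _ _ _ _ _ H x) as A2.
    pose proof (Rabs_pos (Derive u0 x)). pose proof (adm_bounds _ _ _ _ _ _ H x).
    unfold q. eapply Rle_trans; [apply Rabs_triang|]. rewrite Rabs_Ropp. unfold Rdiv.
    rewrite !Rabs_mult, !Rabs_inv, !Rabs_mult, (Rabs_pos_eq s), (Rabs_pos_eq 2), (Rabs_pos_eq (u0 x)) by lra.
    assert (/ s <= / sqrt m) by (apply Rinv_le_contravar; lra).
    assert (0 < / s) by (now apply Rinv_0_lt_compat).
    apply Rplus_le_compat; apply Rmult_le_compat; try lra.
    - apply Rabs_pos.
    - nra.
    - left; apply Rinv_0_lt_compat. nra.
    - apply Rmult_le_compat; lra.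
    - apply Rinv_le_contravar; [nra|]. apply Rmult_le_compat; nra. }
  pose proof (adm_u1' _ _ _ _ _ _ H x) as A3.
  unfold slope_derivative_bound. rewrite Ep, Em. split.
  - replace (4 * ((Derive u1 x + q) / 4)) with (Derive u1 x + q) by field.
    eapply Rle_trans; [apply Rabs_triang|lra].
  - replace (4 * ((Derive u1 x + - q) / 4)) with (Derive u1 x + - q) by field.
    eapply Rle_trans; [apply Rabs_triang|]. rewrite Rabs_Ropp. lra.
Qed.

(** One construction serves both assertions. The curvature bound is left divided by [u], so that it
    gives boundedness or decay according to which lower bound on [u] is available. *)
Lemma flow_solution m M N0 N1 u0 u1 : admissible m M N0 N1 u0 u1 ->
  exists u : R -> R -> R, unique_conformal_solution u0 u1 u /\
    (forall t x, 0 <= t -> m <= u t x) /\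
    (forall e, 0 < e -> (forall x, u1 x >= Rabs (Derive u0 x) / sqrt (u0 x) + e) ->
       forall t x, 0 <= t -> m + e * t <= u t x) /\
    (forall t x y, 0 <= t ->
       Rabs (scalar_curvature (conformal u t) x y) <= second_derivative_bound m N0 N1 / u t x).
Proof.
  intros H. destruct (goursat_solution _ _ _ _ _ _ H) as (p & q & Hpq).
  assert (Hm := adm_m _ _ _ _ _ _ H). assert (smp := sqrt_lt_R0 _ Hm).
  assert (sm2 : sqrt m ^ 2 = m) by (simpl; rewrite Rmult_1_r; apply sqrt_sqrt; lra).
  set (f := rp' u0 u1). set (g := rm' u0 u1). set (S := root_c m u0 u1).
  set (sg := sig m u0 u1 p). set (ta := tau m u0 u1 q).
  set (T := time_of m u0 u1 p). set (X := pos_of m u0 u1 p).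
  set (gen := pq_gen p q).
  assert (Hcont : forall h, smooth_fn gen h -> cont2 h) by (intros h; eapply smg_cont; exact Hpq).
  assert (Hpart : forall h, smooth_fn gen h -> exists ha hb, partials h ha hb /\ smooth_fn gen ha /\ smooth_fn gen hb)
    by exact (smg_partials _ _ _ _ _ _ H p q Hpq).
  assert (smf : smooth f) by exact (smooth_rp' _ _ _ _ _ _ H).
  assert (smg : smooth g) by exact (smooth_rm' _ _ _ _ _ _ H).
  assert (smS : smooth_fn gen S) by exact (sm_root_c _ _ _ _ _ _ H gen).
  assert (smsg : smooth_fn gen sg) by exact (sm_sig _ _ _ _ _ _ H p q).
  assert (smta : smooth_fn gen ta) by exact (sm_tau _ _ _ _ _ _ H p q).
  assert (smT : smooth_fn gen T) by exact (sm_time_of _ _ _ _ _ _ H p q).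
  assert (smX : smooth_fn gen X) by exact (sm_pos_of _ _ _ _ _ _ H p q).
  assert (cpos : 0 < sqrt m / 2) by lra.
  assert (Spos : forall a b, 0 < S a b) by exact (root_c_pos _ _ _ _ _ _ H).
  assert (SD : forall a b, b <= a -> is_derive (fun r => S r b) a (f a) /\ is_derive (fun r => S a r) b (- g b))
    by exact (is_derive_root_c _ _ _ _ _ _ H).
  assert (S0 : forall a b, b <= a -> sqrt m <= S a b).
  { intros a b Hab. unfold S. rewrite (root_c_eq _ _ _ _ _ _ H) by assumption.
    exact (root_lower _ _ _ _ _ _ H a b Hab). }
  assert (low := sig_tau_lower _ _ _ _ _ _ H p q Hpq). fold sg ta in low.
  assert (sgD := sig_snd _ _ _ _ _ _ H p q Hpq). fold f g S sg ta in sgD.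
  assert (taD := tau_fst _ _ _ _ _ _ H p q Hpq). fold f g S sg ta in taD.
  assert (diag := sig_tau_diag _ _ _ _ _ _ H p q Hpq). fold S sg ta in diag.
  assert (TD := time_of_partials _ _ _ _ _ _ H p q Hpq). fold sg ta T in TD.
  assert (XD := pos_of_partials _ _ _ _ _ _ H p q Hpq). fold S sg ta X in XD.
  assert (T0 : forall b, T b b = 0) by (intros b; exact (RInt_point b (fun s => sg s b))).
  assert (X0 : forall b, X b b = b).
  { intros b. unfold X, pos_of. rewrite RInt_point. apply Rplus_0_r. }
  assert (Sdiag : forall x, S x x = sqrt (u0 x)).
  { intros x. unfold S. rewrite (root_c_eq _ _ _ _ _ _ H) by lra. apply root_diag. }
  assert (up := u0_pos _ _ _ _ _ _ H).
  assert (spos := fun x => sqrt_lt_R0 _ (up x)).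
  set (K := slope_bound m N0 N1).
  assert (Kp : 0 < K) by exact (slope_bound_pos _ _ _ _ _ _ H).
  assert (fg : forall x, 0 <= 4 * f x <= K /\ 0 <= 4 * g x <= K) by exact (rpm'_bounds _ _ _ _ _ _ H).
  assert (HK := slopes_upper _ _ _ _ _ _ H p q Hpq K).
  exists (sol S T X). split; [|split; [|split]].
  - apply (sol_unique_conformal gen f g S sg ta T X (sqrt m / 2) (sqrt m)); auto.
    + intros x. rewrite Sdiag. apply sqrt_sqrt. specialize (up x). lra.
    + intros x. unfold f, g, rp', rm'. field. specialize (spos x). lra.
    + intros x. rewrite Sdiag. unfold f, g, rp', rm'. field. specialize (spos x). lra.
  - intros t x Ht. rewrite <- sm2. 
    apply (sol_lower gen S sg ta T X (sqrt m / 2) (sqrt m)); auto.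
  - intros e He Hc t x Ht. rewrite <- sm2 at 1.
    apply (sol_growth gen f g S sg ta T X (sqrt m / 2) (sqrt m)); auto.
    intros a b Hab. apply (slopes_lower _ _ _ _ _ _ H p q Hpq e); [|assumption].
    intros z. specialize (Hc z). specialize (spos z).
    assert (E : Rabs (Derive u0 z) / sqrt (u0 z) = Rabs (Derive u0 z / sqrt (u0 z))).
    { unfold Rdiv. now rewrite Rabs_mult, Rabs_inv, (Rabs_pos_eq (sqrt _)) by lra. }
    rewrite E in Hc. unfold rp', rm'. set (w := Derive u0 z / sqrt (u0 z)) in *.
    revert Hc. unfold Rabs. destruct Rcase_abs; intros; lra.
  - set (L := slope_derivative_bound m N0 N1).
    set (Y1 := 2 * (L + 2 * (K / 4) ^ 2 / sqrt m) / sqrt m).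
    (* This covers the diagonal values of both [Pq] and [Qq]: [d] stands for [f'] or [g'], [z] for
       [f] or [g], and [w] for [f - g]. *)
    assert (Bd : forall d z w x, Rabs (4 * d) <= L -> 0 <= 4 * z <= K -> Rabs (4 * w) <= K ->
      Rabs (2 * (4 * d - 2 * z * w / S x x) / S x x) <= Y1).
    { intros d z w x Hd Hz Hw. pose proof (S0 x x (Rle_refl x)) as Sx.
      rewrite Rabs_mult, (Rabs_pos_eq 4) in Hw by lra. pose proof (Rabs_pos w).
      apply Rabs_div_le; [assumption|assumption|].
      rewrite Rabs_mult, (Rabs_pos_eq 2) by lra. apply Rmult_le_compat_l; [lra|].
      eapply Rle_trans; [apply Rabs_triang|]. rewrite Rabs_Ropp. apply Rplus_le_compat; [assumption|].
      apply Rabs_div_le; [assumption|assumption|].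
      rewrite !Rabs_mult, (Rabs_pos_eq 2), (Rabs_pos_eq z) by lra.
      replace (2 * (K / 4) ^ 2) with (2 * (K / 4) * (K / 4)) by ring. apply Rmult_le_compat; lra. }
    assert (Y1p : 0 <= Y1).
    { specialize (Bd 0 0 0 0). eapply Rle_trans; [apply Rabs_pos|apply Bd].
      - rewrite Rmult_0_r, Rabs_R0. eapply Rle_trans; [apply Rabs_pos|].
        apply (slope_derivatives m M N0 N1 u0 u1 H 0).
      - lra.
      - rewrite Rmult_0_r, Rabs_R0. lra. }
    assert (Kq : 0 <= K ^ 2 / (4 * m)) by (apply Rdiv_le_0_compat; nra).
    assert (Hfg : forall x, Rabs (4 * (f x - g x)) <= K).
    { intros x. destruct (fg x). apply Rabs_le_between. lra. }
    apply (sol_curvature gen f g S sg ta T X (sqrt m / 2) (sqrt m)) with (K := K); auto.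
    + intros x. destruct (fg x). lra.
    + intros x. destruct (fg x). lra.
    + apply HK. intros x. destruct (fg x). split; [apply H0|apply H1].
    + rewrite sm2. unfold second_derivative_bound. fold L K Y1. lra.
    + intros x. eapply Rle_trans; [apply Bd; auto|].
      * apply (slope_derivatives m M N0 N1 u0 u1 H x).
      * apply fg.
      * unfold second_derivative_bound. fold L K Y1. lra.
    + intros x. eapply Rle_trans; [apply Bd; auto|].
      * apply (slope_derivatives m M N0 N1 u0 u1 H x).
      * apply fg.
      * unfold second_derivative_bound. fold L K Y1. lra.
Qed.

Theorem theorem1p2 (M N0 N1 : R) (hM : 0 < M) :
  (forall m : R, 0 < m ->
    exists k : R, 0 < k /\
      forall u0 u1 : R -> R,
        initial_data m M N0 N1 u0 u1 ->
        (forall x, u1 x >= Rabs (Derive u0 x) / sqrt (u0 x)) ->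
        exists u : R -> R -> R,
          unique_conformal_solution u0 u1 u /\
          (forall t x y, 0 <= t ->
             Rabs (scalar_curvature (conformal u t) x y) <= k))
  /\
  (forall eps : R, 0 < eps ->
    exists gamma : R, 1 / 2 < gamma <= 2 /\
      forall m : R, 0 < m ->
        exists kt : R, 0 < kt /\
          forall u0 u1 : R -> R,
            initial_data m M N0 N1 u0 u1 ->
            (forall x, u1 x >= Rabs (Derive u0 x) / sqrt (u0 x) + eps) ->
            exists u : R -> R -> R,
              unique_conformal_solution u0 u1 u /\
              (forall t x y, 0 <= t ->
                 Rabs (scalar_curvature (conformal u t) x y)
                   <= kt / Rpower (1 + t) gamma)).
Proof.
  split.
  (* The constant is chosen before any data are given; the maximum with 1 makes it positive. *)
  - intros m Hm. set (Y := Rmax 1 (second_derivative_bound m N0 N1)).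
    assert (Yp : 1 <= Y) by apply Rmax_l.
    exists (Y / m). split; [apply Rdiv_lt_0_compat; lra|]. intros u0 u1 Hd Hc.
    destruct (flow_solution m M N0 N1 u0 u1 (admissible_initial_data _ _ _ _ _ _ Hm Hd Hc))
      as (u & Hu & Hlow & _ & HR).
    exists u. split; [assumption|]. intros t x y Ht. eapply Rle_trans; [now apply HR|].
    specialize (Hlow t x Ht).
    assert (second_derivative_bound m N0 N1 <= Y) by apply Rmax_r.
    assert (0 < / u t x <= / m).
    { split; [apply Rinv_0_lt_compat|apply Rinv_le_contravar]; lra. }
    apply Rle_trans with (Y / u t x).
    + apply Rmult_le_compat_r; lra.
    + apply Rmult_le_compat_l; lra.
  (* A bounded u_tt divided by a linearly growing u decays at rate 1, whatever [eps] is. *)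
  - intros eps He. exists 1. split; [lra|]. intros m Hm.
    set (Y := Rmax 1 (second_derivative_bound m N0 N1)).
    assert (Yp : 1 <= Y) by apply Rmax_l.
    (* With this [d], [m + eps t >= d (1 + t)]. *)
    set (d := Rmin m eps). assert (dp : 0 < d) by (apply Rmin_pos; lra).
    exists (Y / d). split; [apply Rdiv_lt_0_compat; lra|]. intros u0 u1 Hd Hc.
    assert (Hc' : forall x, u1 x >= Rabs (Derive u0 x) / sqrt (u0 x)) by (intros x; specialize (Hc x); lra).
    destruct (flow_solution m M N0 N1 u0 u1 (admissible_initial_data _ _ _ _ _ _ Hm Hd Hc'))
      as (u & Hu & _ & Hgrow & HR).
    exists u. split; [assumption|]. intros t x y Ht. rewrite Rpower_1 by lra.
    eapply Rle_trans; [now apply HR|].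
    specialize (Hgrow eps He Hc t x Ht).
    assert (second_derivative_bound m N0 N1 <= Y) by apply Rmax_r.
    assert (Hdu : d * (1 + t) <= u t x).
    { pose proof (Rmin_l m eps : d <= m). pose proof (Rmin_r m eps : d <= eps). nra. }
    assert (0 < d * (1 + t)) by nra.
    assert (0 < / u t x <= / (d * (1 + t))).
    { split; [apply Rinv_0_lt_compat|apply Rinv_le_contravar]; lra. }
    replace (Y / d / (1 + t)) with (Y * / (d * (1 + t))) by (field; lra).
    apply Rle_trans with (Y / u t x).
    + apply Rmult_le_compat_r; lra.
    + apply Rmult_le_compat_l; lra.
Qed.
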